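(* Let $w^*=(x^*,y^*,z^* )$ be a KKT triple, and consider the algorithm described in the context. Suppose that $w^*$ satisfies strict complementarity, LICQ and SOSC; that there are constants $0<\underline\kappa_\bullet<1<\overline\kappa_\bullet$ ($\bullet\in\{L,c,e\}$) with $\underline\kappa_\bullet\mu_k\le\varphi_\bullet(\mu_k)\le\overline\kappa_\bullet\mu_k$ for all $k\in\{0,1,2,\dots\}$; that $\mu_k^2=o(\mu_{k+1})$; that $\mu_{k+1}\le\mu_k$ for all sufficiently large $k$; that the retraction $R$ is second order; and that for every $\theta\in\{f,g_1,\dots,g_m,h_1,\dots,h_p\}$ there is $L_\theta>0$ such that, for all $x\in\mathcal M$ sufficiently close to $x^*$ and all sufficiently small $\xi\in T_x\mathcal M$, $\|\mathrm{Hess}(\theta\circ R_x)(\xi)-\mathrm{Hess}(\theta\circ R_x)(0_x)\|_{\rm op}\le L_\theta\|\xi\|_x$. Then, for any $k$-th iteration of the algorithm satisfying that $w_k$ is sufficiently close to $w^*$ and $\mu_{k-1}$ is sufficiently small, the initial point $w_{k+1}^{\rm init}$ satisfies the stopping conditions with parameter $\mu_k>0$: writing $w_{k+1}^{\rm init}=(x,y,z)$, $\|\mathrm{grad}_x\mathcal L(x,y,z)\|_x\le\varphi_L(\mu_k)$, $\|G(x)y-\mu_k\mathbf 1\|\le\varphi_c(\mu_k)$, $\|h(x)\|\le\varphi_e(\mu_k)$, $g(x)>0$ and $y>0$.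
   Context: **Problem.** $\mathcal M$ is an $n$-dimensional connected complete Riemannian manifold with metric $\langle\cdot,\cdot\rangle_x$, norm $\|\cdot\|_x$; $f,g_i\ (i\in\mathcal I=\{1,\dots,m\}),\ h_j\ (j\in\mathcal E=\{1,\dots,p\}):\mathcal M\to\mathbb R$ are twice continuously differentiable; minimize $f(x)$ subject to $g_i(x)\ge0$, $h_j(x)=0$. $w=(x,y,z)\in\mathcal M\times\mathbb R^m\times\mathbb R^p$, $\mathcal L(w)=f(x)-y^\top g(x)+z^\top h(x)$, $G(x)=\mathrm{diag}(g(x))$, $\mathbf 1$ all-ones vector; $\mathrm{grad}_x,\mathrm{Hess}_x$ are the Riemannian gradient and Hessian in $x$. **KKT.** $F(w)=[\mathrm{grad}_x\mathcal L(w);G(x)y;h(x)]$, $F(w;\mu)=F(w)-\mu[0_x;\mathbf 1;0]$. A KKT triple satisfies $F(w^* )=0$, $g(x^* )\ge0$, $y^*\ge0$. $\mathcal A(x^* )=\{i:g_i(x^* )=0\}$. Strict complementarity: for every $i$ exactly one of $y_i^*,g_i(x^* )$ is zero. LICQ: $\{\mathrm{grad}\,g_i(x^* )\}_{i\in\mathcal A(x^* )}\cup\{\mathrm{grad}\,h_j(x^* )\}_{j\in\mathcal E}$ is linearly independent. SOSC: $\langle\mathrm{Hess}_x\mathcal L(w^* )[\xi],\xi\rangle>0$ for all nonzero $\xi\in T_{x^*}\mathcal M$ with $\langle\mathrm{grad}\,g_i(x^* ),\xi\rangle=0$ for $i\in\mathcal A(x^* )$ with $y_i^*>0$, $\ge0$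 for $i\in\mathcal A(x^* )$ with $y_i^*=0$, and $\langle\mathrm{grad}\,h_j(x^* ),\xi\rangle=0$ for $j\in\mathcal E$. **Jacobian.** $J_F(w)$ maps $(d_x,d_y,d_z)\in T_x\mathcal M\times\mathbb R^m\times\mathbb R^p$ to $[\mathrm{Hess}_x\mathcal L(w)[d_x]-\sum_i (d_y)_i\,\mathrm{grad}\,g_i(x)+\sum_j(d_z)_j\,\mathrm{grad}\,h_j(x);\ (y_i\langle\mathrm{grad}\,g_i(x),d_x\rangle_x+g_i(x)(d_y)_i)_i;\ (\langle\mathrm{grad}\,h_j(x),d_x\rangle_x)_j]$. **Retraction.** $R:T\mathcal M\to\mathcal M$ smooth with $R_x(0_x)=x$, $\mathrm DR_x(0_x)=\mathrm{id}$; second order if each curve $t\mapsto R_x(t\xi)$ has zero acceleration at $t=0$. $\mathrm{Hess}(\theta\circ R_x)$ is the Hessian on the Euclidean space $T_x\mathcal M$. **Algorithm.** A forcing function is a continuous $\varphi:[0,\infty)\to[0,\infty)$ with $\varphi(\mu)=0$ iff $\mu=0$; $\varphi_L,\varphi_c,\varphi_e$ are given forcing functions. $\mathcal F^\circ=\{x:g(x)>0\}$. Input: $w_0\in\mathcal F^\circ\times\mathbb R^m_{++}\times\mathbb R^p$, $\mu_{-1}>0$. For $k=0,1,\dots$: set $\mu_k>0$ so that $\lim_{k\to\infty}\mu_k=0$; compute the initial point $w_{k+1}^{\rm init}=(R_{x_k}(d_x),y_k+d_y,z_k+d_z)$ with $(d_x,d_y,d_z)=-J_F(w_k)^{-1}F(w_k;\mu_k)$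 (used at any iteration where $J_F(w_k)$ is nonsingular and the point lies in $\mathcal F^\circ\times\mathbb R^m_{++}\times\mathbb R^p$); then, by an arbitrary inner iteration started from it, compute $w_{k+1}$ satisfying the stopping conditions with parameter $\mu_k$: $\|\mathrm{grad}_x\mathcal L(w_{k+1})\|_{x_{k+1}}\le\varphi_L(\mu_k)$, $\|G(x_{k+1})y_{k+1}-\mu_k\mathbf 1\|\le\varphi_c(\mu_k)$, $\|h(x_{k+1})\|\le\varphi_e(\mu_k)$, $g(x_{k+1})>0$, $y_{k+1}>0$. **Notation.** $a=o(b)$ means $a/b\to0$. *)

(* Defs.v *)
From HB Require Import structures.
From mathcomp Require Import all_boot all_order all_algebra.
From mathcomp Require Import all_classical all_reals all_analysis.

Set Implicit Arguments.
Unset Strict Implicit.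
Unset Printing Implicit Defensive.

Import Order.TTheory GRing.Theory Num.Theory.
Import numFieldNormedType.Exports.

Local Open Scope classical_set_scope.
Local Open Scope ring_scope.

(* In finite dimension, [f] is C^k on the open set [U] iff all its iterated
   directional derivatives of order at most [k] exist and are continuous. *)
Fixpoint Ck (R : realType) (V W : normedModType R) (k : nat) (U : set V)
    (f : V -> W) : Prop :=
  (forall u, U u -> {for u, continuous f}) /\
  (if k is k'.+1 then
     forall v, (forall u, U u -> derivable f u v) /\ Ck k' U ('D_v f)
   else True).

Definition smooth (R : realType) (V W : normedModType R) (U : set V)
    (f : V -> W) : Prop := forall k, Ck k U f.

Definition dotm (R : realType) (n : nat) (G : 'M[R]_n) (v w : 'rV[R]_n) : R :=
  (v *m G *m w^T) 0 0.

Definition enorm (R : realType) (n : nat) (v : 'rV[R]_n) : R :=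
  Num.sqrt (\sum_(i < n) v 0 i ^+ 2).

Section Manifold.
Variables (R : realType) (n : nat).

Record chart (T : topologicalType) := Chart {
  cdom : set T;
  cfun :> T -> 'rV[R]_n;
  cinv : 'rV[R]_n -> T;
  cdom_open : open cdom;
  cimg_open : open (cfun @` cdom);
  cfunK : forall x, cdom x -> cinv (cfun x) = x;
  cfun_continuous : forall x, cdom x -> {for x, continuous cfun};
  cinv_continuous : forall u, (cfun @` cdom) u -> {for u, continuous cinv} }.

Definition cimg (T : topologicalType) (c : chart T) : set 'rV[R]_n :=
  c @` cdom c.

(* The atlas is given by one chart [chart_at p] around each point [p]: every
   smooth structure is generated by such an atlas.  The tangent space T_p M is
   'rV[R]_n, a tangent vector being represented by its coordinates in the
   preferred chart [chart_at p].
   [metric p u] is the Gram matrix, in the chart [chart_at p], of the inner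
   product of the tangent space at the point of coordinates [u]; [metric_tensor]
   says that these matrices are the expressions of one tensor field on M. *)
Record riemannianManifold := RiemannianManifold {
  carrier :> topologicalType;
  carrier_hausdorff : hausdorff_space carrier;
  carrier_second_countable : @second_countable carrier;
  chart_at : carrier -> chart carrier;
  chart_at_dom : forall p, cdom (chart_at p) p;
  chart_smooth : forall p q,
    smooth (chart_at p @` (cdom (chart_at p) `&` cdom (chart_at q)))
           (chart_at q \o cinv (chart_at p));
  metric : carrier -> 'rV[R]_n -> 'M[R]_n;
  metric_smooth : forall p, smooth (cimg (chart_at p)) (metric p);
  metric_sym : forall p u, cimg (chart_at p) u -> (metric p u)^T = metric p u;
  metric_posdef : forall p u, cimg (chart_at p) u ->
    forall v, v != 0 -> 0 < dotm (metric p u) v v;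
  metric_tensor : forall p q u,
    (chart_at p @` (cdom (chart_at p) `&` cdom (chart_at q))) u ->
    let tau := chart_at q \o cinv (chart_at p) in
    forall v w, dotm (metric p u) v w =
                dotm (metric q (tau u)) ('D_v tau u) ('D_w tau u) }.

Variable M : riemannianManifold.
Implicit Types (x p : M) (u v w : 'rV[R]_n) (f : M -> R).

Definition coord x : 'rV[R]_n := chart_at x x.

Definition gram x : 'M[R]_n := metric x (coord x).

Definition inner x v w : R := dotm (gram x) v w.

Definition rnorm x v : R := Num.sqrt (inner x v v).

Definition CkM (k : nat) f : Prop :=
  forall p, Ck k (cimg (chart_at p)) (f \o cinv (chart_at p)).

Definition pd (W : normedModType R) (i : 'I_n) (F : 'rV[R]_n -> W) u : W :=
  'D_(delta_mx 0 i) F u.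

(* Gradient of [F], defined on an open subset of 'rV[R]_n, with respect to the
   metric [G]. *)
Definition mgrad (G : 'rV[R]_n -> 'M[R]_n) (F : 'rV[R]_n -> R) u : 'rV[R]_n :=
  (\row_i pd i F u) *m invmx (G u).

Definition grad f x : 'rV[R]_n :=
  mgrad (metric x) (f \o cinv (chart_at x)) (coord x).

(* Christoffel symbols Gamma^k_ij of the Levi-Civita connection, at the point of
   coordinates [u] of the chart [chart_at p]. *)
Definition christoffel p u (k i j : 'I_n) : R :=
  2^-1 * \sum_(l < n) invmx (metric p u) k l *
    (pd i (fun a => metric p a j l) u + pd j (fun a => metric p a i l) u
     - pd l (fun a => metric p a i j) u).

Definition christoffel_app p u v w : 'rV[R]_n :=
  \row_k \sum_(i < n) \sum_(j < n) christoffel p u k i j * v 0 i * w 0 j.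

(* Covariant derivative along [v], a tangent vector at [x], of the vector field
   whose expression in [chart_at x] is [X]. *)
Definition covariant x v (X : 'rV[R]_n -> 'rV[R]_n) : 'rV[R]_n :=
  'D_v X (coord x) + christoffel_app x (coord x) v (X (coord x)).

Definition hess f x v : 'rV[R]_n :=
  covariant x v (mgrad (metric x) (f \o cinv (chart_at x))).

Definition curve_smooth (c : R -> M) : Prop :=
  forall p, open (c @^-1` cdom (chart_at p)) /\
            smooth (c @^-1` cdom (chart_at p)) (chart_at p \o c).

Definition velocity (c : R -> M) (t : R) : 'rV[R]_n :=
  derive1n 1 (chart_at (c t) \o c) t.

Definition acceleration (c : R -> M) (t : R) : 'rV[R]_n :=
  derive1n 2 (chart_at (c t) \o c) t +
  christoffel_app (c t) (coord (c t)) (velocity c t) (velocity c t).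

(* Geodesic completeness (equivalent to metric completeness when M is connected,
   by the Hopf-Rinow theorem). *)
Definition complete_manifold : Prop :=
  forall x v, exists c : R -> M,
    [/\ curve_smooth c, c 0 = x, velocity c 0 = v
      & forall t, acceleration c t = 0].

(* The tangent vector at [cinv (chart_at p) u] whose coordinates in [chart_at p]
   are [v], expressed in the preferred chart of that point. *)
Definition tangent_of p u v : 'rV[R]_n :=
  'D_v (chart_at (cinv (chart_at p) u) \o cinv (chart_at p)) u.

(* [rt] is expressed on the chart (u, v) of TM induced by [chart_at p]. *)
Definition retr_local (rt : M -> 'rV[R]_n -> M) p (a : 'rV[R]_n * 'rV[R]_n) : M :=
  rt (cinv (chart_at p) a.1) (tangent_of p a.1 a.2).

(* For each p and q, [retr_dom rt p q] is open and [rt] is smooth there, read in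
   charts: this is continuity and smoothness of [rt] as a map TM -> M. *)
Definition retr_dom (rt : M -> 'rV[R]_n -> M) p (q : M) :
    set ('rV[R]_n * 'rV[R]_n) :=
  [set a | cimg (chart_at p) a.1 /\ cdom (chart_at q) (retr_local rt p a)].

Definition retr_smooth (rt : M -> 'rV[R]_n -> M) : Prop :=
  forall p q, open (retr_dom rt p q) /\
              smooth (retr_dom rt p q) (chart_at q \o retr_local rt p).

Definition retraction (rt : M -> 'rV[R]_n -> M) : Prop :=
  [/\ retr_smooth rt, forall x, rt x 0 = x
    & forall x v, 'D_v (chart_at x \o rt x) 0 = v].

Definition second_order (rt : M -> 'rV[R]_n -> M) : Prop :=
  forall x v, acceleration (fun t : R => rt x (t *: v)) 0 = 0.

(* Hessian at [v], applied to [d], of [F] on the Euclidean space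
   (T_x M, inner x). *)
Definition ehess x (F : 'rV[R]_n -> R) v (d : 'rV[R]_n) : 'rV[R]_n :=
  'D_d (mgrad (fun=> gram x) F) v.

Definition opnorm x (A : 'rV[R]_n -> 'rV[R]_n) : R :=
  sup [set rnorm x (A v) | v in [set v | rnorm x v <= 1]].

Definition pullback_hess_lipschitz (rt : M -> 'rV[R]_n -> M) (xs : M) f : Prop :=
  exists L r : R, [/\ 0 < L, 0 < r &
    \forall x \near xs, forall xi : 'rV[R]_n, rnorm x xi < r ->
      opnorm x (fun d => ehess x (f \o rt x) xi d - ehess x (f \o rt x) 0 d)
        <= L * rnorm x xi].

End Manifold.

Arguments inner {R n M} x v w.
Arguments rnorm {R n M} x v.
Arguments grad {R n M} f x.
Arguments hess {R n M} f x v.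

Section Problem.
Variables (R : realType) (n m p : nat) (M : riemannianManifold R n).

(* minimize [obj x] subject to [ineqc i x >= 0] and [eqc j x = 0] *)
Record nlp := Nlp {
  obj : M -> R;
  ineqc : 'I_m -> M -> R;
  eqc : 'I_p -> M -> R }.

Variable P : nlp.

Definition nlp_C2 : Prop :=
  [/\ CkM 2 (obj P), forall i, CkM 2 (ineqc P i) & forall j, CkM 2 (eqc P j)].

Definition triple : Type := (M * 'rV[R]_m * 'rV[R]_p)%type.
Definition direction : Type := ('rV[R]_n * 'rV[R]_m * 'rV[R]_p)%type.

Definition lagrangian (y : 'rV[R]_m) (z : 'rV[R]_p) (x : M) : R :=
  obj P x - \sum_(i < m) y 0 i * ineqc P i x + \sum_(j < p) z 0 j * eqc P j x.

Definition gradL (w : triple) : 'rV[R]_n :=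
  let: (x, y, z) := w in grad (lagrangian y z) x.

Definition hessL (w : triple) (v : 'rV[R]_n) : 'rV[R]_n :=
  let: (x, y, z) := w in hess (lagrangian y z) x v.

Definition compl (w : triple) : 'rV[R]_m :=
  let: (x, y, _) := w in \row_i (ineqc P i x * y 0 i).

Definition eqvec (x : M) : 'rV[R]_p := \row_j eqc P j x.

Definition kktF (w : triple) : 'rV[R]_n * 'rV[R]_m * 'rV[R]_p :=
  (gradL w, compl w, eqvec w.1.1).

Definition kktFmu (w : triple) (mu : R) : 'rV[R]_n * 'rV[R]_m * 'rV[R]_p :=
  kktF w - mu *: (0, const_mx 1, 0).

Definition kktJ (w : triple) (d : direction) :
    'rV[R]_n * 'rV[R]_m * 'rV[R]_p :=
  let: (x, y, z) := w in
  let: (dx, dy, dz) := d in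
  (hessL w dx - \sum_(i < m) dy 0 i *: grad (ineqc P i) x
     + \sum_(j < p) dz 0 j *: grad (eqc P j) x,
   \row_i (y 0 i * inner x (grad (ineqc P i) x) dx + ineqc P i x * dy 0 i),
   \row_j inner x (grad (eqc P j) x) dx).

Definition nonsingular (w : triple) : Prop := bijective (kktJ w).

Definition kkt_triple (w : triple) : Prop :=
  [/\ kktF w = 0, forall i, 0 <= ineqc P i w.1.1 & forall i, 0 <= w.1.2 0 i].

Definition active (x : M) (i : 'I_m) : bool := ineqc P i x == 0.

Definition strict_complementarity (w : triple) : Prop :=
  forall i, (w.1.2 0 i == 0) (+) (ineqc P i w.1.1 == 0).

Definition licq (x : M) : Prop :=
  free ([seq grad (ineqc P i) x | i <- enum 'I_m & active x i]
        ++ [seq grad (eqc P j) x | j <- enum 'I_p]).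

Definition sosc (w : triple) : Prop :=
  let: (x, y, _) := w in
  forall xi : 'rV[R]_n, xi != 0 ->
    (forall i, active x i -> 0 < y 0 i -> inner x (grad (ineqc P i) x) xi = 0) ->
    (forall i, active x i -> y 0 i = 0 -> 0 <= inner x (grad (ineqc P i) x) xi) ->
    (forall j, inner x (grad (eqc P j) x) xi = 0) ->
    0 < inner x (hessL w xi) xi.

Definition forcing (phi : R -> R) : Prop :=
  [/\ {within [set mu : R | 0 <= mu], continuous phi},
      forall mu, 0 <= mu -> 0 <= phi mu
    & forall mu, 0 <= mu -> (phi mu = 0 <-> mu = 0)].

Definition strictly_feasible (w : triple) : Prop :=
  (forall i, 0 < ineqc P i w.1.1) /\ (forall i, 0 < w.1.2 0 i).

Definition stopping (phiL phic phie : R -> R) (mu : R) (w : triple) : Prop :=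
  [/\ rnorm w.1.1 (gradL w) <= phiL mu,
      enorm (compl w - mu *: const_mx 1) <= phic mu,
      enorm (eqvec w.1.1) <= phie mu
    & strictly_feasible w].

(* [is_init rt w mu v]: [v] is the initial point computed from the iterate [w]
   with barrier parameter [mu]; it is unique when [nonsingular w]. *)
Definition is_init (rt : M -> 'rV[R]_n -> M) (w : triple) (mu : R)
    (v : triple) : Prop :=
  exists d : direction, kktJ w d = - kktFmu w mu /\
    v = (rt w.1.1 d.1.1, w.1.2 + d.1.2, w.2 + d.2).

(* The inner iteration being arbitrary, a run of the algorithm with parameters
   [mu] is any sequence of iterates satisfying these conditions. *)
Definition algorithm_run (phiL phic phie : R -> R) (mu : nat -> R)
    (w : nat -> triple) : Prop :=
  strictly_feasible (w 0) /\
  forall k, stopping phiL phic phie (mu k) (w k.+1).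

(* mu_{k-1}, where [mum1] stands for mu_{-1} *)
Definition mu_prev (mum1 : R) (mu : nat -> R) (k : nat) : R :=
  if k is k'.+1 then mu k' else mum1.

Definition comparable_param (phi : R -> R) (mu : nat -> R) : Prop :=
  exists lo hi : R, [/\ 0 < lo, lo < 1, 1 < hi
    & forall k, lo * mu k <= phi (mu k) /\ phi (mu k) <= hi * mu k].

End Problem.

(* Main.v *)
(* Let u and v be the coordinates, in the chart at x*, of a point x near x* and of
   a tangent vector at x, and let T_theta(u, v) = theta(R_x(v)).  Then
   grad theta(x) and, since R is of second order, Hess theta(x) are represented
   by the first and second derivatives of T_theta in v at v = 0.  Hence J_F
   becomes an operator depending continuously on (u, y, z); LICQ, SOSC and strict
   complementarity make it injective at w*, so near w* it is invertible with a
   uniformly bounded inverse.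

   By the stopping conditions ||F(w_k; mu_k)|| = O(mu_{k-1}), so the Newton
   direction d is O(mu_{k-1}).  Expanding T_theta along d, the Newton equation
   cancels the terms of order at most one, and the remainders are O(||d||^2):
   for grad_x L this uses the Lipschitz continuity of the Hessians of the
   pullbacks, and that DR_x is close to the identity.  So the residuals at the
   new point are O(mu_{k-1}^2) = o(mu_k).  Consequently g_i y_i > 0 there, and
   by strict complementarity one of the two factors is bounded away from 0. *)
Require Import Defs.
From HB Require Import structures.
From mathcomp Require Import all_boot all_order all_algebra.
From mathcomp Require Import all_classical all_reals all_analysis.
From mathcomp Require Import ring lra.
Import Order.TTheory GRing.Theory Num.Theory.
Import numFieldNormedType.Exports.
Local Open Scope classical_set_scope.
Local Open Scope ring_scope.

Set Implicit Arguments.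
Unset Strict Implicit.
Unset Printing Implicit Defensive.

(** * Directional derivatives and C^k maps *)

(** The tangent space at [x] is written in the preferred chart of [x], which varies with [x] without
    any continuity, so gradients and Hessians at different points cannot be compared as row vectors.
    They are tested instead, through [inner], against the images under [tangent_of] of fixed
    coordinate vectors, and [rnorm x] is compared with the coordinate norm uniformly near x*, the
    Gram matrix in the chart at x* being continuous and positive definite. [Ck] speaks only of
    directional derivatives. The chain rule and linearity in the direction come from the
    differentiability of C^1 functions on row vectors; the second-order condition, which concerns
    one direction at a time, is polarized by means of the symmetry of second derivatives. The
    gradient at the new point lives in yet another tangent space and is recovered from fibre
    derivatives at [(u, v)]. Smallness of mu_{k-1} is used as largeness of [k]: no parameter
    preceding the asymptotic regime is smaller than [eps]. *)

Section Calculus.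
Variable R : realType.
Implicit Types V W : normedModType R.

(* A directional derivative only depends on the restriction of the map to a
   line; this moves derivatives between charts and tangent spaces for free. *)
Lemma eq_line V (V' : normedModType R) W (f : V -> W) (g : V' -> W) a v b w :
  (forall t : R, f (t *: v + a) = g (t *: w + b)) ->
  (derivable f a v <-> derivable g b w) /\ 'D_v f a = 'D_w g b.
Proof.
move=> fg.
have fg0 : f a = g b by have := fg 0; rewrite !scale0r !add0r.
have E : (fun h : R => h^-1 *: ((f \o shift a) (h *: v) - f a)) =
         (fun h : R => h^-1 *: ((g \o shift b) (h *: w) - g b)).
  by apply/funext => h /=; rewrite fg fg0.
by rewrite /derivable /derive E.
Qed.

Lemma eq_derive_line V (V' : normedModType R) W (f : V -> W) (g : V' -> W)
    a v b w :
  (forall t : R, f (t *: v + a) = g (t *: w + b)) -> 'D_v f a = 'D_w g b.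
Proof. by case/eq_line. Qed.

Lemma is_derive_line V (V' : normedModType R) W (f : V -> W) (g : V' -> W)
    a v b w :
  (forall t : R, f (t *: v + a) = g (t *: w + b)) ->
  derivable g b w -> is_derive a v f ('D_w g b).
Proof. by move=> /eq_line[fg <-] /fg; exact: derivableP. Qed.

(** Only derivability along [v] is assumed, so no differential of [f] is at hand. The restriction of
    [f] to the line is a function of one real variable, for which derivability and differentiability
    agree. *)
Lemma is_derive_dirZ V W (f : V -> W) a v (k : R) :
  derivable f a v -> is_derive a (k *: v) f (k *: 'D_v f a).
Proof.
move=> fav; pose g (t : R) := f (t *: v + a).
have dg : differentiable g 0 by apply/derivable1_diffP; rewrite -derivable1P.
have -> : 'D_v f a = 'D_1 g 0.
  by apply: eq_derive_line => t; rewrite /g addr0 [t%:A]mulr1.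
rewrite (deriveE _ dg) -linearZ -deriveE// [k%:A]mulr1.
apply: is_derive_line; last exact: diff_derivable.
by move=> t; rewrite /g addr0 scalerA.
Qed.

(** The inner map need only be derivable along [v]: the chain rule is applied to the curve that [g]
    traces over the line. *)
Lemma is_derive_comp V (V' : normedModType R) W (F : V' -> W) (g : V -> V') a v :
  derivable g a v -> differentiable F (g a) ->
  is_derive a v (F \o g) ('D_('D_v g a) F (g a)).
Proof.
move=> gav dF; pose c (t : R) := g (t *: v + a).
have c0 : c 0 = g a by rewrite /c scale0r add0r.
have dc : differentiable c 0 by apply/derivable1_diffP; rewrite -derivable1P.
have dFc : differentiable F (c 0) by rewrite c0.
have -> : 'D_v g a = 'D_1 c 0.
  by apply: eq_derive_line => t; rewrite /c addr0 [t%:A]mulr1.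
have -> : 'D_('D_1 c 0) F (g a) = 'D_1 (F \o c) 0.
  rewrite [RHS]deriveE; last exact: differentiable_comp.
  by rewrite diff_comp//= c0 !deriveE.
apply: is_derive_line; last exact/diff_derivable/differentiable_comp.
by move=> t; rewrite /c /= addr0 [t%:A]mulr1.
Qed.

Lemma MVT_line V (F : V -> R) a v :
  (forall s : R, 0 <= s <= 1 -> derivable F (a + s *: v) v) ->
  exists2 s : R, 0 <= s <= 1 & F (a + v) - F a = 'D_v F (a + s *: v).
Proof.
move=> dF; pose g (s : R) := F (a + s *: v).
have dg (s : R) : 0 <= s <= 1 -> is_derive s 1 g ('D_v F (a + s *: v)).
  move=> /dF; apply: is_derive_line => t.
  by rewrite /g [t%:A]mulr1 scalerDl addrCA.
have [s|s sab|s s01] := @MVT_segment _ g (fun s : R => 'D_v F (a + s *: v)) 0 1 ler01.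
- by rewrite in_itv/= => /andP[s0 s1]; apply: dg; rewrite !ltW.
- move: s sab; apply: (@derivable_within_continuous _ _ g `[0, 1]%R) => s.
  by rewrite in_itv/= => /dg[].
- rewrite /g scale1r scale0r addr0 subr0 mulr1 => ->.
  by exists s => //; rewrite in_itv in s01.
Qed.

Lemma mx_norm_le_entries m n (A : 'M[R]_(m, n)) (c : R) :
  0 <= c -> (forall i j, `|A i j| <= c) -> `|A| <= c.
Proof.
by move=> c0 Ac; rewrite [leLHS]/Num.Def.normr/= mx_normrE; apply/bigmax_leP; split.
Qed.

Lemma mx_entry_le m n (A : 'M[R]_(m, n)) i j : `|A i j| <= `|A|.
Proof. by rewrite [leRHS]/Num.Def.normr/= mx_normrE (le_bigmax _ _ (i, j)). Qed.

Lemma linear_rV_norm_le n V (f : 'rV[R]_n -> V) : linear f ->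
  forall v, `|f v| <= (\sum_i `|f (delta_mx 0 i)|) * `|v|.
Proof.
move=> lf v; pose fL := GRing.isLinear.Build _ _ _ _ f lf.
pose g : {linear 'rV[R]_n -> V} := HB.pack f fL.
rewrite -[f]/(g : _ -> _) {1}(row_sum_delta v) linear_sum.
rewrite (le_trans (ler_norm_sum _ _ _))// mulr_suml ler_sum// => i _.
by rewrite linearZ normrZ mulrC ler_wpM2l// mx_entry_le.
Qed.

Lemma linear_rV_continuous n V (f : 'rV[R]_n -> V) : linear f -> continuous f.
Proof.
move=> lf; pose fL := GRing.isLinear.Build _ _ _ _ f lf.
pose g : {linear 'rV[R]_n -> V} := HB.pack f fL.
rewrite -[f]/(g : _ -> _); apply: bounded_linear_continuous.
apply/linear_boundedP; exists (\sum_i `|f (delta_mx 0 i)|); split; first exact: num_real.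
by move=> r /ltW sr v; rewrite (le_trans (@linear_rV_norm_le _ _ f lf v))// ler_wpM2r.
Qed.

(* Change the coordinates of the increment one at a time and apply the mean
   value theorem to each change. *)
Lemma C1_differentiable n (U : set 'rV[R]_n) (F : 'rV[R]_n -> R) u :
  open U -> Ck 1 U F -> U u ->
  differentiable F u /\
  forall v, 'D_v F u = \sum_i v 0 i * pd i F u.
Proof.
move=> oU [_ dF] Uu.
pose df (v : 'rV[R]_n) : R := \sum_i v 0 i * pd i F u.
have ldf : linear df.
  move=> k a b; rewrite /df scaler_sumr -big_split; apply: eq_bigr => i _ /=.
  by rewrite !mxE mulrDl scalerAl.
pose fL := GRing.isLinear.Build _ _ _ _ df ldf.
pose g : {linear 'rV[R]_n -> R} := HB.pack df fL.
have cg : continuous g by exact: (@linear_rV_continuous _ _ df).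
have dFg : F \o shift u = cst (F u) + g +o_ (0 : 'rV[R]_n) id.
  apply/eqaddoP => _/posnumP[e].
  (* Each of the [n] coordinate changes will cost at most [|h| * e']; [n.+1] keeps the divisor
     nonzero when [n = 0]. *)
  pose e' := e%:num / n.+1%:R.
  have e'0 : 0 < e' by rewrite divr_gt0.
  have : \forall a \near u, U a /\ forall i, `|pd i F u - pd i F a| <= e'.
    near=> a; split; first by near: a; exact: open_nbhs_nbhs.
    near: a; apply: filter_forall => i; near=> a; near: a.
    have /= := (dF (delta_mx 0 i)).2.1 u Uu.
    by move=> /cvgrPdist_le/(_ _ e'0).
  rewrite -nbhs_nearE => /nbhs_ballP[r /= r0 Hr].
  have : \forall h \near (0 : 'rV[R]_n), `|h| < r by exact: nbhs0_lt.
  apply: filterS => h hr.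
  rewrite /= /cst !fctE/=.
  (* [tr k] keeps the first [k] coordinates of [h]. The norm being the sup norm, all the
     intermediate points remain within [|h|] of [u]. *)
  pose tr k := \row_(i < n) (h 0 i *+ (i < k)) : 'rV[R]_n.
  have trS (k : 'I_n) : tr k.+1 = tr k + h 0 k *: delta_mx 0 k.
    apply/rowP => j; rewrite !mxE eqxx/= ltnS leq_eqVlt.
    have [->|jk] := eqVneq j k; first by rewrite eqxx ltnn mulr1 add0r.
    have -> : (j == k :> nat) = false by exact: negbTE.
    by rewrite mulr0 addr0.
  have trball (k : 'I_n) s : 0 <= s <= 1 ->
      ball u r (u + tr k + s *: (h 0 k *: delta_mx 0 k)).
    move=> /andP[s0 s1]; rewrite -ball_normE/= -!addrA opprD addNKr normrN.
    apply: le_lt_trans hr; apply: mx_norm_le_entries => // i j.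
    rewrite ord1 !mxE eqxx/=.
    have [->|jk] := eqVneq j k.
      rewrite ltnn mulr0n add0r mulr1 normrM ger0_norm//.
      by rewrite (le_trans _ (mx_entry_le h 0 k))// ler_piMl.
    rewrite !mulr0 addr0 (le_trans _ (mx_entry_le h 0 j))//.
    by case: (j < k)%N; rewrite ?mulr0n ?normr0.
  have step (k : 'I_n) : `|F (u + tr k.+1) - F (u + tr k) - h 0 k * pd k F u|
      <= `|h| * e'.
    have [s s01|s s01] := @MVT_line _ F (u + tr k) (h 0 k *: delta_mx 0 k).
      have [? _] := Hr _ (trball k s s01).
      by apply: ex_derive; apply: is_derive_dirZ; apply: (dF _).1.
    have [Us Hs] := Hr _ (trball k s s01).
    rewrite -addrA -trS => ->.
    have [_ ->] := is_derive_dirZ (h 0 k) ((dF (delta_mx 0 k)).1 _ Us).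
    rewrite -[_ *: _]/(_ * _) -mulrBr normrM ler_pM ?mx_entry_le//.
    by rewrite distrC Hs.
  have tr0 : tr 0%N = 0 by apply/rowP => j; rewrite !mxE ltn0.
  have trn : tr n = h by apply/rowP => j; rewrite !mxE ltn_ord.
  have -> : F (h + u) - (F u + df h) =
      \sum_(k < n) (F (u + tr k.+1) - F (u + tr k) - h 0 k * pd k F u).
    rewrite sumrB -(big_mkord xpredT (fun k => F (u + tr k.+1) - F (u + tr k))).
    by rewrite telescope_sumr// tr0 trn addr0 opprD addrA (addrC h).
  rewrite (le_trans (ler_norm_sum _ _ _))//.
  rewrite (le_trans (ler_sum _ (fun k _ => step k)))// sumr_const card_ord.
  rewrite -mulr_natr -mulrA [leRHS]mulrC ler_wpM2l// /e' mulrAC ler_pdivrMr//.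
  by rewrite ler_wpM2l// ler_nat leqnSn.
have E := diff_unique cg dFg.
have dfF : differentiable F u.
  apply/diff_locallyP; rewrite E; split => //.
by split=> // v; rewrite deriveE// E.
Unshelve. all: by end_near. Qed.

End Calculus.

(** * Closure properties of C^k maps *)

Section CkTheory.
Variable R : realType.
Implicit Types V W : normedModType R.

Lemma Ck_continuous V W k (U : set V) (f : V -> W) u :
  Ck k U f -> U u -> {for u, continuous f}.
Proof. by case: k => [|k] /= [] + _ => /[apply]. Qed.

Lemma Ck_derivable V W k (U : set V) (f : V -> W) u v :
  Ck k.+1 U f -> U u -> derivable f u v.
Proof. by move=> /= [_ /(_ v)[+ _]] => /[apply]. Qed.

Lemma Ck_derive V W k (U : set V) (f : V -> W) v :
  Ck k.+1 U f -> Ck k U ('D_v f).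
Proof. by move=> /= [_ /(_ v)[]]. Qed.

Lemma CkW V W k (U : set V) (f : V -> W) : Ck k.+1 U f -> Ck k U f.
Proof.
elim: k f => [|k IH] f Cf; first by split => // u; exact: (Ck_continuous Cf).
split; first by move=> u; exact: (Ck_continuous Cf).
move=> v; split; first by move=> u Uu; exact (Ck_derivable Cf Uu).
exact/IH/Ck_derive.
Qed.

Lemma Ck_le V W j k (U : set V) (f : V -> W) :
  (j <= k)%N -> Ck k U f -> Ck j U f.
Proof.
elim: k => [|k IH]; first by rewrite leqn0 => /eqP->.
by rewrite leq_eqVlt => /predU1P[->//|/IH {}IH] /CkW /IH.
Qed.

Lemma near_eqfun V W (U : set V) (f g : V -> W) u :
  open U -> (forall u, U u -> f u = g u) -> U u -> {near u, f =1 g}.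
Proof.
move=> oU fg Uu; have : \forall x \near u, U x by exact: open_nbhs_nbhs.
exact: filterS.
Qed.

Lemma derive_eq_open V W (U : set V) (f g : V -> W) u v :
  open U -> (forall u, U u -> f u = g u) -> U u -> 'D_v f u = 'D_v g u.
Proof. by move=> oU fg Uu; apply: near_eq_derive; exact: (near_eqfun oU fg). Qed.

Lemma derivable_eq_open V W (U : set V) (f g : V -> W) u v :
  open U -> (forall u, U u -> f u = g u) -> U u ->
  derivable f u v -> derivable g u v.
Proof. by move=> oU fg Uu; apply: near_eq_derivable; exact: (near_eqfun oU fg). Qed.

Lemma continuous_eq_open V W (U : set V) (f g : V -> W) u :
  open U -> (forall u, U u -> f u = g u) -> U u ->
  {for u, continuous f} -> {for u, continuous g}.
Proof.
move=> oU fg Uu; rewrite /prop_for /continuous_at -(fg u Uu) => cf.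
apply: cvg_trans cf; apply: near_eq_cvg; exact: (near_eqfun oU fg).
Qed.

Lemma Ck_eq V W k (U : set V) (f g : V -> W) :
  open U -> (forall u, U u -> f u = g u) -> Ck k U f -> Ck k U g.
Proof.
move=> oU; elim: k f g => [|k IH] f g fg [cf df].
  by split => // u Uu; apply: (continuous_eq_open oU fg) => //; exact: cf.
split; first by move=> u Uu; apply: (continuous_eq_open oU fg) => //; exact: cf.
move=> v; split.
  by move=> u Uu; apply: (derivable_eq_open oU fg) => //; exact: (df v).1.
apply: IH (df v).2 => u Uu; exact: (derive_eq_open v oU fg).
Qed.

Lemma Ck_cst V W k (U : set V) (c : W) : Ck k U (fun=> c).
Proof.
elim: k c => [|k IH] c; split => //; try by move=> u _; exact: cst_continuous.
move=> v; split; first by move=> u _; exact: derivable_cst.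
have -> : 'D_v (fun=> c) = (fun=> 0) :> (V -> W).
  by apply/funext => u; exact: derive_cst.
exact: IH.
Qed.

Lemma Ck_add V W k (U : set V) (f g : V -> W) :
  open U -> Ck k U f -> Ck k U g -> Ck k U (fun x => f x + g x).
Proof.
move=> oU; elim: k f g => [|k IH] f g Cf Cg; split => //.
- by move=> u Uu; apply: cvgD; [exact: (Ck_continuous Cf)|exact: (Ck_continuous Cg)].
- by move=> u Uu; apply: cvgD; [exact: (Ck_continuous Cf)|exact: (Ck_continuous Cg)].
- move=> v; split.
  by move=> u Uu; apply: derivableD; [exact (Ck_derivable Cf Uu)|exact (Ck_derivable Cg Uu)].
apply: (@Ck_eq _ _ _ _ (fun x => 'D_v f x + 'D_v g x) _ oU).
  move=> u Uu; rewrite -[RHS]/('D_v (f + g) u) deriveD//.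
    exact (Ck_derivable Cf Uu).
  exact (Ck_derivable Cg Uu).
by apply: IH; exact: Ck_derive.
Qed.

Lemma Ck_sum V W k (U : set V) I (r : seq I) (P : pred I) (f : I -> V -> W) :
  open U -> (forall i, Ck k U (f i)) ->
  Ck k U (fun x => \sum_(i <- r | P i) f i x).
Proof.
move=> oU Cf; elim: r => [|i r IH].
  by apply: (@Ck_eq _ _ _ _ (fun=> 0) _ oU); [move=> u _; rewrite big_nil|exact: Ck_cst].
apply: (@Ck_eq _ _ _ _ (fun x => (if P i then f i x else 0) + \sum_(j <- r | P j) f j x) _ oU).
  by move=> u _; rewrite big_cons; case: ifP => //; rewrite add0r.
apply: Ck_add => //; case: (P i) => //; exact: Ck_cst.
Qed.

Lemma Ck_mul V k (U : set V) (f g : V -> R) :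
  open U -> Ck k U f -> Ck k U g -> Ck k U (fun x => f x * g x).
Proof.
move=> oU; elim: k f g => [|k IH] f g Cf Cg; split => //.
- by move=> u Uu; apply: cvgM; [exact: (Ck_continuous Cf)|exact: (Ck_continuous Cg)].
- by move=> u Uu; apply: cvgM; [exact: (Ck_continuous Cf)|exact: (Ck_continuous Cg)].
- move=> v; split.
  by move=> u Uu; apply: derivableM; [exact (Ck_derivable Cf Uu)|exact (Ck_derivable Cg Uu)].
apply: (@Ck_eq _ _ _ _ (fun x => f x * 'D_v g x + g x * 'D_v f x) _ oU).
  move=> u Uu; rewrite -[RHS]/('D_v (f * g) u) deriveM//.
    exact (Ck_derivable Cf Uu).
  exact (Ck_derivable Cg Uu).
by apply: Ck_add => //; apply: IH; by [exact: Ck_derive|exact: CkW].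
Qed.

Lemma Ck_coord V k m n (U : set V) (f : V -> 'M[R]_(m, n)) i j :
  open U -> Ck k U f -> Ck k U (fun x => f x i j).
Proof.
move=> oU; elim: k f => [|k IH] f Cf; split => //.
- move=> u Uu; apply: (@continuous_comp _ _ _ f (fun M : 'M[R]_(m, n) => M i j)).
    exact: (Ck_continuous Cf).
  exact: coord_continuous.
- move=> u Uu; apply: (@continuous_comp _ _ _ f (fun M : 'M[R]_(m, n) => M i j)).
    exact: (Ck_continuous Cf).
  exact: coord_continuous.
- move=> v; split.
  by move=> u Uu; apply: (derivable_mxP f u v).1; exact (Ck_derivable Cf Uu).
apply: (@Ck_eq _ _ _ _ (fun x => ('D_v f x) i j) _ oU).
  move=> u Uu; rewrite derive_mx ?mxE//; exact (Ck_derivable Cf Uu).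
by apply: IH; exact: Ck_derive.
Qed.

Lemma derive_coord V k m n (U : set V) (f : V -> 'M[R]_(m, n)) i j u v :
  Ck k.+1 U f -> U u -> 'D_v (fun x => f x i j) u = ('D_v f u) i j.
Proof. by move=> Cf Uu; rewrite derive_mx ?mxE//; exact (Ck_derivable Cf Uu). Qed.

Lemma derive_compose V k n (U : set V) (O : set 'rV[R]_n) (F : 'rV[R]_n -> R)
    (S : V -> 'rV[R]_n) u v :
  open O -> Ck k.+1 O F -> Ck k.+1 U S -> (forall x, U x -> O (S x)) -> U u ->
  is_derive u v (F \o S) (\sum_i ('D_v S u) 0 i * pd i F (S u)).
Proof.
move=> oO CF CS UO Uu.
have C1F : Ck 1 O F by apply: Ck_le CF.
have [dF <-] := C1_differentiable oO C1F (UO _ Uu).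
by apply: is_derive_comp => //; exact (Ck_derivable CS Uu).
Qed.

(** The induction closes because the derivative given by the chain rule is a sum of products of a
    component of ['D_v S] with a composite [pd i F \o S], both one order less regular. *)
Lemma Ck_compose V k n (U : set V) (O : set 'rV[R]_n) (F : 'rV[R]_n -> R)
    (S : V -> 'rV[R]_n) :
  open U -> open O -> Ck k O F -> Ck k U S -> (forall x, U x -> O (S x)) ->
  Ck k U (F \o S).
Proof.
move=> oU oO; elim: k F S => [|k IH] F S CF CS UO; split => //.
- move=> u Uu; apply: continuous_comp; first exact: (Ck_continuous CS).
  exact: (Ck_continuous CF (UO _ Uu)).
- move=> u Uu; apply: continuous_comp; first exact: (Ck_continuous CS).
  exact: (Ck_continuous CF (UO _ Uu)).
- move=> v; split => [u Uu|].
    by have [] := @derive_compose _ _ _ _ _ _ _ u v oO CF CS UO Uu.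
apply: (@Ck_eq _ _ _ _ (fun x => \sum_i ('D_v S x) 0 i * (pd i F \o S) x) _ oU).
  by move=> u Uu; have [_ ->] := @derive_compose _ _ _ _ _ _ _ u v oO CF CS UO Uu.
apply: Ck_sum => // i; apply: Ck_mul => //.
  by apply: Ck_coord => //; exact: Ck_derive.
by apply: IH; [exact: Ck_derive|exact: CkW|].
Qed.

Lemma Ck_slice V W (Z : normedModType R) k (U : set (V * W)) (f : V * W -> Z) a :
  Ck k U f -> Ck k [set b | U (a, b)] (fun b => f (a, b)).
Proof.
have cs (f' : V * W -> Z) b : {for (a, b), continuous f'} ->
    {for b, continuous (fun b => f' (a, b))}.
  move=> cf; apply: (@continuous_comp _ _ _ (fun b => (a, b)) f') => //.
  by apply: cvg_pair => //; exact: cvg_cst.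
elim: k f => [|k IH] f Cf; split => //.
- by move=> u /= Uu; apply: cs; exact: (Ck_continuous Cf).
- by move=> u /= Uu; apply: cs; exact: (Ck_continuous Cf).
have E (t : R) b v : f (a, t *: v + b) = f (t *: (0, v) + (a, b)).
  by congr f; congr pair; rewrite /= scaler0 add0r.
move=> v; split => [u /= Uu|].
  have [H _] := @eq_line _ _ _ _ (fun b => f (a, b)) f u v (a, u) (0, v) (fun t => E t u v).
  by apply: H.2; exact (Ck_derivable Cf Uu).
have -> : 'D_v (fun b => f (a, b)) = (fun b => 'D_(0, v) f (a, b)).
  by apply/funext => b; apply: eq_derive_line => t.
exact: (IH ('D_(0, v) f) (Ck_derive _ Cf)).
Qed.

Lemma derive_slice V W (Z : normedModType R) (f : V * W -> Z) a b v :
  'D_v (fun b => f (a, b)) b = 'D_(0, v) f (a, b).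
Proof.
apply: eq_derive_line => t; congr f; congr pair.
by rewrite /= scaler0 add0r.
Qed.

Lemma derive_lin n (U : set 'rV[R]_n) F u : open U -> Ck 1 U F -> U u ->
  forall v, 'D_v F u = \sum_i v 0 i * pd i F u.
Proof. by move=> oU CF Uu; have [] := C1_differentiable oU CF Uu. Qed.

Lemma derive2_lin n (U : set 'rV[R]_n) F u a b : open U -> Ck 2 U F -> U u ->
  'D_a ('D_b F) u = \sum_i \sum_j a 0 i * b 0 j * pd i (pd j F) u.
Proof.
move=> oU CF Uu.
have E x : U x -> 'D_b F x = \sum_j b 0 j * pd j F x.
  by move=> Ux; rewrite (derive_lin oU (CkW CF) Ux).
have Cj j : Ck 1 U (pd j F) by exact: Ck_derive.
have Cb : Ck 1 U (fun x => \sum_j b 0 j * pd j F x).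
  apply: Ck_sum => [|j]; first exact: oU.
  by apply: Ck_mul; [exact: oU|exact: Ck_cst|exact: Cj].
rewrite (derive_eq_open a oU E Uu) (derive_lin oU Cb Uu); apply: eq_bigr => i _.
rewrite {1}/pd.
have -> : (fun x => \sum_j b 0 j * pd j F x) = \sum_j (b 0 j *: pd j F).
  by apply/funext => x; rewrite fct_sumE.
rewrite derive_sum => [|j]; last first.
  by apply: derivableZ; exact (Ck_derivable (Cj j) Uu).
rewrite mulr_sumr; apply: eq_bigr => j _; rewrite deriveZ ?mulrA//.
exact (Ck_derivable (Cj j) Uu).
Qed.

End CkTheory.

(** * Symmetry of second derivatives *)

Section Schwarz.
Variable R : realType.
Variable V : normedModType R.

(** Two applications of the mean value theorem turn the second difference into [s ^+ 2] times the
    mixed derivative at a point of the parallelogram, where continuity compares it with its value at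
    [u]. *)
Lemma second_difference (U : set V) (F : V -> R) u a b (e : R) :
  open U -> Ck 2 U F -> U u -> 0 < e ->
  \forall s \near (0 : R)^'+,
    `|F (u + s *: a + s *: b) - F (u + s *: a) - F (u + s *: b) + F u
      - s ^+ 2 * 'D_b ('D_a F) u| <= s ^+ 2 * e.
Proof.
move=> oU CF Uu e0.
have : \forall x \near u, U x /\ `|'D_b ('D_a F) u - 'D_b ('D_a F) x| <= e.
  near=> z0; split; first by near: z0; exact: open_nbhs_nbhs.
  near: z0; have := Ck_continuous (Ck_derive b (Ck_derive a CF)) Uu.
  by move=> /cvgrPdist_le/(_ _ e0).
rewrite -nbhs_nearE => /nbhs_ballP[r /= r0 Hr].
near=> s.
have s0 : 0 < s by [].
(* Keeps the whole parallelogram in the ball; the summand 1 makes the factor positive even if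
   [a = b = 0]. *)
have sr : s * (`|a| + `|b| + 1) < r.
  rewrite -ltr_pdivlMr ?ltr_wpDl ?addr_ge0//; near: s.
  by apply: nbhs_right_lt; rewrite divr_gt0 ?ltr_wpDl ?addr_ge0.
have inU (x y : R) : 0 <= x <= 1 -> 0 <= y <= 1 ->
    ball u r (u + x *: (s *: a) + y *: (s *: b)).
  move=> /andP[x0 x1] /andP[y0 y1].
  rewrite -ball_normE/= -addrA opprD addNKr normrN (le_lt_trans _ sr)//.
  rewrite (le_trans (ler_normD _ _))// !normrZ.
  rewrite (ger0_norm x0) (ger0_norm y0) (gtr0_norm s0).
  have h1 : x * (s * `|a|) <= s * `|a| by rewrite ler_piMl// mulr_ge0// ltW.
  have h2 : y * (s * `|b|) <= s * `|b| by rewrite ler_piMl// mulr_ge0// ltW.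
  by rewrite !mulrDr mulr1; move: s0 h1 h2; lra.
pose phi := (F \o shift (s *: b)) - F.
have dsh (z v : V) : U (z + s *: b) ->
    is_derive z v (F \o shift (s *: b)) ('D_v F (z + s *: b)).
  move=> Uz; apply: is_derive_line; last exact (Ck_derivable CF Uz).
  by move=> t /=; rewrite addrA.
have dphi (t : R) : 0 <= t <= 1 -> is_derive (u + t *: (s *: a)) a phi
   ('D_a F (u + t *: (s *: a) + s *: b) - 'D_a F (u + t *: (s *: a))).
  move=> t01; have [U1 _] := Hr _ (inU t 1 t01 (introT andP (conj ler01 (lexx 1)))).
  have [U0 _] := Hr _ (inU t 0 t01 (introT andP (conj (lexx 0) ler01))).
  rewrite scale1r in U1; rewrite scale0r addr0 in U0.
  apply: is_deriveB; first exact: dsh.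
  by apply: derivableP; exact (Ck_derivable CF U0).
(* First along [s *: a] for the increment [phi] of [F] in the direction [b], then along [s *: b] for
   ['D_a F]. *)
have [x x01|x x01] := @MVT_line _ _ phi u (s *: a).
  by apply: ex_derive; apply: is_derive_dirZ; have [] := dphi x x01.
have [dp ep] := dphi x x01.
have [_ ->] := is_derive_dirZ s dp; rewrite ep.
have [y y01|y y01] := @MVT_line _ _ ('D_a F) (u + x *: (s *: a)) (s *: b).
  have [Uy _] := Hr _ (inU x y x01 y01).
  apply: ex_derive; apply: is_derive_dirZ.
  exact (Ck_derivable (Ck_derive a CF) Uy).
move=> ->.
have [Uy Hy] := Hr _ (inU x y x01 y01).
have [_ ->] := is_derive_dirZ (v := b) s (Ck_derivable (Ck_derive a CF) Uy).
rewrite /phi !fctE/= => E.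
have -> : F (u + s *: a + s *: b) - F (u + s *: a) - F (u + s *: b) + F u =
  F (u + s *: a + s *: b) - F (u + s *: a) - (F (u + s *: b) - F u).
  by rewrite opprB addrA addrAC -addrA addrCA addrC.
rewrite E scalerA -[_ *: _]/(_ * _) -expr2 -mulrBr normrM.
have s20 : 0 <= s ^+ 2 by exact: sqr_ge0.
rewrite (ger0_norm s20); apply: ler_wpM2l; first exact: s20.
rewrite distrC; exact: Hy.
Unshelve. all: by end_near. Qed.

Lemma close_quotients (D p q c : R) : 0 < c -> 0 < `|q - p| ->
  `|D - c * p| <= c * (`|q - p| / 4) -> `|D - c * q| <= c * (`|q - p| / 4) -> False.
Proof.
move=> c0 qp h1 h2; have : c * `|q - p| <= c * (`|q - p| / 2).
  rewrite -{1}(gtr0_norm c0) -normrM.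
  have -> : c * (q - p) = (D - c * p) - (D - c * q) by ring.
  by rewrite (le_trans (ler_normB _ _))//; move: h1 h2; lra.
by rewrite ler_pM2l//; move: qp; lra.
Qed.

(* Both mixed derivatives are limits of the same second difference quotient. *)
Lemma derive2C (U : set V) (F : V -> R) u a b :
  open U -> Ck 2 U F -> U u -> 'D_a ('D_b F) u = 'D_b ('D_a F) u.
Proof.
move=> oU CF Uu; apply/eqP; rewrite -subr_eq0 -normr_le0 leNgt; apply/negP => d0.
pose e := `|'D_a ('D_b F) u - 'D_b ('D_a F) u| / 4.
have e0 : 0 < e by rewrite divr_gt0.
have h1 := second_difference a b oU CF Uu e0.
have h2 := second_difference b a oU CF Uu e0.
have h0 : \forall s \near (0 : R)^'+, 0 < s by exact: nbhs_right_gt.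
have [s [s0 [/= hs1 hs2]]] := filter_ex (filterI h0 (filterI h1 h2)).
(* After reordering, the two second differences are the same number. *)
move: hs2; rewrite (addrAC u) (addrAC (F (u + s *: a + s *: b))) => hs2.
have s2 : 0 < s ^+ 2 by rewrite exprn_gt0.
exact: (close_quotients s2 d0 hs1 hs2).
Qed.

End Schwarz.

(** * Gram matrices *)

Section Dotm.
Variables (R : realType) (n : nat).
Implicit Types (G : 'M[R]_n) (v w : 'rV[R]_n).

Lemma dotmE G v w : dotm G v w = \sum_i \sum_j v 0 i * G i j * w 0 j.
Proof.
rewrite /dotm mxE exchange_big; apply: eq_bigr => j _ /=.
by rewrite !mxE mulr_suml.
Qed.

Lemma dotmDl G v v' w : dotm G (v + v') w = dotm G v w + dotm G v' w.
Proof. by rewrite /dotm !mulmxDl mxE. Qed.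

Lemma dotmDr G v w w' : dotm G v (w + w') = dotm G v w + dotm G v w'.
Proof. by rewrite /dotm linearD mulmxDr mxE. Qed.

Lemma dotmZl G k v w : dotm G (k *: v) w = k * dotm G v w.
Proof. by rewrite /dotm -!scalemxAl mxE. Qed.

Lemma dotmZr G k v w : dotm G v (k *: w) = k * dotm G v w.
Proof. by rewrite /dotm linearZ -scalemxAr mxE. Qed.

Lemma dotm0l G w : dotm G 0 w = 0.
Proof. by rewrite /dotm !mul0mx mxE. Qed.

Lemma dotmNl G v w : dotm G (- v) w = - dotm G v w.
Proof. by rewrite -scaleN1r dotmZl mulN1r. Qed.

Lemma dotmBl G v v' w : dotm G (v - v') w = dotm G v w - dotm G v' w.
Proof. by rewrite dotmDl dotmNl. Qed.

Lemma dotm_suml G I (r : seq I) (P : pred I) (f : I -> 'rV[R]_n) w :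
  dotm G (\sum_(i <- r | P i) f i) w = \sum_(i <- r | P i) dotm G (f i) w.
Proof.
by elim/big_rec2: _ => [|i y z _ <-]; rewrite ?dotm0l// dotmDl.
Qed.

Lemma dotmC G v w : G^T = G -> dotm G v w = dotm G w v.
Proof.
move=> GT; rewrite !dotmE exchange_big; apply: eq_bigr => j _; apply: eq_bigr => i _ /=.
by rewrite -[in LHS]GT mxE mulrC mulrA mulrAC.
Qed.

Lemma dotm_grad G r w : G \in unitmx -> dotm G (r *m invmx G) w = \sum_i r 0 i * w 0 i.
Proof.
by move=> Gu; rewrite /dotm mulmxKV// mxE; apply: eq_bigr => i _; rewrite mxE.
Qed.

Lemma posdef_unitmx G : (forall v, v != 0 -> 0 < dotm G v v) -> G \in unitmx.
Proof.
move=> Gp; rewrite -row_free_unit; apply: inj_row_free => v vG.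
apply/eqP/negP => /negP /Gp; by rewrite /dotm vG mul0mx mxE ltxx.
Qed.

Lemma alternating_dotm_eq0 G : G^T = G -> (forall v, dotm G v v = 0) ->
  forall v w, dotm G v w = 0.
Proof.
move=> GT G0 v w; have := G0 (v + w).
rewrite dotmDl !dotmDr !G0 add0r addr0 (dotmC w v GT) => /eqP.
by rewrite -mulr2n mulrn_eq0 => /eqP.
Qed.

Lemma dotm_CauchySchwarz G : G^T = G -> (forall v, v != 0 -> 0 < dotm G v v) ->
  forall v w, `|dotm G v w| <= Num.sqrt (dotm G v v) * Num.sqrt (dotm G w w).
Proof.
move=> GT Gp v w.
have G0 x : 0 <= dotm G x x.
  by have [->|/Gp/ltW//] := eqVneq x 0; rewrite dotm0l.
have [->|w0] := eqVneq w 0.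
  by rewrite (dotmC _ _ GT) !dotm0l normr0 mulr_ge0 ?sqrtr_ge0.
rewrite -sqrtrM// -sqrtr_sqr ler_sqrt ?mulr_ge0//.
have := G0 (dotm G w w *: v - dotm G v w *: w).
rewrite dotmBl -!scaleNr !(dotmDr, dotmZl, dotmZr) (dotmC w v GT) => h.
have : 0 <= dotm G w w * (dotm G v v * dotm G w w - dotm G v w ^+ 2).
  by apply: le_trans h _; rewrite le_eqVlt; apply/orP; left; apply/eqP; ring.
by rewrite pmulr_rge0 ?Gp// subr_ge0.
Qed.

End Dotm.

Section DerivableMatrix.
Variables (R : realType) (V : normedModType R).

Lemma derivable_cstM (c : R) (f : V -> R) a v :
  derivable f a v -> derivable (fun x => c * f x) a v.
Proof. by move=> df; apply: (derivableM _ df (f := cst c)); exact: derivable_cst. Qed.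

Lemma derivable_prod I (r : seq I) (P : pred I) (f : I -> V -> R) a v :
  (forall i, derivable (f i) a v) ->
  derivable (fun x => \prod_(i <- r | P i) f i x) a v.
Proof.
move=> df; elim: r => [|i r IH].
  have -> : (fun x : V => \prod_(i <- [::] | P i) f i x) = cst 1.
    by apply/funext => x; rewrite big_nil.
  exact: derivable_cst.
have -> : (fun x : V => \prod_(j <- i :: r | P j) f j x) =
    (if P i then f i else cst 1) * (fun x => \prod_(j <- r | P j) f j x).
  by apply/funext => x; rewrite big_cons fctE/=; case: ifP => //; rewrite mul1r.
by apply: derivableM; [case: (P i); [exact: df|exact: derivable_cst]|exact: IH].
Qed.

Lemma derivable_bigsum I (r : seq I) (P : pred I) (f : I -> V -> R) a v :
  (forall i, derivable (f i) a v) ->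
  derivable (fun x => \sum_(i <- r | P i) f i x) a v.
Proof.
move=> df; elim: r => [|i r IH].
  have -> : (fun x : V => \sum_(i <- [::] | P i) f i x) = cst 0.
    by apply/funext => x; rewrite big_nil.
  exact: derivable_cst.
have -> : (fun x : V => \sum_(j <- i :: r | P j) f j x) =
    (if P i then f i else cst 0) + (fun x => \sum_(j <- r | P j) f j x).
  by apply/funext => x; rewrite big_cons fctE/=; case: ifP => //; rewrite add0r.
by apply: derivableD; [case: (P i); [exact: df|exact: derivable_cst]|exact: IH].
Qed.

Lemma derivable_det n (A : V -> 'M[R]_n) a v :
  (forall i j, derivable (fun x => A x i j) a v) ->
  derivable (fun x => \det (A x)) a v.
Proof.
move=> dA; apply: derivable_bigsum => s.
apply: derivable_cstM.
by apply: derivable_prod => i; exact: dA.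
Qed.

(** Cramer's formula. It describes [invmx] only at invertible matrices, whence the hypothesis on a
    whole neighbourhood. *)
Lemma derivable_invmx n (A : V -> 'M[R]_n) a v :
  (\near a, A a \in unitmx) ->
  (forall i j, derivable (fun x => A x i j) a v) ->
  forall i j, derivable (fun x => invmx (A x) i j) a v.
Proof.
move=> uA dA i j.
apply: (near_eq_derivable (f := (fun x => (\det (A x))^-1) *
    (fun x => \adj (A x) i j))).
  by apply: filterS uA => x /= Ax; rewrite /invmx Ax mxE.
apply: derivableM.
  apply: derivableV; last exact: derivable_det.
  by have := nbhs_singleton uA; rewrite unitmxE unitfE.
have -> : (fun x => \adj (A x) i j) =
    (fun x => (-1) ^+ (j + i) * \det (row' j (col' i (A x)))).
  by apply/funext => x; rewrite mxE.
apply: derivable_cstM.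
apply: derivable_det => k l.
have -> : (fun x => row' j (col' i (A x)) k l) =
   (fun x => A x (lift j k) (lift i l)) by apply/funext => x; rewrite !mxE.
exact: dA.
Qed.

End DerivableMatrix.

(** * Charts, gradients and Hessians *)

Section Geometry.
Variables (R : realType) (n : nat) (M : riemannianManifold R n).
Implicit Types (x p : M) (u v w e : 'rV[R]_n) (f : M -> R).

Lemma cimg_chart p x : cdom (chart_at p) x -> cimg (chart_at p) (chart_at p x).
Proof. by move=> px; exists x. Qed.

Lemma cimg_coord x : cimg (chart_at x) (Defs.coord x).
Proof. exact/cimg_chart/chart_at_dom. Qed.

Lemma cinv_coord x : cinv (chart_at x) (Defs.coord x) = x.
Proof. exact/cfunK/chart_at_dom. Qed.

Lemma cinv_dom p u : cimg (chart_at p) u ->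
  cdom (chart_at p) (cinv (chart_at p) u) /\ chart_at p (cinv (chart_at p) u) = u.
Proof. by move=> [x px <-]; rewrite cfunK. Qed.

Lemma open_cimg p : open (cimg (chart_at p)).
Proof. exact: cimg_open. Qed.

Definition overlap p q : set 'rV[R]_n :=
  chart_at p @` (cdom (chart_at p) `&` cdom (chart_at q)).

Lemma overlapE p q u :
  overlap p q u <-> cimg (chart_at p) u /\ cdom (chart_at q) (cinv (chart_at p) u).
Proof.
split=> [[x [px qx] <-]|[pu qu]]; first by rewrite cfunK//; split => //; exists x.
by have [pc cu] := cinv_dom pu; exists (cinv (chart_at p) u).
Qed.

Lemma open_overlap p q : open (overlap p q).
Proof.
rewrite openE => u /overlapE[pu qu].
have h1 : \forall y \near u, cimg (chart_at p) y.
  by apply: open_nbhs_nbhs; split => //; exact: open_cimg.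
have h2 : \forall y \near u, cdom (chart_at q) (cinv (chart_at p) y).
  have c := @cinv_continuous _ _ _ (chart_at p) u pu.
  by apply: c; apply: open_nbhs_nbhs; split => //; exact: cdom_open.
by apply: filterS2 h1 h2 => y py qy; apply/overlapE.
Qed.

Lemma overlap_chart p x : cdom (chart_at p) x -> overlap p x (chart_at p x).
Proof. by move=> px; exists x => //; split => //; exact: chart_at_dom. Qed.

Lemma tangentE p x v : cdom (chart_at p) x ->
  tangent_of p (chart_at p x) v =
  'D_v (chart_at x \o cinv (chart_at p)) (chart_at p x).
Proof. by move=> px; rewrite /tangent_of cfunK. Qed.

Lemma tangent_linear p x : cdom (chart_at p) x ->
  linear (tangent_of p (chart_at p x)).
Proof.
move=> px k v w; rewrite !tangentE//.
have oU := @open_overlap p x.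
have Uu := overlap_chart px.
have C1 : Ck 1 (overlap p x) (chart_at x \o cinv (chart_at p)) by exact: chart_smooth.
apply/rowP => j; rewrite !mxE -!(derive_coord _ _ _ C1 Uu).
rewrite !(derive_lin oU (Ck_coord 0 j oU C1) Uu) mulr_sumr -big_split.
by apply: eq_bigr => i _ /=; rewrite !mxE mulrDl mulrA.
Qed.

Lemma inner_tangent p x v w : cdom (chart_at p) x ->
  inner x (tangent_of p (chart_at p x) v) (tangent_of p (chart_at p x) w) =
  dotm (metric p (chart_at p x)) v w.
Proof.
move=> px; rewrite (@metric_tensor _ _ _ p x _ (overlap_chart px)) !tangentE//.
by rewrite /inner /gram /Defs.coord /= cfunK.
Qed.

Lemma gramT x : (gram x)^T = gram x.
Proof. by rewrite /gram Defs.metric_sym//; exact: cimg_coord. Qed.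

Lemma gram_posdef x v : v != 0 -> 0 < inner x v v.
Proof. by rewrite /inner /gram; apply: metric_posdef; exact: cimg_coord. Qed.

Lemma metric_unitmx p u : cimg (chart_at p) u -> metric p u \in unitmx.
Proof. by move=> pu; apply: posdef_unitmx; exact: metric_posdef. Qed.

Lemma gram_unitmx x : gram x \in unitmx.
Proof. by apply: metric_unitmx; exact: cimg_coord. Qed.

Lemma linear_rV_inj_surj (A : 'rV[R]_n -> 'rV[R]_n) : linear A ->
  (forall v, A v = 0 -> v = 0) -> forall w, exists v, A v = w.
Proof.
move=> lA A0 w; pose AL := GRing.isLinear.Build _ _ _ _ A lA.
pose B : {linear 'rV[R]_n -> 'rV[R]_n} := HB.pack A AL.
have EA v : A v = v *m lin1_mx B by rewrite mul_rV_lin1.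
have uA : lin1_mx B \in unitmx.
  by rewrite -row_free_unit; apply: inj_row_free => v; rewrite -EA => /A0.
by exists (w *m invmx (lin1_mx B)); rewrite EA mulmxKV.
Qed.

(** The change of chart carries the metric in the chart at [p] to the inner product at [x], so
    positive definiteness gives injectivity without inverting the transition map. *)
Lemma tangent_inj p x v : cdom (chart_at p) x ->
  tangent_of p (chart_at p x) v = 0 -> v = 0.
Proof.
move=> px Av; apply/eqP; apply: contraT => /(metric_posdef (cimg_chart px)).
by rewrite -inner_tangent// Av /inner dotm0l ltxx.
Qed.

Lemma tangent_surj p x w : cdom (chart_at p) x ->
  exists v, tangent_of p (chart_at p x) v = w.
Proof.
move=> px; apply: linear_rV_inj_surj; first exact: tangent_linear.
by move=> v; exact: tangent_inj.
Qed.

Lemma tangent_coord x v : tangent_of x (Defs.coord x) v = v.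
Proof.
rewrite tangentE; last exact: chart_at_dom.
have E u : cimg (chart_at x) u -> u = (chart_at x \o cinv (chart_at x)) u.
  by move=> /cinv_dom[].
by rewrite -(derive_eq_open v (@open_cimg x) E (cimg_coord x)) derive_id.
Qed.

Lemma derive_tangent p x f e : CkM 1 f -> cdom (chart_at p) x ->
  'D_e (f \o cinv (chart_at p)) (chart_at p x) =
  'D_(tangent_of p (chart_at p x) e) (f \o cinv (chart_at x)) (Defs.coord x).
Proof.
move=> Cf px; have oU := @open_overlap p x; have Uu := overlap_chart px.
have E u : overlap p x u -> (f \o cinv (chart_at p)) u =
    ((f \o cinv (chart_at x)) \o (chart_at x \o cinv (chart_at p))) u.
  by move=> /overlapE[_ xu] /=; rewrite cfunK.
rewrite (derive_eq_open e oU E Uu) tangentE//.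
have C1 : Ck 1 (overlap p x) (chart_at x \o cinv (chart_at p)) by exact: chart_smooth.
have cx : (chart_at x \o cinv (chart_at p)) (chart_at p x) = Defs.coord x by rewrite /= cfunK.
have [dF _] := C1_differentiable (@open_cimg x) (Cf x) (cimg_coord x).
rewrite -cx in dF *.
have [_ ->//] := is_derive_comp (Ck_derivable (v := e) C1 Uu) dF.
Qed.

Lemma inner_grad f x e : CkM 1 f ->
  inner x (grad f x) e = 'D_e (f \o cinv (chart_at x)) (Defs.coord x).
Proof.
move=> Cf; rewrite /inner /grad /mgrad dotm_grad; last exact: gram_unitmx.
rewrite (derive_lin (@open_cimg x) (Cf x) (cimg_coord x)).
by apply: eq_bigr => i _; rewrite mxE mulrC.
Qed.

Lemma inner_grad_tangent p x f e : CkM 1 f -> cdom (chart_at p) x ->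
  inner x (grad f x) (tangent_of p (chart_at p x) e) =
  'D_e (f \o cinv (chart_at p)) (chart_at p x).
Proof. by move=> Cf px; rewrite inner_grad// derive_tangent. Qed.

End Geometry.

(** * The Riemannian Hessian in coordinates *)

Section Hessian.
Variables (R : realType) (n : nat) (M : riemannianManifold R n).
Variables (x : M) (f : M -> R).
Hypothesis Cf : CkM 2 f.

Let F := f \o cinv (chart_at x).
Let O := cimg (chart_at x).
Let u0 := Defs.coord x.
Let G := metric x.
Let X := mgrad G F.

Let oO : open O. Proof. exact: open_cimg. Qed.
Let Ou0 : O u0. Proof. exact: cimg_coord. Qed.
Let C2F : Ck 2 O F. Proof. exact: Cf. Qed.
Let CG k (i j : 'I_n) : Ck k O (fun a => G a i j).
Proof. by apply: Ck_coord => //; exact: metric_smooth. Qed.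
Let Gsym a (i j : 'I_n) : O a -> G a i j = G a j i.
Proof.
move=> Oa; have := congr1 (fun N : 'M[R]_n => N j i) (Defs.metric_sym Oa).
by rewrite mxE.
Qed.
Let pdGsym k (i j : 'I_n) : pd k (fun a => G a i j) u0 = pd k (fun a => G a j i) u0.
Proof. by apply: (derive_eq_open _ oO) => // a; exact: Gsym. Qed.

(** The Christoffel symbols of the first kind, free of the inverse metric. *)
Let christ1 (i j l : 'I_n) : R := 2^-1 * (pd i (fun a => G a j l) u0 +
  pd j (fun a => G a i l) u0 - pd l (fun a => G a i j) u0).

Lemma christoffel_lower (i j l : 'I_n) :
  \sum_k christoffel x u0 k i j * G u0 k l = christ1 i j l.
Proof.
pose b m := pd i (fun a => G a j m) u0 + pd j (fun a => G a i m) u0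
     - pd m (fun a => G a i j) u0.
transitivity (2^-1 * \sum_m b m * \sum_k G u0 l k * invmx (G u0) k m).
  rewrite mulr_sumr; under [RHS]eq_bigr do rewrite mulrA mulr_sumr.
  rewrite exchange_big; apply: eq_bigr => k _ /=.
  rewrite /christoffel mulr_sumr mulr_suml; apply: eq_bigr => m _ /=.
  rewrite -/(b m) (Gsym k l)//.
  by rewrite -[RHS]mulrA (mulrC (b m)) -!mulrA; congr (_ * _); ring.
rewrite /christ1 -/(b l); congr (_ * _).
have E m : \sum_k G u0 l k * invmx (G u0) k m = (l == m)%:R.
  have := congr1 (fun N : 'M[R]_n => N l m) (mulmxV (metric_unitmx Ou0)).
  by rewrite !mxE.
under eq_bigr do rewrite E.
rewrite (bigD1 l)//= eqxx mulr1 big1 ?addr0// => m ml.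
by rewrite eq_sym (negbTE ml) mulr0.
Qed.

Lemma dotm_christoffel v y w :
  dotm (G u0) (christoffel_app x u0 v y) w =
  \sum_i \sum_j \sum_l v 0 i * y 0 j * w 0 l * christ1 i j l.
Proof.
rewrite dotmE.
under [RHS]eq_bigr => i _ do under eq_bigr => j _ do
  under eq_bigr => l _ do rewrite -christoffel_lower mulr_sumr.
under [LHS]eq_bigr => k _ do under eq_bigr => l _ do
  rewrite mxE mulr_suml mulr_suml.
under [LHS]eq_bigr => k _ do under eq_bigr => l _ do
  under eq_bigr => i _ do rewrite !mulr_suml.
under [LHS]eq_bigr => k _ do rewrite exchange_big/=.
rewrite exchange_big; apply: eq_bigr => i _ /=.
under [LHS]eq_bigr => k _ do rewrite exchange_big/=.
rewrite exchange_big; apply: eq_bigr => j _ /=.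
rewrite exchange_big; apply: eq_bigr => l _ /=.
by apply: eq_bigr => k _; ring.
Qed.

Let metric_near_unit : \near u0, G u0 \in unitmx.
Proof.
have : \forall a \near u0, O a by exact: open_nbhs_nbhs.
by apply: filterS => a; exact: metric_unitmx.
Qed.

Let dX v k : derivable (fun a => X a 0 k) u0 v.
Proof.
have -> : (fun a => X a 0 k) =
    (fun a => \sum_l pd l F a * invmx (G a) l k).
  by apply/funext => a; rewrite /X /mgrad mxE; apply: eq_bigr => l _; rewrite mxE.
apply: derivable_bigsum => l; apply: derivableM.
  exact (Ck_derivable (Ck_derive _ C2F) Ou0).
apply: derivable_invmx metric_near_unit _ _ _ => i j.
exact (Ck_derivable (CG 1 i j) Ou0).
Qed.

(** The product rule applied to [X *m G = dF]. In this way the inverse metric only has to be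
    derivable; its derivative is never computed. *)
Let derive_metric_grad v l :
  \sum_k ('D_v (fun a => X a 0 k) u0 * G u0 k l +
          X u0 0 k * 'D_v (fun a => G a k l) u0) = 'D_v (pd l F) u0.
Proof.
have E a : O a -> (\sum_k (fun a => X a 0 k) * (fun a => G a k l)) a = pd l F a.
  move=> Oa; rewrite fct_sumE/=.
  have := congr1 (fun r : 'rV[R]_n => r 0 l)
    (mulmxKV (metric_unitmx Oa) (\row_i pd i F a)).
  by rewrite /= !mxE => <-; apply: eq_bigr => k _.
have dG k : derivable (fun a => G a k l) u0 v by exact (Ck_derivable (CG 1 k l) Ou0).
rewrite -(derive_eq_open v oO E Ou0) derive_sum => [|k]; last exact: derivableM.
apply: eq_bigr => k _; rewrite deriveM// addrC; congr (_ + _).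
by rewrite [RHS]mulrC.
Qed.

(** The usual formula for the Hessian as second derivative minus Christoffel correction. Here [hess]
    is the covariant derivative of the gradient, so the derivatives of the metric coming from
    [derive_metric_grad] have to be cancelled. *)
Lemma inner_hess v w : inner x (hess f x v) w =
  'D_v ('D_w F) u0 - \sum_k christoffel_app x u0 v w 0 k * pd k F u0.
Proof.
have GXr k : pd k F u0 = \sum_l X u0 0 l * G u0 l k.
  have := congr1 (fun r : 'rV[R]_n => r 0 k)
    (mulmxKV (metric_unitmx Ou0) (\row_i pd i F u0)).
  by rewrite /= !mxE => <-; apply: eq_bigr => l _.
have h2 : \sum_k christoffel_app x u0 v w 0 k * pd k F u0 =
    \sum_i \sum_j \sum_l v 0 i * w 0 j * X u0 0 l * christ1 i j l.
  rewrite -dotm_christoffel dotmE; apply: eq_bigr => k _.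
  rewrite GXr mulr_sumr; apply: eq_bigr => l _.
  rewrite (Gsym k l)//.
  by move: (christoffel_app _ _ _ _ _ _) (X _ _ _) (G _ _ _) => r1 r2 r3; ring.
have dXv : 'D_v X u0 = \row_k 'D_v (fun a => X a 0 k) u0.
  rewrite derive_mx; first by apply/rowP => k; rewrite !mxE.
  by apply/derivable_mxP => i j; rewrite ord1; exact: dX.
have h1 : dotm (G u0) ('D_v X u0) w = 'D_v ('D_w F) u0 -
    \sum_i \sum_j \sum_l v 0 i * X u0 0 j * w 0 l * pd i (fun a => G a j l) u0.
  have -> : 'D_v ('D_w F) u0 = \sum_l w 0 l * 'D_v (pd l F) u0.
    rewrite (derive2_lin _ _ oO C2F Ou0) exchange_big; apply: eq_bigr => l _ /=.
    rewrite (derive_lin oO (Ck_derive _ C2F) Ou0) mulr_sumr.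
    by apply: eq_bigr => i _; ring.
  have -> : \sum_i \sum_j \sum_l v 0 i * X u0 0 j * w 0 l * pd i (fun a => G a j l) u0
      = \sum_l w 0 l * \sum_k X u0 0 k * 'D_v (fun a => G a k l) u0.
    under [RHS]eq_bigr => l _ do rewrite mulr_sumr.
    rewrite [RHS]exchange_big [LHS]exchange_big; apply: eq_bigr => j _ /=.
    rewrite [LHS]exchange_big; apply: eq_bigr => l _ /=.
    rewrite (derive_lin oO (CG 1 j l) Ou0) !mulr_sumr.
    by apply: eq_bigr => i _; ring.
  rewrite -sumrB dotmE exchange_big; apply: eq_bigr => l _ /=.
  rewrite -(derive_metric_grad v l) big_split /= -mulrBr addrK mulr_sumr.
  by apply: eq_bigr => k _; rewrite dXv mxE mulrC.
rewrite /inner /hess /covariant -/F -/G -/u0 -/X dotmDl h1 dotm_christoffel h2.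
(* Compatibility of the connection with the metric: exchanging [j] and [l] in [christ1 i j l] and
   adding leaves the derivative of [G j l] along [i]. *)
suff E : \sum_i \sum_j \sum_l v 0 i * X u0 0 j * w 0 l * christ1 i j l +
    \sum_i \sum_j \sum_l v 0 i * w 0 j * X u0 0 l * christ1 i j l =
    \sum_i \sum_j \sum_l v 0 i * X u0 0 j * w 0 l * pd i (fun a => G a j l) u0.
  by rewrite -E opprD addrA addrAC subrK.
rewrite -big_split; apply: eq_bigr => i _ /=.
rewrite [X in _ + X]exchange_big -big_split; apply: eq_bigr => j _ /=.
rewrite -big_split; apply: eq_bigr => l _ /=.
rewrite /christ1 (pdGsym i l j).
move: (pd i _ _) (pd j _ _) (pd l _ _) (v 0 i) (X u0 0 j) (w 0 l) => a b c r s t.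
by field.
Qed.

End Hessian.

(** * Pullbacks by the retraction *)

Section Retraction.
Variables (R : realType) (n : nat) (M : riemannianManifold R n).
Variable rt : M -> 'rV[R]_n -> M.
Hypothesis rtP : retraction rt.
Implicit Types (x p : M) (u v w e d : 'rV[R]_n) (f : M -> R).

Lemma open_slice (V W : normedModType R) (U : set (V * W)) a :
  open U -> open [set b | U (a, b)].
Proof.
move=> oU; apply: (@open_comp _ _ (fun b : W => (a, b)) U) => // b _.
by apply: cvg_pair => //; exact: cvg_cst.
Qed.

Lemma rt0 x : rt x 0 = x. Proof. by case: rtP. Qed.

Lemma open_retr_dom p q : open (retr_dom rt p q).
Proof. by case: rtP => /(_ p q)[]. Qed.

Lemma smooth_retr p q k : Ck k (retr_dom rt p q) (chart_at q \o retr_local rt p).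
Proof. by case: rtP => /(_ p q)[_ +] _ _; exact. Qed.

Lemma retr_localE p x v : cdom (chart_at p) x ->
  retr_local rt p (chart_at p x, v) = rt x (tangent_of p (chart_at p x) v).
Proof. by move=> px; rewrite /retr_local /= cfunK. Qed.

Lemma retr_local_coord x v : retr_local rt x (Defs.coord x, v) = rt x v.
Proof. by rewrite /retr_local /= cinv_coord tangent_coord. Qed.

Definition rt_dom x : set 'rV[R]_n := [set v | cdom (chart_at x) (rt x v)].

Lemma rt_domE x : rt_dom x = [set v | retr_dom rt x x (Defs.coord x, v)].
Proof.
apply/seteqP; split => v; rewrite /rt_dom /retr_dom /= retr_local_coord.
  by split => //; exact: cimg_coord.
by case.
Qed.

Lemma open_rt_dom x : open (rt_dom x).
Proof. by rewrite rt_domE; apply: open_slice; exact: open_retr_dom. Qed.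

Lemma rt_dom0 x : rt_dom x 0.
Proof. by rewrite /rt_dom /= rt0; exact: chart_at_dom. Qed.

Lemma smooth_rt x k : Ck k (rt_dom x) (chart_at x \o rt x).
Proof.
have -> : chart_at x \o rt x =
    (fun v => (chart_at x \o retr_local rt x) (Defs.coord x, v)).
  by apply/funext => v; rewrite /= retr_local_coord.
by rewrite rt_domE; apply: Ck_slice; exact: smooth_retr.
Qed.

Lemma derive_rt x v : 'D_v (chart_at x \o rt x) 0 = v.
Proof. by case: rtP. Qed.

Hypothesis rt2 : second_order rt.

(** The curve [rt x (t *: v)] has velocity [v] at 0, so its vanishing acceleration forces its second
    derivative in the chart to be opposite to the Christoffel term. *)
Lemma derive2_rt_diag x v :
  'D_v ('D_v (chart_at x \o rt x)) 0 = - christoffel_app x (Defs.coord x) v v.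
Proof.
pose rho := chart_at x \o rt x; pose c (t : R) := rt x (t *: v).
have c0 : c 0 = x by rewrite /c scale0r rt0.
have D (h : 'rV[R]_n -> 'rV[R]_n) t : (fun t : R => h (t *: v))^`()%classic t = 'D_v h (t *: v).
  by rewrite derive1E; apply: eq_derive_line => s; rewrite [s%:A]mulr1 scalerDl.
have d1 : (chart_at x \o c)^`()%classic = (fun t => 'D_v rho (t *: v)).
  by apply/funext => t; rewrite -(D rho).
have := rt2 x v; rewrite -/c /acceleration /velocity c0.
rewrite !(derive1nS, derive1n0) d1 (D ('D_v rho)) scale0r derive_rt.
by move=> /eqP; rewrite addr_eq0 => /eqP.
Qed.

(* [derive2_rt_diag] is the case [v = w]; both sides are symmetric bilinear in
   [v] and [w], hence equal by polarization. *)
Lemma derive2_rt x v w :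
  'D_v ('D_w (chart_at x \o rt x)) 0 = - christoffel_app x (Defs.coord x) v w.
Proof.
pose rho := chart_at x \o rt x.
have C2 : Ck 2 (rt_dom x) rho by exact: smooth_rt.
have oD := @open_rt_dom x; have D0 := rt_dom0 x.
have C2k k : Ck 2 (rt_dom x) (fun y => rho y 0 k) by exact: Ck_coord.
have E k a b : ('D_a ('D_b rho) 0) 0 k = 'D_a ('D_b (fun y => rho y 0 k)) 0.
  rewrite -(derive_coord _ _ _ (Ck_derive b C2) D0).
  apply: (derive_eq_open a oD _ D0) => y Dy.
  by rewrite -(derive_coord _ _ _ C2 Dy).
apply/rowP => k.
pose H := \matrix_(i, j) pd i (pd j (fun y => rho y 0 k)) 0 : 'M[R]_n.
pose Ga := \matrix_(i, j) christoffel x (Defs.coord x) k i j : 'M[R]_n.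
have EH a b : ('D_a ('D_b rho) 0) 0 k = dotm H a b.
  rewrite E (derive2_lin _ _ oD (C2k k) D0) dotmE; apply: eq_bigr => i _.
  by apply: eq_bigr => j _; rewrite mxE mulrAC.
have EG a b : christoffel_app x (Defs.coord x) a b 0 k = dotm Ga a b.
  rewrite dotmE mxE; apply: eq_bigr => i _.
  by apply: eq_bigr => j _; rewrite mxE [_ * a 0 i]mulrC.
have HT : H^T = H.
  by apply/matrixP => i j; rewrite !mxE; exact: (derive2C _ _ oD (C2k k) D0).
have GT : Ga^T = Ga.
  apply/matrixP => i j; rewrite !mxE; congr (_ * _); apply: eq_bigr => l _.
  congr (_ * _); congr (_ - _); first by rewrite addrC.
  apply: (derive_eq_open _ (@open_cimg _ _ _ x)); last exact: cimg_coord.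
  move=> u xu; have := congr1 (fun N : 'M[R]_n => N j i) (Defs.metric_sym xu).
  by rewrite mxE.
have dotmDG a b : dotm (H + Ga) a b = dotm H a b + dotm Ga a b.
  by rewrite /dotm mulmxDr mulmxDl mxE.
have : dotm (H + Ga) v w = 0.
  apply: alternating_dotm_eq0; first by rewrite linearD /= HT GT.
  by move=> a; rewrite dotmDG -EH -EG derive2_rt_diag mxE addNr.
rewrite dotmDG -EH -EG => /eqP; rewrite addr_eq0 => /eqP E0.
by transitivity (- christoffel_app x (Defs.coord x) v w 0 k); [exact: E0|rewrite [RHS]mxE].
Qed.

Lemma derive_pullback x f w : CkM 1 f ->
  'D_w (f \o rt x) 0 = 'D_w (f \o cinv (chart_at x)) (Defs.coord x).
Proof.
move=> Cf; have oD := @open_rt_dom x; have D0 := rt_dom0 x.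
have E v : rt_dom x v -> (f \o rt x) v =
    ((f \o cinv (chart_at x)) \o (chart_at x \o rt x)) v.
  by move=> Dv /=; rewrite cfunK.
rewrite (derive_eq_open w oD E D0).
have [dF _] := C1_differentiable (@open_cimg _ _ _ x) (Cf x) (cimg_coord x).
have rx : (chart_at x \o rt x) 0 = Defs.coord x by rewrite /= rt0.
rewrite -rx in dF *.
have [_ ->] := is_derive_comp (Ck_derivable (v := w) (smooth_rt x 1) D0) dF.
by rewrite derive_rt.
Qed.

(** The chain rule adds to the second derivative of [F] the differential of [F] applied to the
    second derivative of the retraction. By [derive2_rt] this extra term is exactly the Christoffel
    correction of [inner_hess]. *)
Lemma hess_pullback x f d w : CkM 2 f ->
  inner x (hess f x d) w = 'D_d ('D_w (f \o rt x)) 0.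
Proof.
move=> Cf; have oD := @open_rt_dom x; have D0 := rt_dom0 x.
pose F := f \o cinv (chart_at x); pose rho := chart_at x \o rt x.
have oO := @open_cimg _ _ _ x; have C2F : Ck 2 (cimg (chart_at x)) F by exact: Cf.
have C2 : Ck 2 (rt_dom x) rho by exact: smooth_rt.
have DO v : rt_dom x v -> cimg (chart_at x) (rho v) by move=> Dv; exists (rt x v).
have E v : rt_dom x v -> (F \o rho) v = (f \o rt x) v.
  by move=> Dv /=; rewrite /F /rho /= cfunK.
have rx : rho 0 = Defs.coord x by rewrite /rho /= rt0.
pose h i := (fun v => ('D_w rho v) 0 i) * (pd i F \o rho).
have E' v : rt_dom x v -> (\sum_i h i) v = 'D_w (f \o rt x) v.
  move=> Dv; rewrite fct_sumE -(derive_eq_open w oD E Dv).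
  by have [_ ->] := @derive_compose _ _ _ _ _ _ _ _ v w oO C2F C2 DO Dv.
have CD i : Ck 1 (rt_dom x) (fun v => ('D_w rho v) 0 i).
  by apply: Ck_coord; [exact: oD|exact: Ck_derive].
have Cp i : Ck 1 (cimg (chart_at x)) (pd i F) by exact: Ck_derive.
have dp i : is_derive 0 d (pd i F \o rho) ('D_d (pd i F) (Defs.coord x)).
  have [dpF _] := C1_differentiable oO (Cp i) (DO _ D0).
  have := is_derive_comp (Ck_derivable (v := d) C2 D0) dpF.
  by rewrite derive_rt rx.
have dD i : derivable (fun v => ('D_w rho v) 0 i) 0 d by exact (Ck_derivable (CD i) D0).
rewrite -(derive_eq_open d oD E' D0) derive_sum; last first.
  by move=> i; apply: derivableM => //; have [] := dp i.
rewrite inner_hess//.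
have -> : 'D_d ('D_w F) (Defs.coord x) = \sum_i w 0 i * 'D_d (pd i F) (Defs.coord x).
  rewrite (derive2_lin _ _ oO C2F (cimg_coord x)) exchange_big.
  apply: eq_bigr => l _ /=.
  rewrite (derive_lin oO (Cp l) (cimg_coord x)) mulr_sumr.
  by apply: eq_bigr => i _; rewrite mulrA (mulrC (w 0 l)).
rewrite -sumrB; apply: eq_bigr => i _.
have [dpi pi] := dp i.
rewrite deriveM// pi (derive_coord _ _ _ (Ck_derive w C2) D0) derive2_rt derive_rt.
rewrite [(pd i F \o rho) 0]/= rx; congr (_ + _).
set c := christoffel_app _ _ _ _.
transitivity (pd i F (Defs.coord x) * (- c) 0 i); last by [].
by rewrite [(- c) 0 i]mxE mulrN mulrC.
Qed.

End Retraction.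

(** * Derivatives in the second factor of a product *)

Section SliceDerivatives.
Variables (R : realType) (V : normedModType R) (n : nat).
Implicit Types (a : V) (b d e : 'rV[R]_n).

Lemma derive_slice_lin (U : set (V * 'rV[R]_n)) (T : V * 'rV[R]_n -> R) a b d :
  open U -> Ck 1 U T -> U (a, b) ->
  'D_(0, d) T (a, b) = \sum_i d 0 i * 'D_(0, delta_mx 0 i) T (a, b).
Proof.
move=> oU CT Uab; rewrite -derive_slice.
have -> := derive_lin (open_slice a oU) (Ck_slice a CT) Uab d.
by apply: eq_bigr => i _; rewrite /pd derive_slice.
Qed.

Lemma derive2_slice (T : V * 'rV[R]_n -> R) a b d e :
  'D_d ('D_e (fun b => T (a, b))) b = 'D_(0, d) ('D_(0, e) T) (a, b).
Proof.
have -> : 'D_e (fun b => T (a, b)) = (fun b => 'D_(0, e) T (a, b)).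
  by apply/funext => b'; rewrite derive_slice.
by rewrite (derive_slice ('D_(0, e) T)).
Qed.

Lemma derive2_slice_lin (U : set (V * 'rV[R]_n)) (T : V * 'rV[R]_n -> R) a b d e :
  open U -> Ck 2 U T -> U (a, b) ->
  'D_(0, d) ('D_(0, e) T) (a, b) = \sum_i \sum_j d 0 i * e 0 j *
    'D_(0, delta_mx 0 i) ('D_(0, delta_mx 0 j) T) (a, b).
Proof.
move=> oU CT Uab; rewrite -derive2_slice.
have -> := derive2_lin d e (open_slice a oU) (Ck_slice a CT) Uab.
by apply: eq_bigr => i _; apply: eq_bigr => j _; rewrite /pd derive2_slice.
Qed.

End SliceDerivatives.

(** * Uniform estimates near the limit point *)

Section NormEquivalence.
Variables (R : realType) (n : nat).
Implicit Types (G : 'M[R]_n) (v w : 'rV[R]_n).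

Lemma dotm_le G v w :
  `|dotm G v w| <= (\sum_i \sum_j `|G i j|) * `|v| * `|w|.
Proof.
rewrite dotmE -mulrA mulr_suml (le_trans (ler_norm_sum _ _ _))// ler_sum// => i _.
rewrite mulr_suml (le_trans (ler_norm_sum _ _ _))// ler_sum// => j _.
rewrite !normrM (mulrC `|v 0 i|) -mulrA ler_wpM2l// ler_pM//.
  exact: mx_entry_le.
exact: mx_entry_le.
Qed.

(** No compactness of the sphere: the coordinate [v 0 j] is the product of [v] with row [j] of the
    inverse of [G], so the Cauchy-Schwarz inequality bounds it. *)
Lemma posdef_coercive G : G^T = G -> (forall v, v != 0 -> 0 < dotm G v v) ->
  exists2 K : R, 0 < K & forall v, `|v| ^+ 2 <= K * dotm G v v.
Proof.
move=> GT Gp; have Gu := posdef_unitmx Gp.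
have G0 x : 0 <= dotm G x x.
  by have [->|/Gp/ltW//] := eqVneq x 0; rewrite dotm0l.
pose g i : 'rV[R]_n := delta_mx 0 i *m invmx G.
pose K := \sum_i Num.sqrt (dotm G (g i) (g i)).
have K0 : 0 <= K by apply: sumr_ge0 => i _; exact: sqrtr_ge0.
have vK v : `|v| <= K * Num.sqrt (dotm G v v).
  apply: mx_norm_le_entries => [|i j]; first by rewrite mulr_ge0 ?sqrtr_ge0.
  have -> : v i j = dotm G (g j) v.
    rewrite dotm_grad// (bigD1 j)//= big1 => [|k kj].
      by rewrite !mxE !eqxx mul1r addr0 ord1.
    by rewrite !mxE (negbTE kj) andbF mul0r.
  rewrite (le_trans (dotm_CauchySchwarz GT Gp _ _))// ler_wpM2r ?sqrtr_ge0//.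
  rewrite /K (bigD1 j)//= lerDl.
  by apply: sumr_ge0 => k _; exact: sqrtr_ge0.
exists (K ^+ 2 + 1) => [|v]; first by rewrite ltr_wpDl ?sqr_ge0.
rewrite mulrDl mul1r ler_wpDr//.
rewrite -(sqr_sqrtr (G0 v)) -exprMn lerXn2r ?nnegrE//.
by rewrite mulr_ge0// sqrtr_ge0.
Qed.

Lemma near_mx_close (T : topologicalType) (G : T -> 'M[R]_n) t0 (e : R) :
  {for t0, continuous G} -> 0 < e ->
  \forall t \near t0, \sum_i \sum_j `|G t i j - G t0 i j| <= e.
Proof.
move=> cG e0; pose e' := e / (n * n).+1%:R.
have e'0 : 0 < e' by rewrite divr_gt0.
have := cG => /cvgrPdist_le/(_ _ e'0); apply: filterS => t Gt.
have H i j : `|G t i j - G t0 i j| <= e'.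
  rewrite distrC (le_trans _ Gt)//.
  have -> : G t0 i j - G t i j = (G t0 - G t) i j by rewrite !mxE.
  exact: mx_entry_le.
apply: (@le_trans _ _ (\sum_(i < n) \sum_(j < n) e')).
  by apply: ler_sum => i _; apply: ler_sum => j _.
rewrite !sumr_const card_ord -mulrnA -mulr_natr /e' mulrAC ler_pdivrMr//.
by apply: ler_wpM2l; [exact: ltW|rewrite ler_nat].
Qed.

Lemma near_norm_equiv (T : topologicalType) (G : T -> 'M[R]_n) t0 :
  {for t0, continuous G} -> (G t0)^T = G t0 ->
  (forall v, v != 0 -> 0 < dotm (G t0) v v) ->
  exists2 c : R, 0 < c & \forall t \near t0, forall v,
    `|v| <= c * Num.sqrt (dotm (G t) v v) /\ Num.sqrt (dotm (G t) v v) <= c * `|v|.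
Proof.
move=> cG GT Gp; have [K K0 HK] := posdef_coercive GT Gp.
pose B := \sum_i \sum_j `|G t0 i j|.
have B0 : 0 <= B by apply: sumr_ge0 => i _; apply: sumr_ge0 => j _.
(* A perturbation of size [(2 * K)^-1] at most doubles the coercivity constant [K]. Since [1 <= c]
   gives [c <= c ^+ 2], the same [c] serves for the norms and for their squares, in both
   directions. *)
pose c := 1 + 2 * K + (B + (2 * K)^-1).
have k0 : 0 < (2 * K)^-1 by rewrite invr_gt0 mulr_gt0.
have c1 : 1 <= c by rewrite /c; move: B0 K0 k0; lra.
exists c; first exact: lt_le_trans ltr01 c1.
apply: filterS (near_mx_close cG k0) => t Ht v.
have E : dotm (G t) v v = dotm (G t0) v v + dotm (G t - G t0) v v.
  rewrite -[in LHS](subrK (G t0) (G t)) {1}/dotm mulmxDr mulmxDl mxE addrC.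
  by [].
have D : `|dotm (G t - G t0) v v| <= (2 * K)^-1 * `|v| ^+ 2.
  rewrite (le_trans (dotm_le _ _ _))// -mulrA -expr2 ler_wpM2r ?sqr_ge0//.
  by rewrite (le_trans _ Ht)//; apply: ler_sum => i _; apply: ler_sum => j _; rewrite !mxE.
have D0 := dotm_le (G t0) v v; rewrite -/B -mulrA -expr2 in D0.
have lo : `|v| ^+ 2 <= 2 * K * dotm (G t) v v.
  have h : K * ((2 * K)^-1 * `|v| ^+ 2) = `|v| ^+ 2 / 2.
    have Kn : K != 0 by rewrite gt_eqF.
    by move: (`|v| ^+ 2) => q; field.
  have h1 : - (K * ((2 * K)^-1 * `|v| ^+ 2)) <= K * dotm (G t - G t0) v v.
    rewrite -mulrN; apply: ler_wpM2l; first exact: ltW.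
    by move: D; rewrite ler_norml => /andP[].
  rewrite E; move: (HK v) h1; rewrite h; lra.
have p0 : 0 <= dotm (G t) v v.
  by rewrite -(pmulr_rge0 _ (mulr_gt0 (ltr0n _ 2) K0)) (le_trans _ lo)// sqr_ge0.
have hi : dotm (G t) v v <= c * `|v| ^+ 2.
  have h1 : dotm (G t) v v <= (B + (2 * K)^-1) * `|v| ^+ 2.
    rewrite E mulrDl lerD//; first exact: le_trans (ler_norm _) D0.
    exact: le_trans (ler_norm _) D.
  rewrite (le_trans h1)// ler_wpM2r ?sqr_ge0// /c; move: K0; lra.
have c0 : 0 <= c by exact: le_trans ler01 c1.
have cc : c <= c ^+ 2 by rewrite expr2 ler_peMl.
split.
  rewrite -(@ler_pXn2r _ 2)// ?nnegrE ?mulr_ge0 ?sqrtr_ge0//.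
  rewrite exprMn sqr_sqrtr// (le_trans lo)//; apply: ler_wpM2r => //.
  by rewrite (le_trans _ cc)// /c; move: B0 k0; lra.
rewrite -(@ler_pXn2r _ 2)// ?nnegrE ?mulr_ge0 ?sqrtr_ge0//.
by rewrite exprMn sqr_sqrtr// (le_trans hi)// ler_wpM2r ?sqr_ge0.
Qed.

End NormEquivalence.

Section PullbackRegularity.
Variables (R : realType) (n : nat) (M : riemannianManifold R n).
Variable rt : M -> 'rV[R]_n -> M.
Hypotheses (rtP : retraction rt) (rt2 : second_order rt).
Variable p : M.
Implicit Types (x : M) (u v w d e : 'rV[R]_n) (f : M -> R).

Local Notation psi := (chart_at p).
Local Notation A x := (tangent_of p (psi x)).

(* [a = (u, v)] is a point of TM read in the chart induced by [chart_at p]; the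
   components of [v] are thus relative to one fixed chart, whereas gradients and
   Hessians at a point [x] are expressed in the preferred chart of [x]. *)
Definition local_pullback f (a : 'rV[R]_n * 'rV[R]_n) : R := f (retr_local rt p a).

Local Notation T := local_pullback.
Local Notation W := (retr_dom rt p p).

Lemma Ck_pullback k f : CkM k f -> Ck k W (T f).
Proof.
move=> Cf; have oW : open W by exact: open_retr_dom.
apply: (@Ck_eq _ _ _ _ _ ((f \o cinv psi) \o (psi \o retr_local rt p)) _ oW).
  by move=> a [_ da]; rewrite /T /= cfunK.
have H a : W a -> cimg psi ((psi \o retr_local rt p) a).
  by move=> [_ da]; exists (retr_local rt p a).
exact: (Ck_compose oW (@open_cimg _ _ _ p) (Cf p) (@smooth_retr _ _ _ _ rtP p p k) H).
Qed.

End PullbackRegularity.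

(** * Gradients and Hessians as fibre derivatives of the local pullback *)

Section Pullback.
Variables (R : realType) (n : nat) (M : riemannianManifold R n).
Variable rt : M -> 'rV[R]_n -> M.
Hypotheses (rtP : retraction rt) (rt2 : second_order rt).
Variable p : M.
Implicit Types (x : M) (u v w d e : 'rV[R]_n) (f : M -> R).

Local Notation psi := (chart_at p).
Local Notation A x := (tangent_of p (psi x)).
Local Notation T := (local_pullback rt p).
Local Notation W := (retr_dom rt p p).

Lemma tangent0 x : cdom psi x -> A x 0 = 0.
Proof.
by move=> px; have := tangent_linear px (-1) 0 0; rewrite scaler0 add0r scaleN1r addNr.
Qed.

Lemma tangentZD x k v w : cdom psi x -> A x (k *: v + w) = k *: A x v + A x w.
Proof. by move=> px; exact: tangent_linear. Qed.

Lemma retr_dom0 x : cdom psi x -> W (psi x, 0).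
Proof.
move=> px; split; first exact: cimg_chart.
by rewrite retr_localE// tangent0// rt0.
Qed.

Lemma pullback_line x f d v (t : R) : cdom psi x ->
  T f (t *: (0, d) + (psi x, v)) = (f \o rt x) (t *: A x d + A x v).
Proof.
move=> px; have -> : t *: (0, d) + (psi x, v) = (psi x, t *: d + v) :> 'rV[R]_n * 'rV[R]_n.
  by congr pair; rewrite /= scaler0 add0r.
by rewrite /local_pullback /= retr_localE// tangentZD.
Qed.

Lemma derive_local_pullback x f d v : cdom psi x ->
  'D_(0, d) (T f) (psi x, v) = 'D_(A x d) (f \o rt x) (A x v).
Proof. by move=> px; apply: eq_derive_line => t; exact: pullback_line. Qed.

Lemma derive_pullback_line x f e d v (t : R) : cdom psi x ->
  'D_(0, e) (T f) (t *: (0, d) + (psi x, v)) =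
  'D_(A x e) (f \o rt x) (t *: A x d + A x v).
Proof.
move=> px; have -> : t *: (0, d) + (psi x, v) = (psi x, t *: d + v) :> 'rV[R]_n * 'rV[R]_n.
  by congr pair; rewrite /= scaler0 add0r.
have -> := derive_local_pullback f e (t *: d + v) px.
by rewrite (tangentZD t d v px).
Qed.

Lemma derive2_local_pullback x f e d v : cdom psi x ->
  'D_(0, d) ('D_(0, e) (T f)) (psi x, v) =
  'D_(A x d) ('D_(A x e) (f \o rt x)) (A x v).
Proof. by move=> px; apply: eq_derive_line => t; exact: derive_pullback_line. Qed.

Lemma inner_grad_pullback x f e : CkM 1 f -> cdom psi x ->
  inner x (grad f x) (A x e) = 'D_(0, e) (T f) (psi x, 0).
Proof.
move=> Cf px; have -> := inner_grad x (A x e) Cf.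
have <- := derive_pullback rtP x (A x e) Cf.
have -> := derive_local_pullback f e 0 px.
by rewrite (tangent0 px).
Qed.

Lemma inner_hess_pullback x f d e : CkM 2 f -> cdom psi x ->
  inner x (hess f x (A x d)) (A x e) = 'D_(0, d) ('D_(0, e) (T f)) (psi x, 0).
Proof.
move=> Cf px; have -> := hess_pullback rtP rt2 x (A x d) (A x e) Cf.
have -> := derive2_local_pullback f e d 0 px.
by rewrite (tangent0 px).
Qed.

Lemma derive_mulmxr (V : normedModType R) (r : V -> 'rV[R]_n) (B : 'M[R]_n) a (h : V) :
  derivable r a h -> 'D_h (fun y => r y *m B) a = 'D_h r a *m B.
Proof.
move=> dr; have cB : continuous (mulmxr B : 'rV[R]_n -> 'rV[R]_n).
  exact/linear_rV_continuous/linearP.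
have dB : differentiable (mulmxr B : 'rV[R]_n -> 'rV[R]_n) (r a).
  exact/linear_differentiable/cB.
have [_ ->] := is_derive_comp dr dB.
by rewrite deriveE// (diff_lin _ cB).
Qed.

(** [ehess] differentiates the partial derivatives along the coordinate vectors of the preferred
    chart of [x], whereas the fibre coordinates of [T] refer to the chart at [p]. The vectors [a i],
    preimages of the former under [A x], link the two. *)
Lemma inner_ehess_pullback x f d e v : CkM 2 f -> cdom psi x -> W (psi x, v) ->
  inner x (ehess x (f \o rt x) (A x v) (A x d)) (A x e) =
  'D_(0, d) ('D_(0, e) (T f)) (psi x, v).
Proof.
move=> Cf px Wv.
have [a Ha] : exists a : 'I_n -> 'rV[R]_n, forall i, A x (a i) = delta_mx 0 i.
  pose H i := cid (tangent_surj (delta_mx 0 i) px).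
  by exists (fun i => sval (H i)) => i; exact: svalP (H i).
have oW : open W by exact: open_retr_dom.
have CT : Ck 2 W (T f) by exact: Ck_pullback.
have L i (t : R) : pd i (f \o rt x) (t *: A x d + A x v) =
    'D_(0, a i) (T f) (t *: (0, d) + (psi x, v)).
  by have -> := derive_pullback_line f (a i) d v t px; rewrite Ha.
have dpd i : derivable (pd i (f \o rt x)) (A x v) (A x d).
  have [H _] := @eq_line _ _ _ _ (pd i (f \o rt x)) ('D_(0, a i) (T f)) _ _ (psi x, v) (0, d) (L i).
  by apply: H.2; exact (Ck_derivable (Ck_derive (0, a i) CT) Wv).
have dr : derivable (fun xi => \row_i pd i (f \o rt x) xi) (A x v) (A x d).
  apply/derivable_mxP => i j.
  have -> : (fun xi => (\row_i0 pd i0 (f \o rt x) xi) i j) = pd j (f \o rt x).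
    by apply/funext => xi; rewrite mxE.
  exact: dpd.
rewrite /ehess /mgrad (derive_mulmxr _ dr) /inner dotm_grad; last exact: gram_unitmx.
(* By injectivity of [A x], the expansion of [A x e] in the coordinate vectors lifts to one of [e]
   in the [a i]. *)
have Ea : \sum_i (A x e) 0 i *: a i = e.
  apply/subr0_eq/(tangent_inj px).
  have linB y z : A x (y - z) = A x y - A x z.
    by rewrite -scaleN1r addrC tangentZD// scaleN1r addrC.
  rewrite linB; apply/eqP; rewrite subr_eq0 {2}(row_sum_delta (A x e)); apply/eqP.
  elim/big_ind2: _ => [|y1 y2 z1 z2 <- <-|i _]; first exact: tangent0.
    by rewrite -[y2]scale1r tangentZD// !scale1r.
  by rewrite -[_ *: a i]addr0 tangentZD// tangent0// addr0 Ha.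
pose H k l := 'D_(0, delta_mx 0 k) ('D_(0, delta_mx 0 l) (T f)) (psi x, v).
have S e' : 'D_(0, d) ('D_(0, e') (T f)) (psi x, v) =
    \sum_k \sum_l d 0 k * e' 0 l * H k l := derive2_slice_lin d e' oW CT Wv.
rewrite (S e); clearbody H.
transitivity (\sum_i (A x e) 0 i * \sum_k \sum_l d 0 k * (a i) 0 l * H k l).
  apply: eq_bigr => i _; rewrite mulrC (derive_mx dr) mxE; congr (_ * _).
  rewrite -(S (a i)).
  have <- := @eq_derive_line _ _ _ _ (pd i (f \o rt x)) ('D_(0, a i) (T f)) _ _ (psi x, v) (0, d) (L i).
  congr ('D_(A x d) _ (A x v)).
  by apply/funext => xi; rewrite mxE.
under eq_bigr => i _ do rewrite mulr_sumr.
rewrite exchange_big; apply: eq_bigr => k _ /=.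
under eq_bigr => i _ do rewrite mulr_sumr.
rewrite exchange_big; apply: eq_bigr => l _ /=.
rewrite -[in RHS]Ea summxE mulr_sumr mulr_suml; apply: eq_bigr => i _.
rewrite mxE; move: (H k l) => h.
by rewrite !mulrA; congr (_ * _ * _); rewrite mulrC.
Qed.

End Pullback.

(** * The Lipschitz hypothesis in coordinates *)

Section HessianLipschitz.
Variables (R : realType) (n : nat) (M : riemannianManifold R n).
Variable rt : M -> 'rV[R]_n -> M.
Hypotheses (rtP : retraction rt) (rt2 : second_order rt).
Variable p : M.
Implicit Types (x : M) (u v w d e : 'rV[R]_n) (f : M -> R).

Local Notation psi := (chart_at p).
Local Notation A x := (tangent_of p (psi x)).
Local Notation T := (local_pullback rt p).
Local Notation W := (retr_dom rt p p).
Local Notation u0 := (Defs.coord p).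
Local Notation dl k := (delta_mx 0 k : 'rV[R]_n).

Lemma near_cinv (Q : M -> Prop) : (\forall x \near p, Q x) ->
  \forall u \near u0, cimg psi u /\ Q (cinv psi u).
Proof.
move=> nQ.
have h1 : \forall y \near u0, cimg psi y.
  by apply: open_nbhs_nbhs; split; [exact: open_cimg|exact: cimg_coord].
have h2 : \forall y \near u0, Q (cinv psi y).
  have c := @cinv_continuous _ _ _ psi u0 (cimg_coord p).
  by apply: c; rewrite /= cinv_coord.
exact: filterI.
Qed.

Lemma inner_CauchySchwarz x v w : `|inner x v w| <= rnorm x v * rnorm x w.
Proof. by apply: dotm_CauchySchwarz; [exact: gramT|exact: gram_posdef]. Qed.

(** Duality: [z] is itself some [A x y], and testing it against [y] bounds its squared norm by
    [b * |y|], hence by [b * c] times its norm. *)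
Lemma rnorm_dual x z (b c : R) : cdom psi x -> 0 <= b -> 0 <= c ->
  (forall d, `|d| <= c * rnorm x (A x d)) ->
  (forall e, `|inner x z (A x e)| <= b * `|e|) -> rnorm x z <= b * c.
Proof.
move=> px b0 c0 Hc Hb; have [y Ey] := tangent_surj z px.
have i0 : 0 <= inner x z z.
  by have [->|/gram_posdef/ltW//] := eqVneq z 0; rewrite /inner dotm0l.
have h : rnorm x z ^+ 2 <= b * c * rnorm x z.
  rewrite sqr_sqrtr// (le_trans (ler_norm _))// -{2}Ey (le_trans (Hb _))//.
  by rewrite -mulrA; apply: ler_wpM2l => //; rewrite -Ey.
have [->|zn] := eqVneq (rnorm x z) 0; first exact: mulr_ge0.
have z0 : 0 < rnorm x z by rewrite lt_def zn sqrtr_ge0.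
by rewrite -(ler_pM2r z0) -expr2.
Qed.

Lemma metric_near_equiv : exists2 c : R, 0 < c & \forall u \near u0,
  forall x, cdom psi x -> psi x = u ->
    forall d, `|d| <= c * rnorm x (A x d) /\ rnorm x (A x d) <= c * `|d|.
Proof.
have cG : {for u0, continuous (metric p)}.
  exact: (Ck_continuous (metric_smooth p 0) (cimg_coord p)).
have [c c0 Hc] := near_norm_equiv cG (Defs.metric_sym (cimg_coord p))
  (metric_posdef (cimg_coord p)).
exists c => //; apply: filterS Hc => u Hu x px xu d.
by rewrite /rnorm (inner_tangent d d px) xu.
Qed.

Lemma retr_dom_center : W (u0, 0).
Proof. by apply: (retr_dom0 rtP); exact: chart_at_dom. Qed.

Lemma near_retr_dom : \forall a \near (u0, 0 : 'rV[R]_n), W a.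
Proof.
by apply: open_nbhs_nbhs; split; [exact: open_retr_dom|exact: retr_dom_center].
Qed.

Lemma near_fst (Q : 'rV[R]_n -> Prop) : (\forall u \near u0, Q u) ->
  \forall a \near (u0, 0 : 'rV[R]_n), Q a.1.
Proof. by move=> nQ; apply: (@cvg_fst _ _ (nbhs u0) (nbhs (0 : 'rV[R]_n))). Qed.

Lemma near_snd (r : R) : 0 < r ->
  \forall a \near (u0, 0 : 'rV[R]_n), `|a.2| < r.
Proof.
move=> r0; have h : \forall y \near (0 : 'rV[R]_n), `|y| < r by exact: nbhs0_lt.
exact: (@cvg_snd _ _ (nbhs u0) (nbhs (0 : 'rV[R]_n)) _ _ h).
Qed.

Lemma derive2_pullback_le f a d e : CkM 2 f -> W a ->
  `|'D_(0, d) ('D_(0, e) (T f)) a| <=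
  (\sum_i \sum_j `|'D_(0, dl i) ('D_(0, dl j) (T f)) a|) * `|d| * `|e|.
Proof.
case: a => u v Cf Wa; have oW : open W by exact: open_retr_dom.
pose H i j := 'D_(0, dl i) ('D_(0, dl j) (T f)) (u, v).
have E : 'D_(0, d) ('D_(0, e) (T f)) (u, v) = \sum_i \sum_j d 0 i * e 0 j * H i j :=
  derive2_slice_lin d e oW (Ck_pullback rtP p Cf) Wa.
change (`|'D_(0, d) ('D_(0, e) (T f)) (u, v)| <=
  (\sum_i \sum_j `|H i j|) * `|d| * `|e|).
clearbody H; rewrite E -mulrA mulr_suml (le_trans (ler_norm_sum _ _ _))//; apply: ler_sum => i _.
rewrite mulr_suml (le_trans (ler_norm_sum _ _ _))//; apply: ler_sum => j _.
rewrite normrM mulrC; apply: ler_wpM2l => //.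
by rewrite normrM ler_pM// mx_entry_le.
Qed.

Lemma derive2_pullbackDr f a d e (k : R) : CkM 2 f -> W a ->
  'D_(0, k *: d) ('D_(0, e) (T f)) a = k * 'D_(0, d) ('D_(0, e) (T f)) a.
Proof.
case: a => u v Cf Wa; have oW : open W by exact: open_retr_dom.
have CT := Ck_pullback rtP p Cf.
pose H i j := 'D_(0, dl i) ('D_(0, dl j) (T f)) (u, v).
have E d' : 'D_(0, d') ('D_(0, e) (T f)) (u, v) = \sum_i \sum_j d' 0 i * e 0 j * H i j :=
  derive2_slice_lin d' e oW CT Wa.
clearbody H; rewrite (E (k *: d)) [in RHS](E d).
rewrite mulr_sumr; apply: eq_bigr => i _; rewrite mulr_sumr; apply: eq_bigr => j _.
by rewrite mxE !mulrA.
Qed.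

(* The bound [zB] is needed because [sup] is an upper bound only of a bounded
   set. *)
Lemma hess_lipschitz_at f x v (c L : R) : CkM 2 f -> cdom psi x -> W (psi x, v) ->
  0 < c -> 0 < L ->
  (forall d, `|d| <= c * rnorm x (A x d) /\ rnorm x (A x d) <= c * `|d|) ->
  opnorm x (fun d => ehess x (f \o rt x) (A x v) d - ehess x (f \o rt x) 0 d)
    <= L * rnorm x (A x v) ->
  forall d e, `|'D_(0, d) ('D_(0, e) (T f)) (psi x, v) -
      'D_(0, d) ('D_(0, e) (T f)) (psi x, 0)| <= L * c * c * c * `|v| * `|d| * `|e|.
Proof.
move=> Cf px Wv c0 L0 Hcu Hop d e.
have W0 := retr_dom0 rtP px.
have c0' := ltW c0.
have rnv : rnorm x (A x v) <= c * `|v| := (Hcu v).2.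
pose H d e := 'D_(0, d) ('D_(0, e) (T f)) (psi x, v) - 'D_(0, d) ('D_(0, e) (T f)) (psi x, 0).
pose z d := ehess x (f \o rt x) (A x v) (A x d) - ehess x (f \o rt x) 0 (A x d).
have zH d' e' : inner x (z d') (A x e') = H d' e'.
  have e1 := inner_ehess_pullback rtP d' e' Cf px Wv.
  have e2 := inner_ehess_pullback rtP d' e' Cf px W0.
  rewrite (tangent0 px) in e2.
  by rewrite /H -e1 -e2 /inner -dotmBl.
pose B := \sum_i \sum_j `|'D_(0, dl i) ('D_(0, dl j) (T f)) (psi x, v)| +
          \sum_i \sum_j `|'D_(0, dl i) ('D_(0, dl j) (T f)) (psi x, 0)|.
have B0 : 0 <= B.
  by apply: addr_ge0; apply: sumr_ge0 => i _; apply: sumr_ge0 => j _.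
have HB d' e' : `|H d' e'| <= B * `|d'| * `|e'|.
  rewrite /H (le_trans (ler_normB _ _))// /B !mulrDl.
  by apply: lerD; exact: derive2_pullback_le.
have Hscale k d' e' : H (k *: d') e' = k * H d' e'.
  rewrite /H mulrBr (derive2_pullbackDr _ _ _ Cf Wv).
  by rewrite (derive2_pullbackDr _ _ _ Cf W0).
change (`|H d e| <= L * c * c * c * `|v| * `|d| * `|e|).
clearbody H.
have zB d' : rnorm x (z d') <= B * `|d'| * c.
  have Hz e' : `|inner x (z d') (A x e')| <= B * `|d'| * `|e'| by rewrite zH.
  exact: (rnorm_dual px (mulr_ge0 B0 (normr_ge0 _)) c0' (fun d'' => (Hcu d'').1) Hz).
clearbody B.
have zL d' : rnorm x (A x d') <= 1 -> rnorm x (z d') <= L * rnorm x (A x v).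
  move=> d1; apply: le_trans Hop; rewrite /opnorm; apply: sup_upper_bound; last first.
    by exists (A x d').
  split; first by exists (rnorm x (z d')), (A x d').
  exists (B * c * c) => _ [d2 /= d21 <-].
  have [d3 Ed3] := tangent_surj d2 px.
  rewrite -Ed3 in d21 *; rewrite -/(z d3) (le_trans (zB _))//.
  apply: ler_wpM2r => //; apply: ler_wpM2l => //.
  by rewrite (le_trans (Hcu _).1)// ler_piMr.
have [d0|dn] := eqVneq (rnorm x (A x d)) 0.
  have : `|d| <= 0 by have := (Hcu d).1; rewrite d0 mulr0.
  rewrite normr_le0 => /eqP d00; apply: (le_trans (HB d e)).
  by rewrite d00 normr0 !mulr0 !mul0r.
set t := rnorm x (A x d) in dn.
have t0 : 0 < t by rewrite lt_def dn sqrtr_ge0.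
have At : rnorm x (A x (t^-1 *: d)) = 1.
  have -> : A x (t^-1 *: d) = t^-1 *: A x d.
    by rewrite -[_ *: d]addr0 tangentZD// tangent0// addr0.
  rewrite /rnorm /inner dotmZl dotmZr mulrA -expr2 sqrtrM ?sqr_ge0//.
  rewrite sqrtr_sqr gtr0_norm ?invr_gt0//.
  by rewrite -[Num.sqrt _]/t mulVf.
(* [opnorm] only controls vectors of norm at most 1, so [d] is normalized and the factor [t]
   restored by homogeneity. *)
have Ed : d = t *: (t^-1 *: d) by rewrite scalerA divff// scale1r.
have h1 : `|H (t^-1 *: d) e| <= L * (c * `|v|) * (c * `|e|).
  rewrite -zH (le_trans (inner_CauchySchwarz _ _ _))//; apply: ler_pM.
  - exact: sqrtr_ge0.
  - exact: sqrtr_ge0.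
  - by rewrite (le_trans (zL _ _)) ?At//; apply: ler_wpM2l => //; exact: ltW.
  - exact: (Hcu e).2.
rewrite {1}Ed Hscale normrM (gtr0_norm t0).
have h2 : t <= c * `|d| := (Hcu d).2.
apply: (@le_trans _ _ (c * `|d| * (L * (c * `|v|) * (c * `|e|)))).
  by apply: ler_pM => //; exact: ltW.
rewrite le_eqVlt; apply/orP; left; apply/eqP.
by move: `|v| `|d| `|e| => q1 q2 q3; ring.
Qed.

Lemma near_hess_lipschitz f : CkM 2 f -> pullback_hess_lipschitz rt p f ->
  exists2 C : R, 0 <= C & \forall a \near (u0, 0 : 'rV[R]_n), W a /\
    forall d e, `|'D_(0, d) ('D_(0, e) (T f)) a - 'D_(0, d) ('D_(0, e) (T f)) (a.1, 0)|
      <= C * `|a.2| * `|d| * `|e|.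
Proof.
move=> Cf [L [r [L0 r0 HL]]].
have [c c0 Hc] := metric_near_equiv.
(* One factor [c] for each of [v], [d] and [e], to pass from [rnorm] to the coordinate norm; the
   radius [r / c] below serves the same purpose. *)
exists (L * c * c * c); first by rewrite !mulr_ge0// ltW.
have rc0 : 0 < r / c by rewrite divr_gt0.
have n1 := near_fst (near_cinv HL).
have n2 := near_fst Hc.
have n3 := near_snd rc0.
apply: filterS (filterI n1 (filterI n2 (filterI n3 near_retr_dom))) => -[u v] /=.
case=> -[/cinv_dom[]]; move: (cinv psi u) => x px xu HLx [Hcu [vr Wv]].
rewrite -xu in Wv *; split=> //.
have {}Hcu := Hcu x px xu.
apply: hess_lipschitz_at => //; apply: HLx.
by rewrite (le_lt_trans (Hcu v).2)// mulrC -ltr_pdivlMr.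
Qed.

End HessianLipschitz.

(** * Taylor estimates near the zero vector at the limit point *)

Section TaylorEstimates.
Variables (R : realType) (n : nat) (M : riemannianManifold R n).
Variable rt : M -> 'rV[R]_n -> M.
Hypotheses (rtP : retraction rt) (rt2 : second_order rt).
Variable p : M.
Implicit Types (x : M) (u v w d e : 'rV[R]_n) (f : M -> R).

Local Notation psi := (chart_at p).
Local Notation A x := (tangent_of p (psi x)).
Local Notation T := (local_pullback rt p).
Local Notation W := (retr_dom rt p p).
Local Notation u0 := (Defs.coord p).
Local Notation dl k := (delta_mx 0 k : 'rV[R]_n).
Local Notation S := (psi \o retr_local rt p).
Local Notation a0 := (u0, 0 : 'rV[R]_n).

Let oW : open W. Proof. exact: open_retr_dom. Qed.

Lemma derive_S0 e : 'D_(0, e) S a0 = e.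
Proof.
rewrite -(derive_slice S) -[RHS](derive_rt rtP p e).
congr ('D_e _ 0); apply/funext => v; rewrite /= retr_local_coord//.
Qed.

Lemma derive_pullback_chain f a e : CkM 1 f -> W a ->
  'D_(0, e) (T f) a = \sum_i ('D_(0, e) S a) 0 i * pd i (f \o cinv psi) (S a).
Proof.
move=> Cf Wa.
have H b : W b -> cimg psi (S b) by move=> [_ db]; exists (retr_local rt p b).
have E b : W b -> ((f \o cinv psi) \o S) b = T f b.
  by move=> [_ db]; rewrite /local_pullback /= cfunK.
rewrite -(derive_eq_open (0, e) oW E Wa).
by have [_ ->] := @derive_compose _ _ 0 _ _ _ _ _ a (0, e) (@open_cimg _ _ _ p) (Cf p)
  (@smooth_retr _ _ _ _ rtP p p 1) H Wa.
Qed.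

(* The partial derivative of the retraction in the fibre is close to the
   identity near [a0]; its deviation is absorbed by the left-hand side, so that
   it need not be inverted. *)
Lemma near_transport : \forall a \near a0, W a /\ forall f, CkM 1 f ->
  \sum_i `|pd i (f \o cinv psi) (S a)| <= 2 * \sum_k `|'D_(0, dl k) (T f) a|.
Proof.
(* [n] deviations of size [h] sum to at most 1/2, so that the unknown sum [s] will satisfy
   [s <= D + s / 2]. *)
pose h : R := (2 * n.+1%:R)^-1.
have h0 : 0 < h by rewrite invr_gt0 mulr_gt0.
have n1 : \forall a \near a0, forall k : 'I_n, `|'D_(0, dl k) S a - dl k| <= h.
  near=> a; near: a; apply: filter_forall => k.
  have := Ck_continuous (Ck_derive (0, dl k) (@smooth_retr _ _ _ _ rtP p p 1)) (retr_dom_center rtP p).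
  rewrite /prop_for /continuous_at derive_S0 => /cvgrPdist_le/(_ _ h0).
  by apply: filterS => a; rewrite distrC.
apply: filterS (filterI n1 (near_retr_dom rtP p)) => a [Ha Wa]; split=> // f Cf.
pose l i := pd i (f \o cinv psi) (S a).
pose D k := 'D_(0, dl k) (T f) a.
pose E k i := ('D_(0, dl k) S a - dl k) 0 i.
have lk k : l k = D k - \sum_i E k i * l i.
  have -> : D k = \sum_i ('D_(0, dl k) S a) 0 i * l i := derive_pullback_chain (dl k) Cf Wa.
  rewrite -sumrB (bigD1 k)//= big1 => [|i ik].
    by rewrite /E !mxE !eqxx /= addr0 -mulrBl opprB addrC subrK mul1r.
  by rewrite /E !mxE (negbTE ik) andbF subr0 subrr.
have Eh k i : `|E k i| <= h by rewrite (le_trans (mx_entry_le _ _ _) (Ha k)).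
change (\sum_i `|l i| <= 2 * \sum_k `|D k|).
clearbody l D E; set s := \sum_i `|l i|.
have h1 : s <= \sum_k (`|D k| + h * s).
  apply: ler_sum => k _; rewrite {1}lk (le_trans (ler_normB _ _))// lerD2l.
  rewrite (le_trans (ler_norm_sum _ _ _))// mulr_sumr; apply: ler_sum => i _.
  by rewrite normrM; apply: ler_wpM2r.
have s0 : 0 <= s by apply: sumr_ge0.
have h2 : (h * s) *+ n <= s / 2.
  have hn : h * n%:R <= 2^-1.
    rewrite /h invfM -mulrA; apply: ler_piMr => //.
    by rewrite mulrC ler_pdivrMr// mul1r ler_nat.
  by rewrite -mulr_natr mulrAC mulrC; apply: ler_wpM2l.
move: h1; rewrite big_split /= sumr_const card_ord; move: h2.
by move: (_ *+ n) (\sum_k _) => q1 q2; lra.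
Unshelve. all: by end_near. Qed.

(** Taylor expansion controls the fibre derivatives of [T f] at [a]; the stopping condition asks for
    the gradient at the retracted point, in another tangent space. This is the passage from one to
    the other, uniform in [f] so that it applies to Lagrangians with varying multipliers. *)
Lemma near_grad_bound : exists2 C : R, 0 <= C & \forall a \near a0,
  W a /\ forall f, CkM 1 f ->
    rnorm (retr_local rt p a) (grad f (retr_local rt p a)) <=
      C * \sum_k `|'D_(0, dl k) (T f) a|.
Proof.
have [c c0 Hc] := metric_near_equiv p.
have cS : {for a0, continuous S}.
  exact: (Ck_continuous (@smooth_retr _ _ _ _ rtP p p 0) (retr_dom_center rtP p)).
(* The norm equivalence is required at the retracted point, so it is pulled back along [S], which
   maps [a0] to [u0]. *)
have n1 : \forall a \near a0, forall x, cdom psi x -> psi x = S a ->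
    forall d, `|d| <= c * rnorm x (A x d) /\ rnorm x (A x d) <= c * `|d|.
  apply: (cS (fun u => forall x, cdom psi x -> psi x = u ->
    forall d, `|d| <= c * rnorm x (A x d) /\ rnorm x (A x d) <= c * `|d|)).
  by rewrite /= retr_local_coord (rt0 rtP).
exists (2 * c); first by rewrite mulr_ge0// ltW.
apply: filterS (filterI n1 near_transport) => a [Ha [Wa Hl]]; split=> // f Cf.
set x := retr_local rt p a.
have px : cdom psi x by case: Wa.
have {}Ha := Ha x px erefl.
rewrite -mulrA mulrC -mulrA mulrC.
have := Hl f Cf.
set s := \sum_i `|pd i _ _|; set D := \sum_k _ => hs.
have s0 : 0 <= s by apply: sumr_ge0.
have c0' := ltW c0.
have Hz e : `|inner x (grad f x) (A x e)| <= s * `|e|.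
  rewrite inner_grad_tangent// (derive_lin (@open_cimg _ _ _ p) (Cf p) (cimg_chart px)).
  rewrite (le_trans (ler_norm_sum _ _ _))// mulr_suml; apply: ler_sum => i _.
  by rewrite normrM mulrC; apply: ler_wpM2l => //; exact: mx_entry_le.
have := rnorm_dual px s0 c0' (fun d => (Ha d).1) Hz.
move/le_trans; apply.
have -> : D * 2 * c = 2 * D * c by rewrite (mulrC D).
exact: ler_wpM2r.
Qed.

(** All four estimates come from the mean value theorem on the segment from [(u, 0)] to [(u, v)].
    Only the expansion of the derivative calls for the Lipschitz bound, since it compares second
    derivatives at two points; for the others, bounds on the first and second derivatives
    suffice. *)
Lemma near_taylor f : CkM 2 f -> pullback_hess_lipschitz rt p f ->
  exists2 C : R, 0 <= C & \forall a \near a0, [/\ W a /\ W (a.1, 0),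
    forall k, `|'D_(0, dl k) (T f) a - 'D_(0, dl k) (T f) (a.1, 0)
       - 'D_(0, a.2) ('D_(0, dl k) (T f)) (a.1, 0)| <= C * `|a.2| ^+ 2,
    forall k, `|'D_(0, dl k) (T f) a - 'D_(0, dl k) (T f) (a.1, 0)| <= C * `|a.2|,
    `|T f a - T f (a.1, 0) - 'D_(0, a.2) (T f) (a.1, 0)| <= C * `|a.2| ^+ 2
  & `|T f a - T f (a.1, 0)| <= C * `|a.2|].
Proof.
move=> Cf Lf; have [C C0 HC] := near_hess_lipschitz rtP Cf Lf.
have CT := Ck_pullback rtP p Cf.
have W0 := retr_dom_center rtP p.
pose D2 i j a := 'D_(0, dl i) ('D_(0, dl j) (T f)) a.
pose D1 i a := 'D_(0, dl i) (T f) a.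
have n1 : \forall a \near a0, forall i, `|D1 i a| <= `|D1 i a0| + 1.
  near=> a; near: a; apply: filter_forall => i.
  have := Ck_continuous (Ck_derive (0, dl i) CT) W0.
  move=> /cvgrPdist_le/(_ _ ltr01); apply: filterS => a.
  move=> h; rewrite -[D1 i a](subrK (D1 i a0)) (le_trans (ler_normD _ _))// addrC.
  by rewrite lerD2l distrC.
have n2 : \forall a \near a0, forall i j, `|D2 i j a| <= `|D2 i j a0| + 1.
  near=> a; near: a; apply: filter_forall => i; apply: filter_forall => j.
  have := Ck_continuous (Ck_derive (0, dl i) (Ck_derive (0, dl j) CT)) W0.
  move=> /cvgrPdist_le/(_ _ ltr01); apply: filterS => a.
  move=> h; rewrite -[D2 i j a](subrK (D2 i j a0)) (le_trans (ler_normD _ _))// addrC.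
  by rewrite lerD2l distrC.
pose B1 := \sum_i (`|D1 i a0| + 1).
pose B2 := \sum_i \sum_j (`|D2 i j a0| + 1).
have B10 : 0 <= B1 by apply: sumr_ge0 => i _; rewrite addr_ge0.
have B20 : 0 <= B2 by apply: sumr_ge0 => i _; apply: sumr_ge0 => j _; rewrite addr_ge0.
have nb : 0 <= n%:R * B2 by rewrite mulr_ge0.
(* The four estimates hold with [C], [B2], [n%:R * B2] and [B1] respectively; the factor [n] comes
   from summing over the coordinates of [v]. *)
have [K [K0 KC KB1 KB2 Kn]] : exists K : R, [/\ 0 <= K, C <= K, B1 <= K, B2 <= K
    & n%:R * B2 <= K].
  exists (C + B1 + (B2 + n%:R * B2)); split.
  - by rewrite !addr_ge0.
  - by rewrite -addrA lerDl !addr_ge0.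
  - by rewrite (addrC C) -addrA lerDl !addr_ge0.
  - by rewrite addrCA lerDl !addr_ge0.
  - by rewrite addrA lerDr !addr_ge0.
exists K; first exact: K0.
have : \forall a \near a0, [/\ W a, forall d e,
    `|'D_(0, d) ('D_(0, e) (T f)) a - 'D_(0, d) ('D_(0, e) (T f)) (a.1, 0)| <=
     C * `|a.2| * `|d| * `|e|, forall i, `|D1 i a| <= `|D1 i a0| + 1
   & forall i j, `|D2 i j a| <= `|D2 i j a0| + 1].
  by apply: filterS (filterI HC (filterI n1 n2)) => a [[? ?] [? ?]].
rewrite -nbhs_nearE => /nbhs_ballP[r /= r0 Hr].
have : \forall a \near a0, ball a0 r a by exact: nbhsx_ballx.
apply: filterS => -[u v] [/= bu bv].
have r0' : ball (0 : 'rV[R]_n) r 0 by exact: ballxx.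
have bs b (s : R) : ball (0 : 'rV[R]_n) r b -> 0 <= s <= 1 -> ball (0 : 'rV[R]_n) r (s *: b).
  rewrite -ball_normE /= !sub0r !normrN => bb /andP[s0 s1].
  by apply: le_lt_trans bb; rewrite normrZ ger0_norm// ler_piMl.
have eL b (s : R) : (u, 0) + s *: (0, b) = (u, s *: b) :> 'rV[R]_n * 'rV[R]_n.
  by congr pair; rewrite /= ?scaler0 ?addr0 ?add0r.
have e1 b : (u, 0) + (0, b) = (u, b) :> 'rV[R]_n * 'rV[R]_n.
  by have := eL b 1; rewrite !scale1r.
have s01 b (s : R) : 0 <= s <= 1 -> `|s *: b| <= `|b|.
  by move=> /andP[s0 s1]; rewrite normrZ ger0_norm// ler_piMl.
have {}Hr b : ball (0 : 'rV[R]_n) r b -> [/\ W (u, b), forall d e,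
    `|'D_(0, d) ('D_(0, e) (T f)) (u, b) - 'D_(0, d) ('D_(0, e) (T f)) (u, 0)| <=
     C * `|b| * `|d| * `|e|, forall i, `|D1 i (u, b)| <= `|D1 i a0| + 1
   & forall i j, `|D2 i j (u, b)| <= `|D2 i j a0| + 1].
  by move=> bb; apply: (Hr (u, b)).
have Wb b : ball (0 : 'rV[R]_n) r b -> W (u, b) by case/Hr.
have Wu := Wb 0 r0'.
have dl1 (k : 'I_n) : `|dl k| <= 1.
  apply: mx_norm_le_entries => // i j; rewrite !mxE.
  by case: (_ && _); rewrite ?normr1 ?normr0.
have d1lin b d : W (u, b) -> 'D_(0, d) (T f) (u, b) = \sum_i d 0 i * D1 i (u, b).
  by move=> Ws; exact: (derive_slice_lin d oW (CkW CT) Ws).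
have d1le b d : ball (0 : 'rV[R]_n) r b -> `|'D_(0, d) (T f) (u, b)| <= B1 * `|d|.
  move=> hb; have [Ws _ HD1 _] := Hr _ hb.
  rewrite (d1lin b d Ws) (le_trans (ler_norm_sum _ _ _))// mulr_suml; apply: ler_sum => i _.
  by rewrite normrM mulrC; apply: ler_pM; [exact: normr_ge0|exact: normr_ge0|exact: HD1|exact: mx_entry_le].
have d2le b d k : ball (0 : 'rV[R]_n) r b ->
    `|'D_(0, d) ('D_(0, dl k) (T f)) (u, b)| <= B2 * `|d|.
  move=> hb; have [Ws _ _ HD2] := Hr _ hb.
  apply: (le_trans (derive2_pullback_le rtP _ _ Cf Ws)).
  apply: (@le_trans _ _ ((\sum_i \sum_j `|D2 i j (u, b)|) * `|d|)).
    apply: ler_piMr; last exact: dl1.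
    apply: mulr_ge0; last exact: normr_ge0.
    by apply: sumr_ge0 => i _; apply: sumr_ge0 => j _; exact: normr_ge0.
  apply: ler_wpM2r; first exact: normr_ge0.
  by apply: ler_sum => i _; apply: ler_sum => j _; exact: HD2.
have mvt1 k b : ball (0 : 'rV[R]_n) r b -> exists2 s : R, 0 <= s <= 1 &
    D1 k (u, b) - D1 k (u, 0) = 'D_(0, b) ('D_(0, dl k) (T f)) (u, s *: b).
  move=> hb; have [s hs|s hs] := @MVT_line _ _ ('D_(0, dl k) (T f)) (u, 0) (0, b).
    by rewrite eL; exact (Ck_derivable (Ck_derive (0, dl k) CT) (Wb _ (bs b s hb hs))).
  by rewrite e1 eL => E; exists s.
have mvt0 b : ball (0 : 'rV[R]_n) r b -> exists2 s : R, 0 <= s <= 1 &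
    T f (u, b) - T f (u, 0) = 'D_(0, b) (T f) (u, s *: b).
  move=> hb; have [s hs|s hs] := @MVT_line _ _ (T f) (u, 0) (0, b).
    by rewrite eL; exact (Ck_derivable CT (Wb _ (bs b s hb hs))).
  by rewrite e1 eL => E; exists s.
have two k b : ball (0 : 'rV[R]_n) r b -> `|D1 k (u, b) - D1 k (u, 0)| <= B2 * `|b|.
  move=> hb; have [s hs ->] := mvt1 k b hb.
  exact: (d2le _ b k (bs b s hb hs)).
have v0 : 0 <= `|v| := normr_ge0 v.
have v2 : 0 <= `|v| ^+ 2 := sqr_ge0 _.
split.
- by split; [exact: Wb|exact: Wu].
- move=> k /=; have [s hs E] := mvt1 k v bv.
  rewrite -/(D1 k (u, v)) -/(D1 k (u, 0)) E.
  have [_ HL _ _] := Hr _ (bs v s bv hs).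
  apply: (le_trans (HL v (dl k))).
  apply: (@le_trans _ _ (C * `|v| ^+ 2)).
    rewrite expr2 mulrA -[leRHS]mulr1; apply: ler_pM.
    - by apply: mulr_ge0; [apply: mulr_ge0; [exact: C0|exact: normr_ge0]|exact: v0].
    - exact: normr_ge0.
    - apply: ler_wpM2r; first exact: v0.
      by apply: ler_wpM2l; [exact: C0|exact: s01].
    - exact: dl1.
  by apply: ler_wpM2r; [exact: v2|exact: KC].
- move=> k /=; apply: (le_trans (two k v bv)).
  by apply: ler_wpM2r; [exact: v0|exact: KB2].
- have [s hs E] := mvt0 v bv; rewrite [X in `|X - _|]E /=.
  have Ws := Wb _ (bs v s bv hs).
  rewrite (d1lin _ v Ws) (d1lin _ v Wu) -sumrB.
  apply: (@le_trans _ _ (\sum_(i < n) B2 * `|v| ^+ 2)).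
    apply: (le_trans (ler_norm_sum _ _ _)); apply: ler_sum => i _.
    rewrite -mulrBr normrM expr2 mulrA mulrC.
    apply: ler_pM; [exact: normr_ge0|exact: normr_ge0| |exact: mx_entry_le].
    apply: (le_trans (two i _ (bs v s bv hs))); by apply: ler_wpM2l; [exact: B20|exact: s01].
  rewrite sumr_const card_ord -mulr_natl mulrA.
  by apply: ler_wpM2r; [exact: v2|exact: Kn].
- have [s hs E] := mvt0 v bv; rewrite /= E.
  apply: (le_trans (d1le _ v (bs v s bv hs))).
  by apply: ler_wpM2r; [exact: v0|exact: KB1].
Unshelve. all: by end_near. Qed.

End TaylorEstimates.

(** * The Jacobian of the KKT map *)

Section FiniteDimensional.
Variables (R : realType) (n m q : nat).
Local Notation D := ('rV[R]_n * 'rV[R]_m * 'rV[R]_q)%type.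

Lemma linear_inj_bij (V : vectType R) (f : V -> V) :
  linear f -> (forall v, f v = 0 -> v = 0) ->
  exists2 g : V -> V, linear g & cancel f g /\ cancel g f.
Proof.
move=> lf f0; pose fL := GRing.isLinear.Build _ _ _ _ f lf.
pose F : {linear V -> V} := HB.pack f fL.
have kf : lker (linfun F) == 0%VS.
  apply/lker0P => u v; rewrite !lfunE /= => fuv; apply/subr0_eq/f0.
  by rewrite -[f]/(F : _ -> _) linearB /= fuv subrr.
exists (linfun F)^-1%VF => [|]; first exact: linearP.
split=> v; first by have := lker0_lfunK kf v; rewrite lfunE.
by have := lker0_lfunVK kf v; rewrite lfunE.
Qed.

Lemma linear_bound (f : D -> D) : linear f -> forall d, `|f d| <=
  (\sum_i `|f (delta_mx 0 i, 0, 0)| + \sum_i `|f (0, delta_mx 0 i, 0)|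
   + \sum_i `|f (0, 0, delta_mx 0 i)|) * `|d|.
Proof.
move=> lf [[a b] c].
have lD d e : f (d + e) = f d + f e.
  by have := lf 1 d e; rewrite !scale1r.
have E : (a, b, c) = (a, 0, 0) + (0, b, 0) + (0, 0, c) :> D.
  by congr (_, _, _) => /=; rewrite ?addr0 ?add0r.
have h1 := @linear_rV_norm_le R n _ (fun a => f (a, 0, 0)).
have h2 := @linear_rV_norm_le R m _ (fun b => f (0, b, 0)).
have h3 := @linear_rV_norm_le R q _ (fun c => f (0, 0, c)).
rewrite {1}E !lD (le_trans (ler_normD _ _))// (mulrDl _ _ `|_|) lerD//; last first.
  apply: (le_trans (h3 _ c)).
    by move=> k u v; rewrite -lf; congr f; congr (_, _, _); rewrite /= ?scaler0 ?addr0.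
  apply: ler_wpM2l; first by apply: sumr_ge0 => i _; exact: normr_ge0.
  by rewrite [leRHS]prod_normE le_max lexx orbT.
rewrite (le_trans (ler_normD _ _))// (mulrDl _ _ `|_|) lerD//.
  apply: (le_trans (h1 _ a)).
    by move=> k u v; rewrite -lf; congr f; congr (_, _, _); rewrite /= ?scaler0 ?addr0.
  apply: ler_wpM2l; first by apply: sumr_ge0 => i _; exact: normr_ge0.
  by rewrite [leRHS]prod_normE le_max prod_normE le_max lexx.
apply: (le_trans (h2 _ b)).
  by move=> k u v; rewrite -lf; congr f; congr (_, _, _); rewrite /= ?scaler0 ?addr0.
apply: ler_wpM2l; first by apply: sumr_ge0 => i _; exact: normr_ge0.
by rewrite [leRHS]prod_normE le_max prod_normE le_max lexx orbT.
Qed.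

(** Stability of invertibility. Continuity for each fixed [d] is enough, because the operator norm
    of [K w - K w0] is bounded by its values on finitely many basis vectors. *)
Lemma near_injective_bound (X : topologicalType) (w0 : X) (K : X -> D -> D) :
  (\forall w \near w0, linear (K w)) ->
  (forall d, {for w0, continuous (K ^~ d)}) ->
  (forall d, K w0 d = 0 -> d = 0) ->
  exists2 C : R, 0 < C & \forall w \near w0, forall d, `|d| <= C * `|K w d|.
Proof.
move=> lK cK K0; have lK0 := nbhs_singleton lK.
have [g lg [Kg _]] := linear_inj_bij lK0 K0.
pose C0 := \sum_i `|g (delta_mx 0 i, 0, 0)| + \sum_i `|g (0, delta_mx 0 i, 0)|
   + \sum_i `|g (0, 0, delta_mx 0 i)| + 1.
have C00 : 0 < C0.
  by rewrite /C0 ltr_wpDl// !addr_ge0//; apply: sumr_ge0 => i _; exact: normr_ge0.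
have HC0 d : `|d| <= C0 * `|K w0 d|.
  rewrite -{1}[d]Kg (le_trans (linear_bound lg _))//.
  by apply: ler_wpM2r => //; rewrite /C0 lerDl.
(* The deviations on the [n + m + q] basis vectors then sum to at most [(2 * C0)^-1], which costs
   half of [|d|] and doubles the constant. *)
pose e := (2 * C0 * (n + m + q).+1%:R)^-1.
have e0 : 0 < e by rewrite invr_gt0 !mulr_gt0.
have near_le k (b : 'I_k -> D) : \forall w \near w0, forall i, `|K w (b i) - K w0 (b i)| <= e.
  near=> w; near: w; apply: filter_forall => i.
  have := cK (b i) => /cvgrPdist_le/(_ _ e0).
  by apply: filterS => w; rewrite distrC.
exists (2 * C0); first by rewrite mulr_gt0.
have n1 := near_le _ (fun i => (delta_mx 0 i, 0, 0)).
have n2 := near_le _ (fun i => (0, delta_mx 0 i, 0)).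
have n3 := near_le _ (fun i => (0, 0, delta_mx 0 i)).
apply: filterS (filterI lK (filterI n1 (filterI n2 n3))) => w [lKw [H1 [H2 H3]]] d.
have lB : linear (fun d => K w d - K w0 d).
  by move=> k a b; rewrite lKw lK0 scalerBr opprD addrACA.
have h := linear_bound lB d.
have Hs k (b : 'I_k -> D) : (forall i, `|K w (b i) - K w0 (b i)| <= e) ->
    \sum_i `|K w (b i) - K w0 (b i)| <= k%:R * e.
  move=> Hb; rewrite mulr_natl -[k in _ *+ k]card_ord -sumr_const.
  by apply: ler_sum => i _.
have {}h : `|K w d - K w0 d| <= ((n + m + q)%:R * e) * `|d|.
  apply: (le_trans h); apply: ler_wpM2r => //.
  by rewrite !natrD !mulrDl; apply: lerD; [apply: lerD|]; exact: Hs.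
have h2 : (n + m + q)%:R * e <= (2 * C0)^-1.
  rewrite /e invfM mulrCA; apply: ler_piMr; first by rewrite invr_ge0 ltW// mulr_gt0.
  by rewrite ler_pdivrMr// mul1r ler_nat.
have h3 : C0 * `|K w d - K w0 d| <= `|d| / 2.
  apply: (@le_trans _ _ (C0 * ((2 * C0)^-1 * `|d|))).
    apply: ler_wpM2l; first exact: ltW.
    by apply: (le_trans h); apply: ler_wpM2r.
  have Cn : C0 != 0 by rewrite gt_eqF.
  rewrite le_eqVlt; apply/orP; left; apply/eqP.
  by move: `|d| => r; field.
have h4 : `|d| <= C0 * `|K w d| + C0 * `|K w d - K w0 d|.
  rewrite -mulrDr (le_trans (HC0 d))//; apply: ler_wpM2l; first exact: ltW.
  by rewrite -{1}(subKr (K w d) (K w0 d)) (le_trans (ler_normB _ _)).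
move: h3 h4; rewrite -mulrA.
by move: `|d| (C0 * `|K w d|) (C0 * `|K w d - K w0 d|) => r1 r2 r3; lra.
Unshelve. all: by end_near. Qed.

End FiniteDimensional.

Section Free.
Variables (R : fieldType) (V : vectType R).

(** Linear independence in indexed form, for the concatenated list of gradients in [licq]. *)
Lemma free_map_eq0 (I : eqType) (s : seq I) (F : I -> V) (c : I -> R) :
  free (map F s) -> \sum_(i <- s) c i *: F i = 0 -> forall i, i \in s -> c i = 0.
Proof.
elim: s => // a s IH /=; rewrite free_cons => /andP[aF fs]; rewrite big_cons => E.
have ca : c a = 0.
  apply/eqP; apply: contraNT aF => ca.
  have -> : F a = - (c a)^-1 *: \sum_(i <- s) c i *: F i.
    move/eqP: E; rewrite addr_eq0 => /eqP E.
    by rewrite scaleNr -scalerN -E scalerA mulVf// scale1r.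
  rewrite memvZ// big_seq memv_suml// => i si.
  by rewrite memvZ// memv_span// map_f.
move=> i; rewrite inE => /predU1P[->//|]; apply: IH => //.
by rewrite ca scale0r add0r in E.
Qed.

End Free.

(** * The Lagrangian and its Jacobian in coordinates *)

Section Kkt.
Variables (R : realType) (n m q : nat) (M : riemannianManifold R n).
Variable P : nlp m q M.
Hypothesis P_C2 : nlp_C2 P.
Variable rt : M -> 'rV[R]_n -> M.
Hypotheses (rtP : retraction rt) (rt2 : second_order rt).
Variable xs : M.

Local Notation psi := (chart_at xs).
Local Notation A x := (tangent_of xs (psi x)).
Local Notation T := (local_pullback rt xs).
Local Notation W := (retr_dom rt xs xs).
Local Notation u0 := (Defs.coord xs).
Local Notation dl k := (delta_mx 0 k : 'rV[R]_n).
Local Notation D := ('rV[R]_n * 'rV[R]_m * 'rV[R]_q)%type.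
Implicit Types (y : 'rV[R]_m) (z : 'rV[R]_q).

(** The common shape of the Lagrangian and of its derivatives. It keeps the multipliers explicit,
    since the Newton step changes them together with the point. *)
Definition lcomb y z (F : R) (G : 'I_m -> R) (H : 'I_q -> R) : R :=
  F - \sum_i y 0 i * G i + \sum_j z 0 j * H j.

Definition lagr_comb y z (Phi : (M -> R) -> R) : R :=
  lcomb y z (Phi (obj P)) (fun i => Phi (ineqc P i)) (fun j => Phi (eqc P j)).

Lemma lcomb_linear y z k F G H F' G' H' :
  lcomb y z (k * F + F') (fun i => k * G i + G' i) (fun j => k * H j + H' j) =
  k * lcomb y z F G H + lcomb y z F' G' H'.
Proof.
rewrite /lcomb.
have -> : \sum_i y 0 i * (k * G i + G' i) = k * (\sum_i y 0 i * G i) + \sum_i y 0 i * G' i.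
  by rewrite mulr_sumr -big_split; apply: eq_bigr => i _ /=; rewrite mulrDr mulrCA.
have -> : \sum_i z 0 i * (k * H i + H' i) = k * (\sum_i z 0 i * H i) + \sum_i z 0 i * H' i.
  by rewrite mulr_sumr -big_split; apply: eq_bigr => i _ /=; rewrite mulrDr mulrCA.
move: (\sum_i _) (\sum_i _) (\sum_i _) (\sum_i _) => *; ring.
Qed.

Lemma lcomb_linear_coef y z y' z' k F G H :
  lcomb (k *: y + y') (k *: z + z') F G H =
  k * lcomb y z 0 G H + lcomb y' z' F G H.
Proof.
rewrite /lcomb.
have -> : \sum_i (k *: y + y') 0 i * G i = k * (\sum_i y 0 i * G i) + \sum_i y' 0 i * G i.
  by rewrite mulr_sumr -big_split; apply: eq_bigr => i _ /=; rewrite !mxE mulrDl mulrA.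
have -> : \sum_i (k *: z + z') 0 i * H i = k * (\sum_i z 0 i * H i) + \sum_i z' 0 i * H i.
  by rewrite mulr_sumr -big_split; apply: eq_bigr => i _ /=; rewrite !mxE mulrDl mulrA.
move: (\sum_i _) (\sum_i _) (\sum_i _) (\sum_i _) => *; ring.
Qed.

Lemma lcombD y z y' z' F G H :
  lcomb (y + y') (z + z') F G H = lcomb y z F G H + lcomb y' z' 0 G H.
Proof.
by rewrite addrC (addrC z) -[y']scale1r -[z']scale1r lcomb_linear_coef !scale1r mul1r addrC.
Qed.

Lemma derive_lcomb (V : normedModType R) y z (F : V -> R) (G : 'I_m -> V -> R)
    (H : 'I_q -> V -> R) a v :
  derivable F a v -> (forall i, derivable (G i) a v) -> (forall j, derivable (H j) a v) ->
  'D_v (fun a => lcomb y z (F a) (G ^~ a) (H ^~ a)) a =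
  lcomb y z ('D_v F a) (fun i => 'D_v (G i) a) (fun j => 'D_v (H j) a).
Proof.
move=> dF dG dH.
have -> : (fun a => lcomb y z (F a) (G ^~ a) (H ^~ a)) =
    F - \sum_i (y 0 i *: G i) + \sum_j (z 0 j *: H j).
  by apply/funext => b; rewrite /lcomb !fctE !fct_sumE.
have dyG i : derivable (y 0 i *: G i) a v by apply: derivableZ; exact: dG.
have dzH i : derivable (z 0 i *: H i) a v by apply: derivableZ; exact: dH.
have d1 := derivable_sum dyG; have d2 := derivable_sum dzH.
rewrite (deriveD (derivableB dF d1) d2) (deriveB dF d1) (derive_sum dyG) (derive_sum dzH).
rewrite /lcomb; congr (_ - _ + _).
  by apply: eq_bigr => i _; have -> := deriveZ (y 0 i) (dG i).
by apply: eq_bigr => i _; have -> := deriveZ (z 0 i) (dH i).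
Qed.

Lemma Ck_obj : CkM 2 (obj P).
Proof. case: P_C2 => H _ _; exact H. Qed.

Lemma Ck_ineqc i : CkM 2 (ineqc P i).
Proof. case: P_C2 => _ H _; exact (H i). Qed.

Lemma Ck_eqc j : CkM 2 (eqc P j).
Proof. case: P_C2 => _ _ H; exact (H j). Qed.

Lemma CkMW k (f : M -> R) : CkM k.+1 f -> CkM k f.
Proof. by move=> Cf x; exact: (CkW (Cf x)). Qed.

Lemma Ck_lagrangian y z : CkM 2 (lagrangian P y z).
Proof.
move=> x; have oU := @open_cimg _ _ _ x.
have -> : lagrangian P y z \o cinv (chart_at x) = (fun u =>
    ((obj P \o cinv (chart_at x)) u
    + \sum_i (- y 0 i) * (ineqc P i \o cinv (chart_at x)) u)
    + \sum_j z 0 j * (eqc P j \o cinv (chart_at x)) u).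
  apply/funext => u; rewrite /lagrangian /= -sumrN; congr (_ + _ + _).
  by apply: eq_bigr => i _; rewrite mulNr.
apply: Ck_add; first exact: oU.
  apply: Ck_add; [exact: oU|exact: Ck_obj|].
  apply: Ck_sum; first exact: oU.
  by move=> i; apply: Ck_mul; [exact: oU|exact: Ck_cst|exact: Ck_ineqc].
apply: Ck_sum; first exact: oU.
by move=> i; apply: Ck_mul; [exact: oU|exact: Ck_cst|exact: Ck_eqc].
Qed.

Let oW : open W. Proof. exact: open_retr_dom. Qed.
Let CT f : CkM 2 f -> Ck 2 W (T f). Proof. exact: Ck_pullback. Qed.
Let dT f a v : CkM 2 f -> W a -> derivable (T f) a v.
Proof. by move=> Cf Wa; exact (Ck_derivable (CT Cf) Wa). Qed.
Let dDT f a v e : CkM 2 f -> W a -> derivable ('D_e (T f)) a v.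
Proof. by move=> Cf Wa; exact (Ck_derivable (Ck_derive e (CT Cf)) Wa). Qed.

Lemma derive_lagrangian y z a e : W a ->
  'D_e (T (lagrangian P y z)) a = lagr_comb y z (fun f => 'D_e (T f) a).
Proof.
move=> Wa.
exact (@derive_lcomb _ y z (T (obj P)) (fun i => T (ineqc P i)) (fun j => T (eqc P j)) a e
  (@dT _ _ e Ck_obj Wa) (fun i => @dT _ _ e (Ck_ineqc i) Wa) (fun j => @dT _ _ e (Ck_eqc j) Wa)).
Qed.

Lemma derive2_lagrangian y z a d e : W a ->
  'D_d ('D_e (T (lagrangian P y z))) a =
  lagr_comb y z (fun f => 'D_d ('D_e (T f)) a).
Proof.
move=> Wa.
have E b : W b -> 'D_e (T (lagrangian P y z)) b =
    lcomb y z ('D_e (T (obj P)) b) (fun i => 'D_e (T (ineqc P i)) b)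
      (fun j => 'D_e (T (eqc P j)) b).
  by move=> Wb; exact: derive_lagrangian.
rewrite (derive_eq_open d oW E Wa).
exact (@derive_lcomb _ y z ('D_e (T (obj P))) (fun i => 'D_e (T (ineqc P i)))
  (fun j => 'D_e (T (eqc P j))) a d (@dDT _ _ d e Ck_obj Wa)
  (fun i => @dDT _ _ d e (Ck_ineqc i) Wa) (fun j => @dDT _ _ d e (Ck_eqc j) Wa)).
Qed.

(* [coordJ] is the Jacobian J_F read in the chart at [xs]: a tangent vector at [x]
   is the image by [A x] of its coordinates, and the first component of the
   result is represented by its inner products with the vectors [A x (dl k)].
   Unlike [kktJ], it is continuous in the base point. *)
Definition coordJ1 u y z (d1 : 'rV[R]_n) (dy : 'rV[R]_m) (dz : 'rV[R]_q) k : R :=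
  lagr_comb y z (fun f => 'D_(0, d1) ('D_(0, dl k) (T f)) (u, 0))
  + lcomb dy dz 0 (fun i => 'D_(0, dl k) (T (ineqc P i)) (u, 0))
                  (fun j => 'D_(0, dl k) (T (eqc P j)) (u, 0)).

Definition coordJ (w d : D) : D :=
  let: (u, y, z) := w in
  let: (d1, dy, dz) := d in
  (\row_k coordJ1 u y z d1 dy dz k,
   \row_i (y 0 i * 'D_(0, d1) (T (ineqc P i)) (u, 0) + T (ineqc P i) (u, 0) * dy 0 i),
   \row_j 'D_(0, d1) (T (eqc P j)) (u, 0)).

Lemma pullback0 f x : cdom psi x -> T f (psi x, 0) = f x.
Proof.
by move=> px; rewrite /local_pullback retr_localE// (tangent0 px) rt0.
Qed.

Lemma coordJ_kktJ x y z d dy dz : cdom psi x ->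
  let V := kktJ P (x, y, z) (A x d, dy, dz) in
  coordJ (psi x, y, z) (d, dy, dz) =
  (\row_k inner x V.1.1 (A x (dl k)), V.1.2, V.2).
Proof.
move=> px; have W0 := retr_dom0 rtP px; rewrite /=.
congr (_, _, _).
- apply/rowP => k; rewrite !mxE /coordJ1.
  have -> : lcomb dy dz 0 (fun i => 'D_(0, dl k) (T (ineqc P i)) (psi x, 0))
     (fun j => 'D_(0, dl k) (T (eqc P j)) (psi x, 0)) =
     - \sum_i dy 0 i * inner x (grad (ineqc P i) x) (A x (dl k))
     + \sum_j dz 0 j * inner x (grad (eqc P j) x) (A x (dl k)).
    rewrite /lcomb add0r; congr (- _ + _); apply: eq_bigr => i _; congr (_ * _).
      by rewrite (inner_grad_pullback rtP (dl k) (CkMW (Ck_ineqc i)) px).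
    by rewrite (inner_grad_pullback rtP (dl k) (CkMW (Ck_eqc i)) px).
  rewrite -(derive2_lagrangian y z (0, d) (0, dl k) W0).
  rewrite -(inner_hess_pullback rtP rt2 d (dl k) (Ck_lagrangian y z) px).
  rewrite /inner dotmDl dotmBl !dotm_suml -addrA; congr (_ + (- _ + _)).
    by apply: eq_bigr => i _; rewrite dotmZl.
  by apply: eq_bigr => i _; rewrite dotmZl.
- apply/rowP => i; rewrite !mxE (pullback0 _ px).
  by rewrite (inner_grad_pullback rtP d (CkMW (Ck_ineqc i)) px).
- apply/rowP => j; rewrite !mxE.
  by rewrite (inner_grad_pullback rtP d (CkMW (Ck_eqc j)) px).
Qed.

Lemma derive_pullback_linear f u d e k : CkM 2 f -> W (u, 0) ->
  'D_(0, k *: d + e) (T f) (u, 0) =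
  k * 'D_(0, d) (T f) (u, 0) + 'D_(0, e) (T f) (u, 0).
Proof.
move=> Cf Wu.
pose H i := 'D_(0, dl i) (T f) (u, 0).
have E d' : 'D_(0, d') (T f) (u, 0) = \sum_i d' 0 i * H i :=
  derive_slice_lin d' oW (CkW (CT Cf)) Wu.
rewrite (E (k *: d + e)) (E d) (E e) mulr_sumr -big_split.
by apply: eq_bigr => i _ /=; rewrite !mxE mulrDl mulrA.
Qed.

Lemma derive2_pullback_linear f u d e e' k : CkM 2 f -> W (u, 0) ->
  'D_(0, k *: d + e) ('D_(0, e') (T f)) (u, 0) =
  k * 'D_(0, d) ('D_(0, e') (T f)) (u, 0) + 'D_(0, e) ('D_(0, e') (T f)) (u, 0).
Proof.
move=> Cf Wu.
pose H i j := 'D_(0, dl i) ('D_(0, dl j) (T f)) (u, 0).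
have E d' : 'D_(0, d') ('D_(0, e') (T f)) (u, 0) = \sum_i \sum_j d' 0 i * e' 0 j * H i j :=
  derive2_slice_lin d' e' oW (CT Cf) Wu.
clearbody H; rewrite (E (k *: d + e)) (E d) (E e) mulr_sumr -big_split.
apply: eq_bigr => i _ /=; rewrite mulr_sumr -big_split; apply: eq_bigr => j _ /=.
by rewrite !mxE mulrDl mulrDl !mulrA.
Qed.

Lemma coordJ1_linear u y z d dy dz e ey ez k l : W (u, 0) ->
  coordJ1 u y z (k *: d + e) (k *: dy + ey) (k *: dz + ez) l =
  k * coordJ1 u y z d dy dz l + coordJ1 u y z e ey ez l.
Proof.
move=> Wu.
have H f : CkM 2 f -> 'D_(0, k *: d + e) ('D_(0, dl l) (T f)) (u, 0) =
  k * 'D_(0, d) ('D_(0, dl l) (T f)) (u, 0) + 'D_(0, e) ('D_(0, dl l) (T f)) (u, 0).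
  by move=> Cf; exact: derive2_pullback_linear.
have E : lagr_comb y z (fun f => 'D_(0, k *: d + e) ('D_(0, dl l) (T f)) (u, 0)) =
  k * lagr_comb y z (fun f => 'D_(0, d) ('D_(0, dl l) (T f)) (u, 0)) +
  lagr_comb y z (fun f => 'D_(0, e) ('D_(0, dl l) (T f)) (u, 0)).
  rewrite /lagr_comb -lcomb_linear; congr lcomb.
  - exact: H Ck_obj.
  - by apply/funext => i; exact: H (Ck_ineqc i).
  - by apply/funext => i; exact: H (Ck_eqc i).
apply: (etrans (congr2 +%R E (lcomb_linear_coef dy dz ey ez k 0 _ _))).
apply: (etrans (addrACA _ _ _ _)); congr (_ + _); exact: esym (mulrDr _ _ _).
Qed.

Lemma coordJ_linear u y z : W (u, 0) -> linear (coordJ (u, y, z)).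
Proof.
move=> Wu k [[d dy] dz] [[e ey] ez].
change (coordJ (u, y, z) (k *: d + e, k *: dy + ey, k *: dz + ez) =
  k *: coordJ (u, y, z) (d, dy, dz) + coordJ (u, y, z) (e, ey, ez)).
rewrite /coordJ; congr (_, _, _).
- apply/rowP => l; rewrite [LHS]mxE (coordJ1_linear _ _ _ _ _ _ _ _ _ _ Wu).
  by rewrite [RHS]mxE [X in _ = X + _]mxE [X in _ = _ * X + _]mxE [X in _ = _ + X]mxE.
- apply/rowP => i.
  rewrite [LHS]mxE [RHS]mxE [X in _ = X + _]mxE [X in _ = _ * X + _]mxE [X in _ = _ + X]mxE.
  rewrite (derive_pullback_linear d e k (Ck_ineqc i) Wu).
  rewrite [(k *: dy + ey) 0 i]mxE [(k *: dy) 0 i]mxE.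
  move: ('D_(0, d) _ _) ('D_(0, e) _ _) (T _ _) (y 0 i) (dy 0 i) (ey 0 i) => *.
  by ring.
- apply/rowP => j.
  rewrite [LHS]mxE [RHS]mxE [X in _ = X + _]mxE [X in _ = _ * X + _]mxE [X in _ = _ + X]mxE.
  exact: (derive_pullback_linear d e k (Ck_eqc j) Wu).
Qed.

End Kkt.

Section Continuity.
Variables (R : realType) (X : topologicalType) (x0 : X).

Lemma continuous_row k (f : X -> 'rV[R]_k) :
  (forall j, {for x0, continuous (fun x => f x 0 j)}) -> {for x0, continuous f}.
Proof.
move=> cf; apply/cvgrPdist_le => e e0.
have n1 : \forall x \near x0, forall j, `|f x0 0 j - f x 0 j| <= e.
  near=> x; near: x; apply: filter_forall => j.
  by have := cf j => /cvgrPdist_le/(_ _ e0).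
apply: filterS n1 => x Hx; apply: mx_norm_le_entries => [|i j]; first exact: ltW.
by rewrite ord1 !mxE.
Unshelve. all: by end_near. Qed.

Lemma continuous_pair (Y Z : topologicalType) (f : X -> Y) (g : X -> Z) :
  {for x0, continuous f} -> {for x0, continuous g} ->
  {for x0, continuous (fun x => (f x, g x))}.
Proof.
by move=> cf cg; apply: (@cvg_pair _ _ _ (nbhs x0) (nbhs (f x0)) (nbhs (g x0))).
Qed.

Lemma continuous_bigsum I (r : seq I) (F : I -> X -> R) :
  (forall i, {for x0, continuous (F i)}) ->
  {for x0, continuous (fun x => \sum_(i <- r) F i x)}.
Proof.
move=> cF; elim: r => [|i r IH].
  have -> : (fun x : X => \sum_(i <- [::]) F i x) = cst 0.
    by apply/funext => x; rewrite big_nil.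
  exact: cst_continuous.
have -> : (fun x : X => \sum_(j <- i :: r) F j x) =
    (fun x => F i x + \sum_(j <- r) F j x).
  by apply/funext => x; rewrite big_cons.
exact: (cvgD (cF i) IH).
Qed.

Lemma continuous_lcomb m q (y : X -> 'rV[R]_m) (z : X -> 'rV[R]_q) F G H :
  {for x0, continuous y} -> {for x0, continuous z} -> {for x0, continuous F} ->
  (forall i, {for x0, continuous (G i)}) -> (forall j, {for x0, continuous (H j)}) ->
  {for x0, continuous (fun x => lcomb (y x) (z x) (F x) (G ^~ x) (H ^~ x))}.
Proof.
move=> cy cz cF cG cH; rewrite /lcomb.
have co k (v : X -> 'rV[R]_k) i : {for x0, continuous v} -> {for x0, continuous (fun x => v x 0 i)}.
  move=> cv; apply: (@continuous_comp _ _ _ v (fun M : 'rV[R]_k => M 0 i)) => //.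
  exact: coord_continuous.
have c1 : {for x0, continuous (fun x => \sum_i y x 0 i * G i x)}.
  by apply: continuous_bigsum => i; exact: (cvgM (co _ _ i cy) (cG i)).
have c2 : {for x0, continuous (fun x => \sum_j z x 0 j * H j x)}.
  by apply: continuous_bigsum => i; exact: (cvgM (co _ _ i cz) (cH i)).
exact: (cvgD (cvgB cF c1) c2).
Qed.

End Continuity.

(** * Uniform invertibility of the Jacobian *)

Section Nonsingular.
Variables (R : realType) (n m q : nat) (M : riemannianManifold R n).
Variable P : nlp m q M.
Hypothesis P_C2 : nlp_C2 P.
Variable rt : M -> 'rV[R]_n -> M.
Hypotheses (rtP : retraction rt) (rt2 : second_order rt).
Variable xs : M.

Local Notation psi := (chart_at xs).
Local Notation A x := (tangent_of xs (psi x)).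
Local Notation T := (local_pullback rt xs).
Local Notation W := (retr_dom rt xs xs).
Local Notation u0 := (Defs.coord xs).
Local Notation dl k := (delta_mx 0 k : 'rV[R]_n).
Local Notation D := ('rV[R]_n * 'rV[R]_m * 'rV[R]_q)%type.
Local Notation J := (coordJ P rt xs).
Implicit Types (y : 'rV[R]_m) (z : 'rV[R]_q).

Lemma coordJ_continuous ys zs d : {for (u0, ys, zs) : D, continuous (J ^~ d)}.
Proof.
case: d => [[d dy] dz].
have W0 := retr_dom_center rtP xs.
have cw1 : {for (u0, ys, zs) : D, continuous (fun w : D => w.1)} by exact: cvg_fst.
have cx : {for (u0, ys, zs) : D, continuous (fun w : D => w.1.1)}.
  apply: (@continuous_comp _ _ _ (fun w : D => w.1) fst); first exact: cw1.
  exact: cvg_fst.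
have cy : {for (u0, ys, zs) : D, continuous (fun w : D => w.1.2)}.
  apply: (@continuous_comp _ _ _ (fun w : D => w.1) snd); first exact: cw1.
  exact: cvg_snd.
have cz : {for (u0, ys, zs) : D, continuous (fun w : D => w.2)} by exact: cvg_snd.
have cu (phi : 'rV[R]_n * 'rV[R]_n -> R) : {for (u0, 0), continuous phi} ->
    {for (u0, ys, zs) : D, continuous (fun w : D => phi (w.1.1, 0))}.
  move=> cphi.
  apply: (@continuous_comp _ _ _ (fun w : D => (w.1.1, 0 : 'rV[R]_n)) phi); last exact: cphi.
  by apply: (@cvg_pair _ _ _ (nbhs ((u0, ys, zs) : D)) (nbhs u0) (nbhs (0 : 'rV[R]_n)));
    [exact: cx|exact: cvg_cst].
have c0 f : CkM 2 f -> {for (u0, 0), continuous (T f)}.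
  by move=> Cf; exact: (Ck_continuous (Ck_pullback rtP xs Cf) W0).
have c1 f e : CkM 2 f -> {for (u0, 0), continuous ('D_(0, e) (T f))}.
  by move=> Cf; exact: (Ck_continuous (Ck_derive (0, e) (Ck_pullback rtP xs Cf)) W0).
have c2 f e e' : CkM 2 f -> {for (u0, 0), continuous ('D_(0, e') ('D_(0, e) (T f)))}.
  move=> Cf.
  exact: (Ck_continuous (Ck_derive (0, e') (Ck_derive (0, e) (Ck_pullback rtP xs Cf))) W0).
have -> : J ^~ (d, dy, dz) = (fun w : D =>
  (\row_k coordJ1 P rt xs w.1.1 w.1.2 w.2 d dy dz k,
   \row_i (w.1.2 0 i * 'D_(0, d) (T (ineqc P i)) (w.1.1, 0)
      + T (ineqc P i) (w.1.1, 0) * dy 0 i),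
   \row_j 'D_(0, d) (T (eqc P j)) (w.1.1, 0))).
  by apply/funext => -[[u y] z].
have fo := Ck_obj P_C2; have fg := Ck_ineqc P_C2; have fh := Ck_eqc P_C2.
apply: continuous_pair; first apply: continuous_pair.
- apply: continuous_row => k.
  rewrite (_ : (fun w : D => _) = (fun w : D =>
    coordJ1 P rt xs w.1.1 w.1.2 w.2 d dy dz k)); last first.
    by apply/funext => w; rewrite mxE.
  apply: cvgD.
    apply: (continuous_lcomb cy cz).
    + exact: (cu _ (c2 _ _ _ fo)).
    + by move=> i; exact: (cu _ (c2 _ _ _ (fg i))).
    + by move=> j; exact: (cu _ (c2 _ _ _ (fh j))).
  apply: (@continuous_lcomb _ _ _ _ _ (cst dy) (cst dz) (cst 0)).
  + exact: cvg_cst.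
  + exact: cvg_cst.
  + exact: cvg_cst.
  + by move=> i; exact: (cu _ (c1 _ _ (fg i))).
  + by move=> j; exact: (cu _ (c1 _ _ (fh j))).
- apply: continuous_row => i.
  rewrite (_ : (fun w : D => _) = (fun w : D =>
    w.1.2 0 i * 'D_(0, d) (T (ineqc P i)) (w.1.1, 0)
      + T (ineqc P i) (w.1.1, 0) * dy 0 i)); last first.
    by apply/funext => w; rewrite mxE.
  apply: cvgD; apply: cvgM.
  + apply: (@continuous_comp _ _ _ (fun w : D => w.1.2) (fun N : 'rV[R]_m => N 0 i)).
      exact: cy.
    exact: coord_continuous.
  + exact: (cu _ (c1 _ _ (fg i))).
  + exact: (cu _ (c0 _ (fg i))).
  + exact: cvg_cst.
- apply: continuous_row => j.
  rewrite (_ : (fun w : D => _) = (fun w : D => 'D_(0, d) (T (eqc P j)) (w.1.1, 0))).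
    exact: (cu _ (c1 _ _ (fh j))).
  by apply/funext => w; rewrite mxE.
Qed.

Lemma inner_tangent_nondegenerate x (v : 'rV[R]_n) : cdom psi x ->
  (forall k, inner x v (A x (dl k)) = 0) -> v = 0.
Proof.
move=> px; have [e <-] := tangent_surj v px => H.
have eG : e *m metric xs (psi x) = 0.
  apply/rowP => k; have := H k.
  by rewrite (inner_tangent e (dl k) px) /dotm trmx_delta -colE !mxE.
have -> : e = 0.
  by rewrite -[e](mulmxK (metric_unitmx (cimg_chart px))) eG mul0mx.
exact: tangent0.
Qed.

(** The only instance of linearity of [hess] in its direction that the injectivity argument calls
    for. *)
Lemma inner_hess0 f v : CkM 2 f -> inner xs (hess f xs 0) v = 0.
Proof. by move=> Cf; rewrite (hess_pullback rtP rt2 _ _ _ Cf) derive0. Qed.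

(** By strict complementarity the second row gives orthogonality of [d] to the active gradients and
    [dy 0 i = 0] at the inactive ones. SOSC then kills [d], after which LICQ kills [dy] and [dz]. *)
Lemma kktJ_injective ys zs : kkt_triple P (xs, ys, zs) ->
  strict_complementarity P (xs, ys, zs) -> licq P xs -> sosc P (xs, ys, zs) ->
  forall d, kktJ P (xs, ys, zs) d = 0 -> d = 0.
Proof.
move=> [_ /= g0 y0] sc licqxs soscw [[d dy] dz] /= E.
have E1 := congr1 (fun V : D => V.1.1) E; have E2 := congr1 (fun V : D => V.1.2) E.
have E3 := congr1 (fun V : D => V.2) E; rewrite /= in E1 E2 E3.
have gd i : active P xs i -> inner xs (grad (ineqc P i) xs) d = 0.
  move=> ai; have := congr1 (fun r : 'rV[R]_m => r 0 i) E2; rewrite !mxE.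
  have := sc i; rewrite /= -/(active P xs i) ai addbT => yn.
  move/eqP: ai => ->; rewrite mul0r addr0 => /eqP.
  by rewrite mulf_eq0 (negbTE yn) => /eqP.
have dyi i : ~~ active P xs i -> dy 0 i = 0.
  move=> ai; have := congr1 (fun r : 'rV[R]_m => r 0 i) E2; rewrite !mxE.
  have := sc i; rewrite /= -/(active P xs i) (negbTE ai) addbF => /eqP->.
  by rewrite mul0r add0r => /eqP; rewrite mulf_eq0 -/(active P xs i) (negbTE ai) => /eqP.
have hd j : inner xs (grad (eqc P j) xs) d = 0.
  by have := congr1 (fun r : 'rV[R]_q => r 0 j) E3; rewrite !mxE.
have d0 : d = 0.
  apply/eqP; apply: contraT => dn.
  have := soscw d dn (fun i ai _ => gd i ai) _ hd.
  (* The first row paired with [d]: in each multiplier term either the coefficient or the inner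
     product vanishes. *)
  have hE : inner xs (hessL P (xs, ys, zs) d) d = 0.
    have := congr1 (fun V => inner xs V d) E1.
    rewrite /inner dotmDl dotmBl !dotm_suml dotm0l /=.
    rewrite [X in _ - X + _]big1 ?subr0 => [|i _]; last first.
      rewrite dotmZl; have [ai|ai] := boolP (active P xs i).
        by have := gd i ai; rewrite /inner => ->; rewrite mulr0.
      by rewrite dyi// mul0r.
    rewrite big1 ?addr0// => j _.
    by rewrite dotmZl; have := hd j; rewrite /inner => ->; rewrite mulr0.
  (* The premise of SOSC still open concerns active constraints with zero multiplier; [gd] satisfies
     it with equality. *)
  rewrite hE ltxx => h; apply: (contraTT _ isT) => _; apply: h => i ai _.
  by rewrite gd.
rewrite d0 in E1 *.
have h0 : hess (lagrangian P ys zs) xs 0 = 0.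
  apply/eqP; apply: contraT => /(@gram_posdef _ _ _ xs).
  by have -> := inner_hess0 (hess (lagrangian P ys zs) xs 0) (Ck_lagrangian P_C2 ys zs); rewrite ltxx.
rewrite h0 add0r in E1.
(* Both families of gradients are indexed by one sum type; [s] retains the active inequalities, the
   dropped terms being zero by [dyi]. *)
pose c (k : 'I_m + 'I_q) := match k with inl i => - dy 0 i | inr j => dz 0 j end.
pose F (k : 'I_m + 'I_q) := match k with
  | inl i => grad (ineqc P i) xs | inr j => grad (eqc P j) xs end.
pose s := [seq inl i | i <- enum 'I_m & active P xs i] ++ [seq inr j | j <- enum 'I_q].
have Es : map F s = [seq grad (ineqc P i) xs | i <- enum 'I_m & active P xs i]
    ++ [seq grad (eqc P j) xs | j <- enum 'I_q].
  by rewrite map_cat -!map_comp.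
have fs : free (map F s) by rewrite Es; exact licqxs.
have sum0 : \sum_(k <- s) c k *: F k = 0.
  apply: etrans E1; rewrite /s big_cat !big_map big_filter /=; congr (_ + _).
    rewrite -sumrN big_enum_cond /= big_mkcond; apply: eq_bigr => i _ /=.
    by case: ifPn => [_|ai]; rewrite ?scaleNr// dyi// scale0r oppr0.
have c0 := free_map_eq0 fs sum0.
have -> : dy = 0.
  apply/rowP => i; rewrite mxE; have [ai|] := boolP (active P xs i); last exact: dyi.
  apply/eqP; rewrite -oppr_eq0; apply/eqP; apply: (c0 (inl i)).
  rewrite mem_cat; apply/orP; left; apply/mapP; exists i => //.
  by rewrite mem_filter ai mem_enum.
have -> : dz = 0.
  apply/rowP => j; rewrite mxE; apply: (c0 (inr j)).
  rewrite mem_cat; apply/orP; right; apply/mapP; exists j => //.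
  by rewrite mem_enum.
by [].
Qed.

Lemma near_coordJ_bound ys zs : kkt_triple P (xs, ys, zs) ->
  strict_complementarity P (xs, ys, zs) -> licq P xs -> sosc P (xs, ys, zs) ->
  exists2 C : R, 0 < C & \forall w \near ((u0, ys, zs) : D),
    forall d, `|d| <= C * `|J w d|.
Proof.
move=> h1 h2 h3 h4; apply: near_injective_bound.
- have h : \forall u \near u0, cimg psi u.
    by apply: open_nbhs_nbhs; split; [exact: open_cimg|exact: cimg_coord].
  have h' : \forall w \near (u0, ys), cimg psi w.1.
    exact: (@cvg_fst _ _ (nbhs u0) (nbhs ys) _ _ h).
  have h'' : \forall w \near ((u0, ys, zs) : D), cimg psi w.1.1.
    exact: (@cvg_fst _ _ (nbhs (u0, ys)) (nbhs zs) _ _ h').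
  apply: filterS h'' => -[[u y] z] /= /cinv_dom[px ux].
  apply: (coordJ_linear P_C2 rtP y z).
  by rewrite -ux; exact: (retr_dom0 rtP).
- by move=> d; exact: coordJ_continuous.
- have px : cdom psi xs by exact: chart_at_dom.
  move=> [[d dy] dz] E.
  have E' : J (psi xs, ys, zs) (d, dy, dz) = 0 := E.
  have := coordJ_kktJ P_C2 rtP rt2 ys zs d dy dz px; rewrite E'.
  case EV: (kktJ P (xs, ys, zs) (A xs d, dy, dz)) => [[V1 V2] V3] /= H.
  have H1 := congr1 (fun V : D => V.1.1) H; have H2 := congr1 (fun V : D => V.1.2) H.
  have H3 := congr1 (fun V : D => V.2) H; rewrite /= in H1 H2 H3.
  have V10 : V1 = 0.
    apply: (inner_tangent_nondegenerate px) => k.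
    by have := congr1 (fun r : 'rV[R]_n => r 0 k) H1; rewrite !mxE.
  have K0 : kktJ P (xs, ys, zs) (A xs d, dy, dz) = 0 by rewrite EV V10 -H2 -H3.
  have := kktJ_injective h1 h2 h3 h4 K0.
  move=> K; have K1 := congr1 (fun V : D => V.1.1) K.
  have K2 := congr1 (fun V : D => V.1.2) K; have K3 := congr1 (fun V : D => V.2) K.
  rewrite /= in K1 K2 K3.
  by rewrite K2 K3 (tangent_inj px K1).
Qed.

(** [J] factors as [Phi] after [kktJ] after [Psi], with [Phi] injective and [Psi] surjective, so
    bijectivity of [J] passes to [kktJ]. *)
Lemma kktJ_bijective x y z (C : R) : cdom psi x ->
  (forall d, `|d| <= C * `|J (psi x, y, z) d|) -> nonsingular P (x, y, z).
Proof.
move=> px HC; have W0 := retr_dom0 rtP px.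
have J0 d : J (psi x, y, z) d = 0 -> d = 0.
  by move=> Jd; apply/eqP; rewrite -normr_le0; have := HC d; rewrite Jd normr0 mulr0.
have [g _ [gK Kg]] := linear_inj_bij (coordJ_linear P_C2 rtP y z W0) J0.
pose Phi (V : D) : D := (\row_k inner x V.1.1 (A x (dl k)), V.1.2, V.2).
pose Psi (d : D) : D := (A x d.1.1, d.1.2, d.2).
have JE d : J (psi x, y, z) d = Phi (kktJ P (x, y, z) (Psi d)).
  by case: d => [[d dy] dz]; exact: coordJ_kktJ.
have PhiI V V' : Phi V = Phi V' -> V = V'.
  case: V => [[V1 V2] V3]; case: V' => [[V1' V2'] V3'] E.
  have H1 := congr1 (fun V : D => V.1.1) E; have H2 := congr1 (fun V : D => V.1.2) E.
  have H3 := congr1 (fun V : D => V.2) E; rewrite /= in H1 H2 H3.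
  rewrite H2 H3; congr (_, _, _); apply/subr0_eq/(inner_tangent_nondegenerate px) => k.
  have := congr1 (fun r : 'rV[R]_n => r 0 k) H1; rewrite !mxE => h.
  by rewrite /inner dotmBl; apply/eqP; rewrite subr_eq0; apply/eqP.
have PsiS d : exists e, Psi e = d.
  case: d => [[d dy] dz]; have [e Ae] := tangent_surj d px.
  by exists (e, dy, dz); rewrite /Psi /= Ae.
exists (Psi \o g \o Phi) => [d|V] /=.
  by have [e <-] := PsiS d; rewrite -JE gK.
by apply: PhiI; rewrite -JE Kg.
Qed.

End Nonsingular.

(** * The Newton step *)

Section Residual.
Variables (R : realType) (n m q : nat) (M : riemannianManifold R n).
Variable P : nlp m q M.
Hypothesis P_C2 : nlp_C2 P.
Variable rt : M -> 'rV[R]_n -> M.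
Hypotheses (rtP : retraction rt) (rt2 : second_order rt).
Variable xs : M.

Local Notation psi := (chart_at xs).
Local Notation A x := (tangent_of xs (psi x)).
Local Notation T := (local_pullback rt xs).
Local Notation W := (retr_dom rt xs xs).
Local Notation u0 := (Defs.coord xs).
Local Notation dl k := (delta_mx 0 k : 'rV[R]_n).
Local Notation D := ('rV[R]_n * 'rV[R]_m * 'rV[R]_q)%type.
Local Notation J := (coordJ P rt xs).
Local Notation a0 := (u0, 0 : 'rV[R]_n).
Implicit Types (y : 'rV[R]_m) (z : 'rV[R]_q).

Definition taylor_at (f : M -> R) (C : R) (a : 'rV[R]_n * 'rV[R]_n) : Prop :=
  [/\ W a /\ W (a.1, 0),
    forall k, `|'D_(0, dl k) (T f) a - 'D_(0, dl k) (T f) (a.1, 0)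
       - 'D_(0, a.2) ('D_(0, dl k) (T f)) (a.1, 0)| <= C * `|a.2| ^+ 2,
    forall k, `|'D_(0, dl k) (T f) a - 'D_(0, dl k) (T f) (a.1, 0)| <= C * `|a.2|,
    `|T f a - T f (a.1, 0) - 'D_(0, a.2) (T f) (a.1, 0)| <= C * `|a.2| ^+ 2
  & `|T f a - T f (a.1, 0)| <= C * `|a.2|].

Lemma taylor_at_le f C C' a : C <= C' -> taylor_at f C a -> taylor_at f C' a.
Proof.
move=> CC' [h1 h2 h3 h4 h5].
have l1 : C * `|a.2| <= C' * `|a.2| by apply: ler_wpM2r.
have l2 : C * `|a.2| ^+ 2 <= C' * `|a.2| ^+ 2 by apply: ler_wpM2r => //; exact: sqr_ge0.
split=> //.
- by move=> k; exact: le_trans (h2 k) l2.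
- by move=> k; exact: le_trans (h3 k) l1.
- exact: le_trans h4 l2.
- exact: le_trans h5 l1.
Qed.

(** The family being finite, the sum of the individual constants serves for all its members. *)
Lemma near_taylor_family k (F : 'I_k -> M -> R) :
  (forall i, CkM 2 (F i)) -> (forall i, pullback_hess_lipschitz rt xs (F i)) ->
  exists2 C : R, 0 <= C & \forall a \near a0, forall i, taylor_at (F i) C a.
Proof.
move=> CF LF.
have H i : exists C : R, 0 <= C /\ \forall a \near a0, taylor_at (F i) C a.
  by have [C C0 HC] := near_taylor rtP (CF i) (LF i); exists C.
pose c i := sval (cid (H i)).
have c0 i : 0 <= c i by have [] := svalP (cid (H i)).
have Hc i : \forall a \near a0, taylor_at (F i) (c i) a by have [] := svalP (cid (H i)).
exists (\sum_i c i); first by apply: sumr_ge0 => i _; exact: c0.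
near=> a; near: a; apply: filter_forall => i; apply: filterS (Hc i) => a.
apply: taylor_at_le; rewrite (bigD1 i)//= lerDl.
by apply: sumr_ge0 => j _; exact: c0.
Unshelve. all: by end_near. Qed.

Lemma lcomb0_le y z (G : 'I_m -> R) (H : 'I_q -> R) (b : R) :
  (forall i, `|G i| <= b) -> (forall j, `|H j| <= b) ->
  `|lcomb y z 0 G H| <= b * (m%:R * `|y| + q%:R * `|z|).
Proof.
move=> HG HH; rewrite /lcomb add0r (le_trans (ler_normD _ _))// normrN mulrDr.
have S k (v : 'rV[R]_k) (K : 'I_k -> R) : (forall i, `|K i| <= b) ->
    `|\sum_i v 0 i * K i| <= b * (k%:R * `|v|).
  move=> HK; rewrite (le_trans (ler_norm_sum _ _ _))//.
  rewrite mulr_natl -[k in _ *+ k]card_ord mulrnAr -sumr_const; apply: ler_sum => i _.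
  by rewrite normrM mulrC; apply: ler_pM => //; exact: mx_entry_le.
by apply: lerD; exact: S.
Qed.

Lemma lcomb_le y z F (G : 'I_m -> R) (H : 'I_q -> R) (b : R) :
  `|F| <= b -> (forall i, `|G i| <= b) -> (forall j, `|H j| <= b) ->
  `|lcomb y z F G H| <= b * (1 + m%:R * `|y| + q%:R * `|z|).
Proof.
move=> HF HG HH; have -> : lcomb y z F G H = F + lcomb y z 0 G H.
  by rewrite /lcomb add0r !addrA.
rewrite (le_trans (ler_normD _ _))// -addrA mulrDr mulr1; apply: lerD => //.
exact: lcomb0_le.
Qed.

Lemma lcombB y z F G H F' G' H' :
  lcomb y z F G H - lcomb y z F' G' H' =
  lcomb y z (F - F') (fun i : 'I_m => G i - G' i) (fun j : 'I_q => H j - H' j).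
Proof.
have E (a b : R) : a - b = -1 * b + a by rewrite mulN1r addrC.
rewrite !E -lcomb_linear; congr lcomb; by apply/funext => i; rewrite E.
Qed.

Lemma enorm_le k (v : 'rV[R]_k) (b : R) :
  0 <= b -> (forall i, `|v 0 i| <= b) -> enorm v <= k%:R * b.
Proof.
move=> b0 Hv; rewrite /enorm.
have kb : 0 <= k%:R * b by rewrite mulr_ge0.
rewrite -(ger0_norm kb) -sqrtr_sqr ler_sqrt ?sqr_ge0//.
apply: (@le_trans _ _ (\sum_(i < k) b ^+ 2)).
  apply: ler_sum => i _; rewrite -[v 0 i ^+ 2]ger0_norm ?sqr_ge0// normrX.
  by rewrite ler_pXn2r// ?nnegrE.
rewrite sumr_const card_ord; have -> : b ^+ 2 *+ k = k%:R * b ^+ 2 by rewrite mulr_natl.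
rewrite exprMn; apply: ler_wpM2r; first exact: sqr_ge0.
by rewrite -natrX ler_nat; case: k {v Hv kb} => // k; rewrite expnS expn1 leq_pmulr.
Qed.

Lemma entry_le_enorm k (v : 'rV[R]_k) i : `|v 0 i| <= enorm v.
Proof.
rewrite /enorm -sqrtr_sqr ler_sqrt; last by apply: sumr_ge0 => j _; exact: sqr_ge0.
by rewrite (bigD1 i)//= lerDl; apply: sumr_ge0 => j _; exact: sqr_ge0.
Qed.

(** The Newton equation in coordinates. In the factor [c + 1], [c] comes from testing the gradient
    against [A x (dl k)], and 1 from the other two rows, which involve no change of norm. *)
Lemma coord_residual x y z d dy dz mu (c e : R) :
  cdom psi x -> 0 <= c -> 0 <= e ->
  (forall d, rnorm x (A x d) <= c * `|d|) ->
  rnorm x (gradL P (x, y, z)) <= e ->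
  (forall i, `|ineqc P i x * y 0 i - mu| <= e) -> (forall j, `|eqc P j x| <= e) ->
  kktJ P (x, y, z) (A x d, dy, dz) = - kktFmu P (x, y, z) mu ->
  [/\ `|J (psi x, y, z) (d, dy, dz)| <= (c + 1) * e,
    forall k, coordJ1 P rt xs (psi x) y z d dy dz k =
      - lagr_comb P y z (fun f => 'D_(0, dl k) (T f) (psi x, 0)),
    forall i, y 0 i * 'D_(0, d) (T (ineqc P i)) (psi x, 0)
      + T (ineqc P i) (psi x, 0) * dy 0 i
      = - (T (ineqc P i) (psi x, 0) * y 0 i - mu)
  & forall j, 'D_(0, d) (T (eqc P j)) (psi x, 0) = - T (eqc P j) (psi x, 0)].
Proof.
move=> px c0 e0 Hc He1 He2 He3 E.
have W0 := retr_dom0 rtP px.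
have EJ := coordJ_kktJ P_C2 rtP rt2 y z d dy dz px; rewrite E in EJ.
have P0 f := pullback0 rtP f px.
have H1 := congr1 (fun V : D => V.1.1) EJ; have H2 := congr1 (fun V : D => V.1.2) EJ.
have H3 := congr1 (fun V : D => V.2) EJ.
have e1 k : coordJ1 P rt xs (psi x) y z d dy dz k =
    - inner x (gradL P (x, y, z)) (A x (dl k)).
  have := congr1 (fun r : 'rV[R]_n => r 0 k) H1.
  rewrite [LHS]mxE [X in _ = X -> _]mxE => ->.
  by rewrite /= scaler0 subr0 /inner dotmNl.
have e2 i : y 0 i * 'D_(0, d) (T (ineqc P i)) (psi x, 0)
      + T (ineqc P i) (psi x, 0) * dy 0 i = - (ineqc P i x * y 0 i - mu).
  have := congr1 (fun r : 'rV[R]_m => r 0 i) H2; rewrite [LHS]mxE => ->.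
  by rewrite /= !mxE mulr1.
have e3 j : 'D_(0, d) (T (eqc P j)) (psi x, 0) = - eqc P j x.
  have := congr1 (fun r : 'rV[R]_q => r 0 j) H3; rewrite [LHS]mxE => ->.
  by rewrite /= scaler0 subr0 !mxE.
have dl1 (k : 'I_n) : `|dl k| <= 1.
  apply: mx_norm_le_entries => // i j; rewrite !mxE.
  by case: (_ && _); rewrite ?normr1 ?normr0.
have ce : 0 <= c * e by exact: mulr_ge0.
split.
- rewrite mulrDl mul1r prod_normE ge_max prod_normE ge_max -andbA; apply/and3P; split.
  + apply: mx_norm_le_entries => [|i k]; first by rewrite addr_ge0.
    rewrite ord1 [X in `|X|]mxE e1 normrN.
    apply: (le_trans (inner_CauchySchwarz _ _ _)).
    apply: (@le_trans _ _ (e * c)); last by rewrite mulrC lerDl.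
    apply: ler_pM; [exact: sqrtr_ge0|exact: sqrtr_ge0|exact: He1|].
    by apply: (le_trans (Hc _)); rewrite ler_piMr.
  + apply: mx_norm_le_entries => [|i k]; first by rewrite addr_ge0.
    rewrite ord1 [X in `|X|]mxE e2 normrN (le_trans (He2 k))//.
    by rewrite lerDr.
  + apply: mx_norm_le_entries => [|i k]; first by rewrite addr_ge0.
    rewrite ord1 [X in `|X|]mxE e3 normrN (le_trans (He3 k))//.
    by rewrite lerDr.
- move=> k; rewrite e1; congr (- _).
  have -> := inner_grad_pullback rtP (dl k) (CkMW (Ck_lagrangian P_C2 y z)) px.
  exact: (derive_lagrangian P_C2 rtP y z _ W0).
- by move=> i; rewrite e2 P0.
- by move=> j; rewrite e3 P0.
Qed.

End Residual.

(** * Residuals at the new point *)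

Section StepErrors.
Variables (R : realType) (n m q : nat) (M : riemannianManifold R n).
Variable P : nlp m q M.
Hypothesis P_C2 : nlp_C2 P.
Variable rt : M -> 'rV[R]_n -> M.
Hypotheses (rtP : retraction rt) (rt2 : second_order rt).
Variable xs : M.

Local Notation psi := (chart_at xs).
Local Notation A x := (tangent_of xs (psi x)).
Local Notation T := (local_pullback rt xs).
Local Notation W := (retr_dom rt xs xs).
Local Notation u0 := (Defs.coord xs).
Local Notation dl k := (delta_mx 0 k : 'rV[R]_n).
Local Notation D := ('rV[R]_n * 'rV[R]_m * 'rV[R]_q)%type.
Local Notation J := (coordJ P rt xs).
Local Notation a0 := (u0, 0 : 'rV[R]_n).
Implicit Types (y : 'rV[R]_m) (z : 'rV[R]_q).

(* By the Newton equation all the terms of order at most one in [(d, dy, dz)]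
   cancel. *)
Lemma new_gradient u y z d dy dz (C t Y : R) k :
  0 <= C -> 0 <= t -> W (u, d) ->
  taylor_at rt xs (obj P) C (u, d) ->
  (forall i, taylor_at rt xs (ineqc P i) C (u, d)) ->
  (forall j, taylor_at rt xs (eqc P j) C (u, d)) ->
  `|d| <= t -> `|dy| <= t -> `|dz| <= t -> `|y| <= Y -> `|z| <= Y ->
  coordJ1 P rt xs u y z d dy dz k =
    - lagr_comb P y z (fun f => 'D_(0, dl k) (T f) (u, 0)) ->
  `|'D_(0, dl k) (T (lagrangian P (y + dy) (z + dz))) (u, d)| <=
    C * (1 + m%:R * Y + q%:R * Y + m%:R + q%:R) * t ^+ 2.
Proof.
move=> C0 t0 Wa [_ o1 o2 _ _] Hg Hh dt dyt dzt yY zY E.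
pose L1 (f : M -> R) := 'D_(0, dl k) (T f) (u, d).
pose L0 (f : M -> R) := 'D_(0, dl k) (T f) (u, 0).
pose H0 (f : M -> R) := 'D_(0, d) ('D_(0, dl k) (T f)) (u, 0).
have eL : 'D_(0, dl k) (T (lagrangian P (y + dy) (z + dz))) (u, d) =
    lagr_comb P (y + dy) (z + dz) L1 := derive_lagrangian P_C2 rtP _ _ _ Wa.
have eJ : lagr_comb P y z H0 + lcomb dy dz 0 (fun i => L0 (ineqc P i)) (fun j => L0 (eqc P j))
    = - lagr_comb P y z L0 := E.
have {}o1 : `|L1 (obj P) - L0 (obj P) - H0 (obj P)| <= C * `|d| ^+ 2 := o1 k.
have g1 i : `|L1 (ineqc P i) - L0 (ineqc P i) - H0 (ineqc P i)| <= C * `|d| ^+ 2.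
  by have [_ h _ _ _] := Hg i; exact: (h k).
have h1 j : `|L1 (eqc P j) - L0 (eqc P j) - H0 (eqc P j)| <= C * `|d| ^+ 2.
  by have [_ h _ _ _] := Hh j; exact: (h k).
have g2 i : `|L1 (ineqc P i) - L0 (ineqc P i)| <= C * `|d|.
  by have [_ _ h _ _] := Hg i; exact: (h k).
have h2 j : `|L1 (eqc P j) - L0 (eqc P j)| <= C * `|d|.
  by have [_ _ h _ _] := Hh j; exact: (h k).
rewrite eL; clear eL E Hg Hh o2; clearbody L1 L0 H0.
(* Second-order remainders weighted by the old multipliers, plus first-order changes weighted by the
   increments [dy] and [dz]: each part is quadratic in [t]. *)
have -> : lagr_comb P (y + dy) (z + dz) L1 =
    lcomb y z (L1 (obj P) - L0 (obj P) - H0 (obj P))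
      (fun i => L1 (ineqc P i) - L0 (ineqc P i) - H0 (ineqc P i))
      (fun j => L1 (eqc P j) - L0 (eqc P j) - H0 (eqc P j)) +
    lcomb dy dz 0 (fun i => L1 (ineqc P i) - L0 (ineqc P i))
      (fun j => L1 (eqc P j) - L0 (eqc P j)).
  rewrite /lagr_comb lcombD -(lcombB y z _ _ _ (H0 (obj P))) -(lcombB y z _ _ _ (L0 (obj P))).
  have -> : lcomb dy dz 0 (fun i => L1 (ineqc P i) - L0 (ineqc P i))
      (fun j => L1 (eqc P j) - L0 (eqc P j)) =
    lcomb dy dz 0 (fun i => L1 (ineqc P i)) (fun j => L1 (eqc P j)) -
    lcomb dy dz 0 (fun i => L0 (ineqc P i)) (fun j => L0 (eqc P j)).
    by rewrite lcombB subr0.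
  move: eJ; rewrite /lagr_comb.
  move: (lcomb y z (L1 _) _ _) (lcomb y z (L0 _) _ _) (lcomb y z (H0 _) _ _)
    (lcomb dy dz 0 (fun i => L1 _) _) (lcomb dy dz 0 (fun i => L0 _) _).
  by move=> r1 r2 r3 r4 r5 /eqP; rewrite -subr_eq0 => /eqP e; lra.
have d2 : `|d| ^+ 2 <= t ^+ 2 by rewrite ler_pXn2r// nnegrE.
have Y0 : 0 <= Y by exact: le_trans yY.
have b1 := lcomb_le y z o1 g1 h1.
have b2 := lcomb0_le dy dz g2 h2.
apply: (le_trans (ler_normD _ _)).
have c1 : C * `|d| ^+ 2 * (1 + m%:R * `|y| + q%:R * `|z|) <=
    C * t ^+ 2 * (1 + m%:R * Y + q%:R * Y).
  apply: ler_pM.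
  - by rewrite mulr_ge0// sqr_ge0.
  - by rewrite !addr_ge0// mulr_ge0.
  - exact: ler_wpM2l.
  - by apply: lerD; [apply: lerD => //|]; apply: ler_wpM2l.
have c2 : C * `|d| * (m%:R * `|dy| + q%:R * `|dz|) <= C * t * ((m%:R + q%:R) * t).
  apply: ler_pM.
  - by rewrite mulr_ge0.
  - by rewrite !addr_ge0// mulr_ge0.
  - exact: ler_wpM2l.
  - by rewrite mulrDl; apply: lerD; apply: ler_wpM2l.
apply: (le_trans (lerD (le_trans b1 c1) (le_trans b2 c2))).
rewrite le_eqVlt; apply/orP; left; apply/eqP.
by move: (m%:R) (q%:R) => r1 r2; ring.
Qed.

Lemma new_complementarity u y d (dy : 'rV[R]_m) (C t Y mu : R) i : 0 <= C -> 0 <= t ->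
  taylor_at rt xs (ineqc P i) C (u, d) ->
  `|d| <= t -> `|dy| <= t -> `|y| <= Y ->
  y 0 i * 'D_(0, d) (T (ineqc P i)) (u, 0) + T (ineqc P i) (u, 0) * dy 0 i
    = - (T (ineqc P i) (u, 0) * y 0 i - mu) ->
  `|T (ineqc P i) (u, d) * (y + dy) 0 i - mu| <= C * (Y + 1) * t ^+ 2.
Proof.
move=> C0 t0 [_ _ _ g1 g2] dt dyt yY; rewrite [(y + dy) 0 i]mxE.
rewrite /= in g1 g2; have y1 := mx_entry_le y 0 i; have y2 := mx_entry_le dy 0 i.
move: (T (ineqc P i) (u, d)) (T (ineqc P i) (u, 0)) ('D_(_) _ _) (y 0 i) (dy 0 i) g1 g2 y1 y2.
move=> g g' Dg r s g1 g2 y1 y2 e.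
(* The Newton equation [e] removes the linearization, leaving the Taylor remainder times [y] and the
   product of the two increments. *)
have -> : g * (r + s) - mu = (g - g' - Dg) * r + (g - g') * s by lra.
have d2 : `|d| ^+ 2 <= t ^+ 2 by rewrite ler_pXn2r// nnegrE.
rewrite (le_trans (ler_normD _ _))// !normrM.
have h1 : `|g - g' - Dg| * `|r| <= C * t ^+ 2 * Y.
  apply: ler_pM => //; last exact: le_trans yY.
  by apply: (le_trans g1); apply: ler_wpM2l.
have h2 : `|g - g'| * `|s| <= C * t * t.
  apply: ler_pM => //; last exact: le_trans dyt.
  by apply: (le_trans g2); apply: ler_wpM2l.
apply: (le_trans (lerD h1 h2)).
by rewrite le_eqVlt; apply/orP; left; apply/eqP; ring.
Qed.

Lemma new_equality u d (C t : R) j : 0 <= C -> 0 <= t ->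
  taylor_at rt xs (eqc P j) C (u, d) -> `|d| <= t ->
  'D_(0, d) (T (eqc P j)) (u, 0) = - T (eqc P j) (u, 0) ->
  `|T (eqc P j) (u, d)| <= C * t ^+ 2.
Proof.
move=> C0 t0 [_ _ _ h1 _] dt e; rewrite /= e opprK subrK in h1.
by apply: (le_trans h1); apply: ler_wpM2l => //; rewrite ler_pXn2r// nnegrE.
Qed.

Lemma near_ball (V : normedModType R) (x : V) (Q : V -> Prop) :
  (\forall x' \near x, Q x') ->
  exists2 r : R, 0 < r & forall x' : V, `|x - x'| < r -> Q x'.
Proof.
move=> /nbhs_ballP[r r0 Hr]; exists r => // x' xx'; apply: Hr.
by rewrite -ball_normE.
Qed.

Lemma near_coords ys zs (Q : D -> Prop) :
  (\forall w \near ((u0, ys, zs) : D), Q w) ->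
  \forall w \near ((xs, ys, zs) : M * 'rV[R]_m * 'rV[R]_q),
    cdom psi w.1.1 /\ Q (psi w.1.1, w.1.2, w.2).
Proof.
move=> nQ.
have c1 : {for (xs, ys, zs) : M * 'rV[R]_m * 'rV[R]_q,
    continuous (fun w : M * 'rV[R]_m * 'rV[R]_q => w.1)} by exact: cvg_fst.
have cx : {for (xs, ys, zs) : M * 'rV[R]_m * 'rV[R]_q,
    continuous (fun w : M * 'rV[R]_m * 'rV[R]_q => w.1.1)}.
  apply: (@continuous_comp _ _ _ (fun w : M * 'rV[R]_m * 'rV[R]_q => w.1) fst); first exact: c1.
  exact: cvg_fst.
have cy : {for (xs, ys, zs) : M * 'rV[R]_m * 'rV[R]_q,
    continuous (fun w : M * 'rV[R]_m * 'rV[R]_q => w.1.2)}.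
  apply: (@continuous_comp _ _ _ (fun w : M * 'rV[R]_m * 'rV[R]_q => w.1) snd); first exact: c1.
  exact: cvg_snd.
have cz : {for (xs, ys, zs) : M * 'rV[R]_m * 'rV[R]_q,
    continuous (fun w : M * 'rV[R]_m * 'rV[R]_q => w.2)} by exact: cvg_snd.
have cpsi : {for (xs, ys, zs) : M * 'rV[R]_m * 'rV[R]_q,
    continuous (fun w : M * 'rV[R]_m * 'rV[R]_q => psi w.1.1)}.
  apply: (@continuous_comp _ _ _ (fun w : M * 'rV[R]_m * 'rV[R]_q => w.1.1) psi); first exact: cx.
  exact: (cfun_continuous (chart_at_dom xs)).
have nd : \forall x \near xs, cdom psi x.
  by apply: open_nbhs_nbhs; split; [exact: cdom_open|exact: chart_at_dom].
have n1 : \forall w \near ((xs, ys, zs) : M * 'rV[R]_m * 'rV[R]_q), cdom psi w.1.1.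
  exact: (cx _ nd).
have n2 : \forall w \near ((xs, ys, zs) : M * 'rV[R]_m * 'rV[R]_q),
    Q (psi w.1.1, w.1.2, w.2).
  exact: (continuous_pair (continuous_pair cpsi cy) cz nQ).
by apply: filterS2 n1 n2 => w.
Qed.

End StepErrors.

Section NewtonStep.
Variables (R : realType) (n m q : nat) (M : riemannianManifold R n).
Variable P : nlp m q M.
Hypothesis P_C2 : nlp_C2 P.
Variable rt : M -> 'rV[R]_n -> M.
Hypotheses (rtP : retraction rt) (rt2 : second_order rt).
Variables (xs : M) (ys : 'rV[R]_m) (zs : 'rV[R]_q).
Hypotheses (ws_kkt : kkt_triple P (xs, ys, zs))
  (ws_sc : strict_complementarity P (xs, ys, zs))
  (ws_licq : licq P xs) (ws_sosc : sosc P (xs, ys, zs)).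
Hypotheses (obj_lip : pullback_hess_lipschitz rt xs (obj P))
  (ineqc_lip : forall i, pullback_hess_lipschitz rt xs (ineqc P i))
  (eqc_lip : forall j, pullback_hess_lipschitz rt xs (eqc P j)).

Local Notation psi := (chart_at xs).
Local Notation A x := (tangent_of xs (psi x)).
Local Notation T := (local_pullback rt xs).
Local Notation W := (retr_dom rt xs xs).
Local Notation u0 := (Defs.coord xs).
Local Notation dl k := (delta_mx 0 k : 'rV[R]_n).
Local Notation D := ('rV[R]_n * 'rV[R]_m * 'rV[R]_q)%type.
Local Notation J := (coordJ P rt xs).
Local Notation a0 := (u0, 0 : 'rV[R]_n).

Lemma near_taylor_all : exists2 C : R, 0 <= C & \forall a \near a0,
  [/\ taylor_at rt xs (obj P) C a, forall i, taylor_at rt xs (ineqc P i) C a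
    & forall j, taylor_at rt xs (eqc P j) C a].
Proof.
have [C1 C10 H1] := near_taylor rtP (Ck_obj P_C2) obj_lip.
have [C2 C20 H2] := near_taylor_family rtP (Ck_ineqc P_C2) ineqc_lip.
have [C3 C30 H3] := near_taylor_family rtP (Ck_eqc P_C2) eqc_lip.
exists (C1 + C2 + C3); first by rewrite !addr_ge0.
apply: filterS (filterI H1 (filterI H2 H3)) => a [h1 [h2 h3]]; split.
- by apply: taylor_at_le h1; rewrite -addrA lerDl addr_ge0.
- by move=> i; apply: taylor_at_le (h2 i); rewrite (addrC C1) -addrA lerDl addr_ge0.
- by move=> j; apply: taylor_at_le (h3 j); rewrite lerDr addr_ge0.
Qed.

(** A neighbourhood of pairs [(u, v)] rather than of points, so that it applies to the retracted
    point. *)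
Lemma near_inactive : \forall a \near a0, forall i, ~~ active P xs i -> 0 < T (ineqc P i) a.
Proof.
near=> a; near: a; apply: filter_forall => i.
have [ai|ai] := boolP (active P xs i); first by apply: filterE.
have g0 : 0 < T (ineqc P i) a0.
  have px : cdom psi xs by exact: chart_at_dom.
  have -> : T (ineqc P i) a0 = ineqc P i xs := pullback0 rtP _ px.
  by case: ws_kkt => _ /(_ i) /= gi _; rewrite lt_def gi andbT.
have cT := Ck_continuous (Ck_pullback rtP xs (Ck_ineqc P_C2 i)) (retr_dom_center rtP xs).
have := cT => /cvgrPdist_lt/(_ _ g0); apply: filterS => a h _.
by move: h; rewrite ltr_distlC subrr => /andP[].
Unshelve. all: by end_near. Qed.

Lemma near_active : \forall y \near ys, forall i, active P xs i -> 0 < (y : 'rV[R]_m) 0 i.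
Proof.
near=> y; near: y; apply: filter_forall => i.
have [ai|ai] := boolP (active P xs i); last by apply: filterE.
have y0 : 0 < ys 0 i.
  case: ws_kkt => _ _ /(_ i) /= yi; rewrite lt_def yi andbT.
  by have := ws_sc i; rewrite /= -/(active P xs i) ai addbT.
have := @coord_continuous R 1 m 0 i ys => /cvgrPdist_lt/(_ _ y0).
apply: filterS => y h _.
by move: h; rewrite ltr_distlC subrr => /andP[].
Unshelve. all: by end_near. Qed.

(** The neighbourhood and the constants are chosen before [mu] and [e]: closeness to the KKT triple
    gives the uniform bounds, while [C * e < r] keeps the step inside their range of validity. *)
Lemma newton_step : exists C r : R, [/\ 0 < C, 0 < r &
  \forall w \near ((xs, ys, zs) : M * 'rV[R]_m * 'rV[R]_q), nonsingular P w /\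
    forall mu e v, 0 <= e -> C * e < r ->
      rnorm w.1.1 (gradL P w) <= e ->
      (forall i, `|ineqc P i w.1.1 * w.1.2 0 i - mu| <= e) ->
      (forall j, `|eqc P j w.1.1| <= e) ->
      is_init P rt w mu v ->
      [/\ rnorm v.1.1 (gradL P v) <= C * e ^+ 2,
        forall i, `|ineqc P i v.1.1 * v.1.2 0 i - mu| <= C * e ^+ 2,
        forall j, `|eqc P j v.1.1| <= C * e ^+ 2
      & forall i, 0 < ineqc P i v.1.1 \/ 0 < v.1.2 0 i]].
Proof.
have [C0 C00 nJ] := near_coordJ_bound P_C2 rtP rt2 ws_kkt ws_sc ws_licq ws_sosc.
have [c c0 nc] := metric_near_equiv xs.
have [Ct Ct0 nT] := near_taylor_all.
have [Cg Cg0 nG] := near_grad_bound rtP xs.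
have [r1 r10 Hr1] := near_ball (filterI nT (filterI nG near_inactive)).
have [r2 r20 Hr2] := near_ball near_active.
pose Y := `|ys| + `|zs| + 1.
have Y0 : 0 <= Y by rewrite !addr_ge0.
pose B := Ct * (1 + m%:R * Y + q%:R * Y + m%:R + q%:R).
have B0 : 0 <= B by rewrite mulr_ge0// !addr_ge0// mulr_ge0.
(* The summands bound the gradient, complementarity and equality residuals, in this order, relative
   to the squared step length. *)
pose K := Cg * (n%:R * B) + Ct * (Y + 1) + Ct.
have K1 : 0 <= Cg * (n%:R * B).
  by apply: mulr_ge0; [exact: Cg0|apply: mulr_ge0; [exact: ler0n|exact: B0]].
have K2 : 0 <= Ct * (Y + 1) by rewrite mulr_ge0// addr_ge0.
have K0 : 0 <= K by apply: addr_ge0; [exact: addr_ge0|exact: Ct0].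
pose C1 := C0 * (c + 1).
have C10 : 0 < C1 by rewrite mulr_gt0// addr_gt0.
(* The step has length at most [C1 * e]: the first summand makes [C * e < r] control it, the second
   absorbs the quadratic residuals. *)
pose C := C1 + K * C1 ^+ 2.
have KC : 0 <= K * C1 ^+ 2 by rewrite mulr_ge0// sqr_ge0.
have C0' : 0 < C by rewrite ltr_pwDl.
(* The new multiplier differs from [ys] by an initial error and by [dy], each allotted [r2 / 2]. *)
pose r := Num.min r1 (r2 / 2).
have r0 : 0 < r by rewrite lt_min r10 divr_gt0.
exists C, r; split => //.
have f12 (Q : 'rV[R]_n * 'rV[R]_m -> Prop) : (\forall v \near (u0, ys), Q v) ->
    \forall w \near ((u0, ys, zs) : D), Q w.1.
  by move=> h; exact: (@cvg_fst _ _ (nbhs (u0, ys)) (nbhs zs) _ _ h).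
have f1 (Q : 'rV[R]_n -> Prop) : (\forall u \near u0, Q u) ->
    \forall w \near ((u0, ys, zs) : D), Q w.1.1.
  move=> h; apply: (f12 (fun v => Q v.1)).
  exact: (@cvg_fst _ _ (nbhs u0) (nbhs ys) _ _ h).
have f2 (Q : 'rV[R]_m -> Prop) : (\forall y \near ys, Q y) ->
    \forall w \near ((u0, ys, zs) : D), Q w.1.2.
  move=> h; apply: (f12 (fun v => Q v.2)).
  exact: (@cvg_snd _ _ (nbhs u0) (nbhs ys) _ _ h).
have f3 (Q : 'rV[R]_q -> Prop) : (\forall z \near zs, Q z) ->
    \forall w \near ((u0, ys, zs) : D), Q w.2.
  by move=> h; exact: (@cvg_snd _ _ (nbhs (u0, ys)) (nbhs zs) _ _ h).
have close (V : normedModType R) (x : V) e : 0 < e -> \forall x' \near x, `|x - x'| < e.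
  by move=> e0; have := nbhsx_ballx x e e0; rewrite -ball_normE.
have n1 := f1 _ (close _ u0 _ r10); have n1' := f1 _ nc.
have n2 := f2 _ (close _ ys _ (divr_gt0 r20 (ltr0n _ 2))).
have n2' := f2 _ (close _ ys _ ltr01).
have n3 := f3 _ (close _ zs _ ltr01).
have nI (Q Q' : D -> Prop) : (\forall w \near ((u0, ys, zs) : D), Q w) ->
    (\forall w \near ((u0, ys, zs) : D), Q' w) ->
    \forall w \near ((u0, ys, zs) : D), Q w /\ Q' w.
  by move=> h h'; exact: filterI h h'.
have nw := near_coords (nI _ _ nJ (nI _ _ n1 (nI _ _ n1' (nI _ _ n2 (nI _ _ n2' n3))))).
apply: filterS nw => -[[x y] z] /= [px [HJ [bu [Hc [yr [y1 z1]]]]]].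
have {}Hc := Hc x px erefl.
split; first exact: (kktJ_bijective P_C2 rtP rt2 px HJ).
move=> mu e v e0 Cer He1 He2 He3 [[[dx dy] dz] [/= E ->]] /=.
(* [dx] is written in the preferred chart of [x]; [d] is the same tangent vector in the chart at
   [xs]. *)
have [d Ed] := tangent_surj dx px; rewrite -Ed in E *.
have [JC e1 e2 e3] := coord_residual P_C2 rtP rt2 px (ltW c0) e0
  (fun d => (Hc d).2) He1 He2 He3 E.
pose t := `|((d, dy, dz) : D)|.
have t0 : 0 <= t by exact: normr_ge0.
have tC1 : t <= C1 * e.
  apply: (le_trans (HJ _)); rewrite /C1 -mulrA; apply: ler_wpM2l => //; exact: ltW.
have dt : `|d| <= t by rewrite /t prod_normE le_max prod_normE le_max lexx.
have dyt : `|dy| <= t by rewrite /t prod_normE le_max prod_normE le_max lexx orbT.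
have dzt : `|dz| <= t by rewrite /t prod_normE le_max lexx orbT.
have tr : t < r.
  apply: (le_lt_trans tC1); apply: le_lt_trans Cer; apply: ler_wpM2r => //.
  by rewrite lerDl.
have t2 : K * t ^+ 2 <= C * e ^+ 2.
  apply: (@le_trans _ _ (K * (C1 * e) ^+ 2)).
    by apply: ler_wpM2l => //; rewrite ler_pXn2r// nnegrE// mulr_ge0// ltW.
  rewrite exprMn mulrA; apply: ler_wpM2r; first exact: sqr_ge0.
  by rewrite lerDr ltW.
clearbody t.
have yY : `|y| <= Y.
  rewrite -[y](subKr ys) (le_trans (ler_normB _ _))// /Y -addrA; apply: lerD => //.
  by rewrite (le_trans (ltW y1))// lerDr.
have zY : `|z| <= Y.
  rewrite -[z](subKr zs) (le_trans (ler_normB _ _))//.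
  apply: (@le_trans _ _ (`|zs| + 1)); first by rewrite lerD2l ltW.
  by rewrite /Y -addrA lerDr.
have [[To Tg Th] [[Wa HG] Hina]] : [/\ taylor_at rt xs (obj P) Ct (psi x, d),
     forall i, taylor_at rt xs (ineqc P i) Ct (psi x, d)
    & forall j, taylor_at rt xs (eqc P j) Ct (psi x, d)] /\
   (W (psi x, d) /\ forall f, CkM 1 f ->
    rnorm (retr_local rt xs (psi x, d)) (grad f (retr_local rt xs (psi x, d))) <=
      Cg * \sum_k `|'D_(0, dl k) (T f) (psi x, d)|) /\
   (forall i, ~~ active P xs i -> 0 < T (ineqc P i) (psi x, d)).
  apply: Hr1; rewrite prod_normE gt_max /= bu sub0r normrN.
  by apply: (le_lt_trans dt); apply: (lt_le_trans tr); rewrite /r ge_min lexx.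
have Ex : rt x (A x d) = retr_local rt xs (psi x, d) by rewrite retr_localE.
have t20 : 0 <= t ^+ 2 by exact: sqr_ge0.
rewrite Ex; split.
- rewrite /gradL; apply: (le_trans (HG _ (CkMW (Ck_lagrangian P_C2 _ _)))).
  apply: le_trans t2; apply: (@le_trans _ _ (Cg * (n%:R * B) * t ^+ 2)); last first.
    by apply: ler_wpM2r => //; rewrite /K -addrA lerDl addr_ge0.
  rewrite -!mulrA; apply: ler_wpM2l => //.
  rewrite mulr_natl -[n in _ *+ n]card_ord -sumr_const; apply: ler_sum => k _.
  rewrite [leRHS]mulrA; exact: (new_gradient P_C2 rtP Ct0 t0 Wa To Tg Th dt dyt dzt yY zY (e1 k)).
- move=> i; have := new_complementarity Ct0 t0 (Tg i) dt dyt yY (e2 i).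
  move/le_trans; apply; apply: le_trans t2; apply: ler_wpM2r => //.
  apply: (@le_trans _ _ (Cg * (n%:R * B) + Ct * (Y + 1))).
    by rewrite lerDr; exact: K1.
  by rewrite lerDl; exact: Ct0.
- move=> j; have := new_equality Ct0 t0 (Th j) dt (e3 j).
  move/le_trans; apply; apply: le_trans t2; apply: ler_wpM2r => //.
  by rewrite /K lerDr addr_ge0.
- move=> i; have [ai|ai] := boolP (active P xs i); last by left; exact: Hina.
  right; apply: Hr2 => //; rewrite opprD addrA.
  apply: (le_lt_trans (ler_normB _ _)); rewrite [r2]splitr; apply: ltrD => //.
  by apply: (le_lt_trans dyt); apply: (lt_le_trans tr); rewrite /r ge_min lexx orbT.
Qed.

End NewtonStep.

(** * From residuals to the stopping conditions *)

(** Turns a small parameter into a large index: [mu k < eps] is impossible for [k < N]. *)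
Lemma positive_lower_bound (R : realType) (mu : nat -> R) (b : R) N :
  0 < b -> (forall k, 0 < mu k) ->
  exists2 eps : R, 0 < eps & eps <= b /\ forall k, (k < N)%N -> eps <= mu k.
Proof.
move=> b0 mu0; elim: N => [|N [eps eps0 [epsb H]]]; first by exists b.
exists (Num.min eps (mu N)); first by rewrite lt_min eps0 mu0.
split; first by rewrite ge_min epsb.
move=> k; rewrite ltnS leq_eqVlt => /predU1P[->|/H ek].
  by rewrite ge_min lexx orbT.
by rewrite ge_min ek.
Qed.

(** The iterate satisfies the conditions with the old parameter [mu], while its Newton equation uses
    the new one [mu']. The shift costs at most [mu] in the complementarity row, hence the extra [mu]
    in the bound by [H * mu]. *)
Lemma stopping_residual (R : realType) (n m q : nat) (M : riemannianManifold R n)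
    (P : nlp m q M) (phiL phic phie : R -> R) (mu mu' H : R)
    (w : M * 'rV[R]_m * 'rV[R]_q) :
  0 <= mu' <= mu -> phiL mu + phic mu + phie mu + mu <= H * mu ->
  0 <= phiL mu -> 0 <= phic mu -> 0 <= phie mu ->
  stopping P phiL phic phie mu w ->
  [/\ rnorm w.1.1 (gradL P w) <= H * mu,
    forall i, `|ineqc P i w.1.1 * w.1.2 0 i - mu'| <= H * mu
  & forall j, `|eqc P j w.1.1| <= H * mu].
Proof.
case: w => [[x y] z] /andP[mu'0 mu'mu] HH L0 c0 e0 [sL sc se _]; rewrite /= in sL sc se *.
have mu0 : 0 <= mu by exact: le_trans mu'mu.
split.
- by apply: (le_trans sL); apply: le_trans HH; rewrite -!addrA lerDl !addr_ge0.
- move=> i; have := le_trans (entry_le_enorm _ i) sc; rewrite !mxE mulr1 => h.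
  have -> : ineqc P i x * y 0 i - mu' = (ineqc P i x * y 0 i - mu) + (mu - mu').
    by rewrite addrA subrK.
  apply: (le_trans (ler_normD _ _)).
  rewrite [`|mu - mu'|]ger0_norm ?subr_ge0//.
  apply: (@le_trans _ _ (phic mu + mu)); first by apply: lerD; rewrite // lerBlDr lerDl.
  by apply: le_trans HH; rewrite lerD2r (addrC (phiL mu)) -addrA lerDl addr_ge0.
- move=> j; have := le_trans (entry_le_enorm _ j) se; rewrite !mxE => h.
  by apply: (le_trans h); apply: le_trans HH; rewrite addrAC lerDr !addr_ge0.
Qed.

(** Since [b < mu], every product of a constraint with its multiplier is positive, so the positivity
    of one factor yields that of the other. The factors [m] and [q] pay for the passage from entries
    to the Euclidean norm. *)
Lemma residual_stopping (R : realType) (n m q : nat) (M : riemannianManifold R n)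
    (P : nlp m q M) (phiL phic phie : R -> R) (mu b : R)
    (w : M * 'rV[R]_m * 'rV[R]_q) :
  0 <= b -> b < mu -> b <= phiL mu -> m%:R * b <= phic mu -> q%:R * b <= phie mu ->
  rnorm w.1.1 (gradL P w) <= b ->
  (forall i, `|ineqc P i w.1.1 * w.1.2 0 i - mu| <= b) ->
  (forall j, `|eqc P j w.1.1| <= b) ->
  (forall i, 0 < ineqc P i w.1.1 \/ 0 < w.1.2 0 i) ->
  stopping P phiL phic phie mu w.
Proof.
case: w => [[x y] z] b0 bmu bL bc be rL rc re pos; rewrite /= in rL rc re pos.
have gy i : 0 < ineqc P i x * y 0 i.
  have := rc i; rewrite ler_distl => /andP[h _].
  by apply: lt_le_trans h; rewrite subr_gt0.
split.
- exact: le_trans rL bL.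
- apply: le_trans bc; apply: enorm_le => // i; rewrite !mxE mulr1; exact: rc.
- apply: le_trans be; apply: enorm_le => // j; rewrite !mxE; exact: re.
- split=> i /=; case: (pos i) => // h.
  + by have := gy i; rewrite pmulr_lgt0.
  + by have := gy i; rewrite pmulr_rgt0.
Qed.

Theorem theorem4p1 (R : realType) (n m p : nat) (M : riemannianManifold R n)
    (M_connected : connected [set: M])
    (M_complete : complete_manifold M)
    (P : nlp m p M) (P_C2 : nlp_C2 P)
    (rt : M -> 'rV[R]_n -> M) (rt_retraction : retraction rt)
    (phiL phic phie : R -> R)
    (phiL_forcing : forcing phiL) (phic_forcing : forcing phic)
    (phie_forcing : forcing phie)
    (mum1 : R) (mu : nat -> R)
    (mum1_gt0 : 0 < mum1) (mu_gt0 : forall k, 0 < mu k)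
    (mu_cvg0 : mu @ \oo --> (0 : R))
    (ws : M * 'rV[R]_m * 'rV[R]_p)
    (ws_kkt : kkt_triple P ws)
    (ws_sc : strict_complementarity P ws)
    (ws_licq : licq P ws.1.1)
    (ws_sosc : sosc P ws)
    (phiL_mu : comparable_param phiL mu)
    (phic_mu : comparable_param phic mu)
    (phie_mu : comparable_param phie mu)
    (mu_littleo : (fun k => mu k ^+ 2 / mu k.+1) @ \oo --> (0 : R))
    (mu_decr : \forall k \near \oo, mu k.+1 <= mu k)
    (rt_second_order : second_order rt)
    (obj_lip : pullback_hess_lipschitz rt ws.1.1 (obj P))
    (ineqc_lip : forall i, pullback_hess_lipschitz rt ws.1.1 (ineqc P i))
    (eqc_lip : forall j, pullback_hess_lipschitz rt ws.1.1 (eqc P j)) :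
  exists (U : set (M * 'rV[R]_m * 'rV[R]_p)) (eps : R),
    [/\ nbhs ws U, 0 < eps &
      forall w : nat -> M * 'rV[R]_m * 'rV[R]_p,
        algorithm_run P phiL phic phie mu w ->
        forall k, U (w k) -> mu_prev mum1 mu k < eps ->
          nonsingular P (w k) /\
          forall v, is_init P rt (w k) (mu k) v ->
            stopping P phiL phic phie (mu k) v].
Proof.
case: ws ws_kkt ws_sc ws_licq ws_sosc obj_lip ineqc_lip eqc_lip =>
  [[xs ys] zs] kktw scw licqw soscw lipf lipg liph.
have [C [r [C0 r0 nU]]] :=
  newton_step P_C2 rt_retraction rt_second_order kktw scw licqw soscw lipf lipg liph.
have [loL [hiL [loL0 loL1 hiL1 HL]]] := phiL_mu.
have [loc [hic [loc0 loc1 hic1 Hc]]] := phic_mu.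
have [loe [hie [loe0 loe1 hie1 He]]] := phie_mu.
(* The summand 1 accounts for the change of barrier parameter in [stopping_residual]. *)
pose H := hiL + hic + hie + 1.
have H0 : 0 < H.
  have hL0 := lt_trans ltr01 hiL1; have hc0 := lt_trans ltr01 hic1.
  by have he0 := lt_trans ltr01 hie1; rewrite !addr_gt0.
pose lo := Num.min loL (Num.min loc loe).
have lo0 : 0 < lo by rewrite !lt_min loL0 loc0 loe0.
have lo1 : lo < 1 by rewrite gt_min loL1.
pose N1 : R := m%:R + p%:R + 1.
have N10 : 0 < N1 by rewrite ltr_wpDl.
(* Chosen so that [mu k ^+ 2 < rho * mu k.+1] brings the new residual [C * (H * mu k) ^+ 2],
   enlarged by [N1], below [lo * mu k.+1]. *)
pose rho := lo / (N1 * C * H ^+ 2).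
have rho0 : 0 < rho by rewrite divr_gt0// !mulr_gt0// exprn_gt0.
have rCH : 0 < r / (C * H) by rewrite divr_gt0// mulr_gt0.
have n1 : \forall k \near \oo, mu k ^+ 2 / mu k.+1 < rho.
  exact: (cvgr_lt (0 : R) mu_littleo).
have n2 : \forall k \near \oo, mu k < r / (C * H) by exact: (cvgr_lt (0 : R) mu_cvg0).
have [N _ HN] : \forall k \near \oo,
    [/\ mu k ^+ 2 / mu k.+1 < rho, mu k < r / (C * H) & mu k.+1 <= mu k].
  by apply: filterS3 n1 n2 mu_decr.
(* [eps <= mum1] excludes [k = 0]: the starting point [w 0] satisfies no
   stopping condition. *)
have [eps eps0 [epsm epsN]] := positive_lower_bound N mum1_gt0 mu_gt0.
(* The neighbourhood is the very set of points at which the conclusion of [newton_step] holds. *)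
exists [set w | nonsingular P w /\
    forall mu e v, 0 <= e -> C * e < r ->
      rnorm w.1.1 (gradL P w) <= e ->
      (forall i, `|ineqc P i w.1.1 * w.1.2 0 i - mu| <= e) ->
      (forall j, `|eqc P j w.1.1| <= e) ->
      is_init P rt w mu v ->
      [/\ rnorm v.1.1 (gradL P v) <= C * e ^+ 2,
        forall i, `|ineqc P i v.1.1 * v.1.2 0 i - mu| <= C * e ^+ 2,
        forall j, `|eqc P j v.1.1| <= C * e ^+ 2
      & forall i, 0 < ineqc P i v.1.1 \/ 0 < v.1.2 0 i]], eps.
split=> // w [_ Hstop] [|k] [nsing Hw] /= muk; first by move: (lt_le_trans muk epsm); rewrite ltxx.
split=> // v init.
(* The iteration considered has index [k.+1]: its previous parameter is [mu k] and its own is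
   [mu k.+1]. *)
have Nk : (N <= k)%N by rewrite leqNgt; apply/negP => /epsN; rewrite leNgt muk.
have [h1 h2 h3] := HN k Nk.
have mk0 := mu_gt0 k; have mk10 := mu_gt0 k.+1.
have [HL1 HL2] := HL k; have [Hc1 Hc2] := Hc k; have [He1 He2] := He k.
have pL : 0 <= phiL (mu k) by apply: le_trans HL1; rewrite ltW// mulr_gt0.
have pc : 0 <= phic (mu k) by apply: le_trans Hc1; rewrite ltW// mulr_gt0.
have pe : 0 <= phie (mu k) by apply: le_trans He1; rewrite ltW// mulr_gt0.
have HH : phiL (mu k) + phic (mu k) + phie (mu k) + mu k <= H * mu k.
  by rewrite /H !mulrDl mul1r lerD2r; apply: lerD => //; exact: lerD.
have mm : 0 <= mu k.+1 <= mu k by rewrite (ltW mk10).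
have [b1 b2 b3] := stopping_residual mm HH pL pc pe (Hstop k).
have e0 : 0 <= H * mu k by rewrite ltW// mulr_gt0.
have er : C * (H * mu k) < r.
  by rewrite mulrA mulrC -ltr_pdivlMr// mulr_gt0.
have [g1 g2 g3 g4] := Hw _ _ _ e0 er b1 b2 b3 init.
have key : N1 * (C * (H * mu k) ^+ 2) <= lo * mu k.+1.
  have -> : N1 * (C * (H * mu k) ^+ 2) = mu k ^+ 2 * (N1 * C * H ^+ 2).
    by move: (mu k) => t; ring.
  rewrite -ler_pdivlMr; last by rewrite !mulr_gt0// exprn_gt0.
  by move: (ltW h1); rewrite ler_pdivrMr// /rho mulrAC.
have [k1 k2 k3] : [/\ lo * mu k.+1 <= phiL (mu k.+1), lo * mu k.+1 <= phic (mu k.+1)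
    & lo * mu k.+1 <= phie (mu k.+1)].
  split; [apply: le_trans (HL _).1|apply: le_trans (Hc _).1|apply: le_trans (He _).1];
    rewrite (ler_pM2r mk10) !ge_min lexx ?orbT//.
set b := C * (H * mu k) ^+ 2 in g1 g2 g3 key.
have bb0 : 0 <= b by rewrite mulr_ge0 ?sqr_ge0// ltW.
have mb : m%:R * b <= N1 * b by rewrite ler_wpM2r// /N1 -addrA lerDl addr_ge0.
have pb : p%:R * b <= N1 * b.
  by rewrite ler_wpM2r// /N1 (addrC m%:R) -addrA lerDl addr_ge0.
have b1' : b <= N1 * b.
  by rewrite -[leLHS]mul1r ler_wpM2r// /N1 lerDr addr_ge0.
apply: (residual_stopping bb0 _ _ _ _ g1 g2 g3 g4).
(* Here [lo < 1] supplies the strict inequality that positivity of the products depends on. *)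
- apply: (le_lt_trans (le_trans b1' key)).
  by rewrite -[ltRHS]mul1r ltr_pM2r.
- exact: le_trans (le_trans b1' key) k1.
- exact: le_trans (le_trans mb key) k2.
- exact: le_trans (le_trans pb key) k3.
Qed.
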